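(* There is an algorithm that, given a construction sequence of an $n$-vertex graph $G$ with radius-1 width $d$, solves All-Pairs Shortest Path on $G$ in time $O(dn^2\log n)$.
   Context: A construction sequence of a graph $G$ with vertex set $V$ is a sequence $(\mathcal P_1,E_1,N_1),\dots,(\mathcal P_m,E_m,N_m)$ where each $\mathcal P_i$ is a partition of $V$ and $E_i,N_i\subseteq\binom V2$; initially $\mathcal P_1$ is the partition into singletons and $E_1=N_1=\emptyset$, and each step is obtained from the previous by one of: merge (replace two parts $A,B\in\mathcal P_i$ by $A\cup B$); resolve positively (for parts $A,B$, possibly $A=B$, set $E_{i+1}=E_i\cup(AB\setminus N_i)$, where $AB$ is the set of pairs with one element in $A$ and one in $B$); resolve negatively (set $N_{i+1}=N_i\cup(AB\setminus E_i)$). The constructed graph is $(V,E_m)$, which must equal $G$. With $R_i=E_i\cup N_i$, the radius-$r$ width of the sequence is $\max_{i}\max_{v\in V}$ of the number of parts of $\mathcal P_i$ intersecting the ball of radius $r$ around $v$ in the graph $(V,R_i)$. All-Pairs Shortest Path asks for all pairwise distances in $G$ (unweighted).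
   Formalization: The time bound is O(dn^2 log n) plus the number of steps of the construction sequence that change nothing; such idle steps can pad a sequence of fixed n and d to any length, so the bound fails literally without this term. Steps are input by kind and part representatives. *)

(* Defs.v *)
From mathcomp Require Import all_boot.
Set Implicit Arguments.
Unset Strict Implicit.
Unset Printing Implicit Defensive.

(** * Walks, distances, balls *)

Definition walk (T : finType) (e : rel T) (x y : T) (k : nat) : bool :=
  [exists p : k.-tuple T, path e x p && (last x p == y)].

Definition is_dist (T : finType) (e : rel T) (x y : T) (k : nat) : Prop :=
  walk e x y k /\ forall j, walk e x y j -> k <= j.

Definition ball (T : finType) (e : rel T) (r : nat) (v : T) : {set T} :=
  [set u | [exists k : 'I_r.+1, walk e v u k]].

(** * Construction sequences

    Unordered pairs of vertices are two-element sets. *)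

Definition edge_set (T : finType) (e : rel T) : {set {set T}} :=
  [set f | [exists x, exists y, e x y && (f == [set x; y])]].

Definition pairs (T : finType) (A B : {set T}) : {set {set T}} :=
  [set f | [exists a in A, exists b in B, (a != b) && (f == [set a; b])]].

(** A triple (P, E, N). *)
Definition state (T : finType) : Type :=
  ({set {set T}} * {set {set T}} * {set {set T}})%type.

Definition parts (T : finType) (s : state T) : {set {set T}} := s.1.1.
Definition pos (T : finType) (s : state T) : {set {set T}} := s.1.2.
Definition neg (T : finType) (s : state T) : {set {set T}} := s.2.

Definition init (T : finType) : state T := ([set [set v] | v : T], set0, set0).

Definition resolved (T : finType) (s : state T) : rel T :=
  fun x y => [set x; y] \in pos s :|: neg s.

Variant kind := Merge | Positive | Negative.

Definition step (T : finType) (k : kind) (A B : {set T}) (s s' : state T) : Prop :=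
  [/\ A \in parts s, B \in parts s &
   match k with
   | Merge =>
       A != B /\ s' = ((A :|: B) |: (parts s :\ A :\ B), pos s, neg s)
   | Positive =>
       s' = (parts s, pos s :|: (pairs A B :\: neg s), neg s)
   | Negative =>
       s' = (parts s, pos s, neg s :|: (pairs A B :\: pos s))
   end].

Definition construction_sequence (T : finType) (e : rel T) (cs : seq (state T)) : Prop :=
  [/\ cs = init T :: behead cs,
      forall i, i.+1 < size cs ->
        exists k A B, step k A B (nth (init T) cs i) (nth (init T) cs i.+1)
    & pos (last (init T) cs) = edge_set e].

Definition width (T : finType) (r : nat) (cs : seq (state T)) : nat :=
  \max_(s <- cs) \max_(v : T)
    #|[set A in parts s | A :&: ball (resolved s) r v != set0]|.

(** Resolving parts between which every pair is already resolved leaves the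
    triple unchanged, so the width does not bound the length of a construction
    sequence; the radius-1 width and #|T| together only bound the number of the other steps. *)
Definition idle_steps (T : finType) (cs : seq (state T)) : nat :=
  \sum_(i < (size cs).-1) (nth (init T) cs i == nth (init T) cs i.+1).

(** In the input of an algorithm, a step is given by its kind and by arbitrary
    representatives of the two parts involved. *)
Definition op (T : finType) : Type := (kind * T * T)%type.

Definition describes (T : finType) (ops : seq (op T)) (cs : seq (state T)) : Prop :=
  size cs = (size ops).+1 /\
  forall (i : nat) (k : kind) (a b : T), onth ops i = Some (k, a, b) ->
    let s := nth (init T) cs i in
    step k (pblock (parts s) a) (pblock (parts s) b) s (nth (init T) cs i.+1).

(** * Word RAM

    Programs over registers and a randomly accessed memory, both indexed by
    [nat].  Every instruction and every evaluation of a test takes one unit of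
    time.  Words are the naturals below [W]: there is no transition that writes
    a number [>= W] to a register, so a program that overflows has no execution.
    Memory cells only receive contents of registers, and addresses are contents
    of registers. *)

Variant arith := Add | Sub | Mul | Div.

Definition eval (o : arith) : nat -> nat -> nat :=
  match o with Add => addn | Sub => subn | Mul => muln | Div => divn end.

Inductive prog :=
| Const of nat & nat            (* R[r] := k *)
| Arith of arith & nat & nat & nat  (* R[r] := R[a] o R[b] *)
| Read of nat & nat             (* R[r] := M[R[a]] *)
| Write of nat & nat            (* M[R[a]] := R[b] *)
| Seq of prog & prog
| If of nat & nat & prog & prog (* if R[a] < R[b] *)
| While of nat & nat & prog.    (* while R[a] < R[b] *)

Record store := Mk { reg : nat -> nat; mem : nat -> nat }.

Definition upd (f : nat -> nat) (i v : nat) : nat -> nat :=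
  fun j => if j == i then v else f j.

Definition set_reg (s : store) (r v : nat) : store := Mk (upd (reg s) r v) (mem s).
Definition set_mem (s : store) (i v : nat) : store := Mk (reg s) (upd (mem s) i v).

(** [exec W p s t s']: started in [s], the program [p] halts in [s'] after
    exactly [t] units of time. *)
Inductive exec (W : nat) : prog -> store -> nat -> store -> Prop :=
| exec_const r k s :
    k < W -> exec W (Const r k) s 1 (set_reg s r k)
| exec_arith o r a b s :
    eval o (reg s a) (reg s b) < W ->
    exec W (Arith o r a b) s 1 (set_reg s r (eval o (reg s a) (reg s b)))
| exec_load r a s :
    mem s (reg s a) < W ->
    exec W (Read r a) s 1 (set_reg s r (mem s (reg s a)))
| exec_store a b s :
    exec W (Write a b) s 1 (set_mem s (reg s a) (reg s b))
| exec_seq p q s1 t1 s2 t2 s3 :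
    exec W p s1 t1 s2 -> exec W q s2 t2 s3 -> exec W (Seq p q) s1 (t1 + t2) s3
| exec_if_true a b p q s t s' :
    reg s a < reg s b -> exec W p s t s' -> exec W (If a b p q) s t.+1 s'
| exec_if_false a b p q s t s' :
    reg s b <= reg s a -> exec W q s t s' -> exec W (If a b p q) s t.+1 s'
| exec_while_true a b p s1 t1 s2 t2 s3 :
    reg s1 a < reg s1 b -> exec W p s1 t1 s2 -> exec W (While a b p) s2 t2 s3 ->
    exec W (While a b p) s1 (t1 + t2).+1 s3
| exec_while_false a b p s :
    reg s b <= reg s a -> exec W (While a b p) s 1 s.

(** * Input and output of the algorithm *)

Definition kind_code (k : kind) : nat :=
  match k with Merge => 0 | Positive => 1 | Negative => 2 end.

Definition op_code (n : nat) (o : op 'I_n) : seq nat :=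
  let: (k, a, b) := o in [:: kind_code k; nat_of_ord a; nat_of_ord b].

Definition input (n : nat) (ops : seq (op 'I_n)) : seq nat :=
  n :: size ops :: flatten [seq op_code o | o <- ops].

Definition initial_store (w : seq nat) : store := Mk (fun=> 0) (nth 0 w).

(** Words of [c * log2 (n + l + 2)] bits, where [l] is the number of steps. *)
Definition word_bound (n : nat) (ops : seq (op 'I_n)) (c : nat) : nat :=
  (n + size ops + 2) ^ c.

(** The distance matrix is stored row by row from the address in register 0 on.
    The infinite distance is written [n], which is never a finite distance. *)
Definition holds_distances (n : nat) (e : rel 'I_n) (s : store) : Prop :=
  forall x y : 'I_n,
    let w := mem s (reg s 0 + x * n + y) in
    is_dist e x y w \/ ((forall k, ~~ walk e x y k) /\ w = n).

(* Main.v *)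
(* The first step that is not a merge and acts on the parts of two vertices
   decides whether they are adjacent; it is found for all pairs in O(n^2) by
   recursion over pairs of nodes of the merge forest.  Call a step effective if
   it is not a merge and its two parts were not resolved against each other
   before.  Two parts resolved against each other are within distance 1, so at
   any time at most dn pairs of current parts are resolved, and a merge loses at
   most 4d of them: there are at most 5dn effective steps.

   Order the vertices so that every part that ever occurs is an interval.  Place
   the rows of the adjacency matrix at the leaves of a complete binary tree of
   depth L, let U_q be the set of common neighbours of the leaves below the node
   q, and S_q the difference of U_q and U of the parent of q.  The neighbourhood
   of a leaf is the disjoint union of the S_q over its ancestors q.  If a
   maximal interval of S_q starts right after y, some effective step has a part
   separating y from y+1 while its other part meets the rows below the parent of
   q without containing all of them.  As parts are intervals, each effective step
   accounts for O(L) such pairs (q, y), so all S_q together consist of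
   O(d n log n) intervals.

   A breadth-first search scans S_q for every ancestor q of a vertex leaving the
   queue, once for each q, and jumps over visited vertices by means of a
   union-find structure on intervals that relabels the smaller half.  It takes
   O(d n log n) per source. *)

From mathcomp Require Import all_boot zify.
Require Import Defs.
Set Implicit Arguments.
Unset Strict Implicit.
Unset Printing Implicit Defensive.

(** One step on parts A and B changes the neighbourhood of every vertex of A, so storing the
    neighbourhoods one by one as intervals could cost |A| intervals per step. In the tree, the
    interval A cuts only nodes on the two paths from the root to its ends, and only children of cut
    nodes are charged: if all rows below the parent p of q lie in one part when they first meet the
    columns y and y+1, they have equal entries in each of these columns, so U_p and U_q agree there
    and S_q contains neither. This is why S_q leaves out U of the parent. The width enters through
    the number of effective steps alone. The parts resolved against a given part all meet the ball
    around any one of its vertices, so each row and each column of the table of resolved pairs of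
    current parts has at most d entries, and a merge deletes two rows and two columns. The exponent
    of the word bound is dictated by the program: its time is polynomial in n plus the number of
    steps, a value gains at most a constant per unit of time, and since the base is at least 2, a
    constant factor can be absorbed into the exponent. *)

(* The algorithm is written in a language without addition: a value grows by at
   most the size of the program per unit of time, so a time bound also excludes
   overflows after compilation. *)
Inductive exp :=
| EVar of nat
| ECst of nat
| EGet of nat & exp & exp
| EInp of exp
| ESuc of exp
| ESub of exp & exp
| EHalf of exp.

Inductive cmd :=
| CSkip
| CSet of nat & exp
| CPut of nat & exp & exp & exp
| COut of exp & exp
| CSeq of cmd & cmd
| CIf of exp & exp & cmd & cmd
| CWhile of exp & exp & cmd.

Record st := St {
  var : nat -> nat;
  arr : nat -> nat -> nat -> nat;
  out : nat -> nat;
  tm : nat }.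

Definition tick (s : st) : st := St (var s) (arr s) (out s) (tm s).+1.

Definition aupd (f : nat -> nat -> nat -> nat) (a i j v : nat) : nat -> nat -> nat -> nat :=
  fun a' => if a' == a then fun i' j' => if (i' == i) && (j' == j) then v else f a i' j'
            else f a'.

Fixpoint ev (inp : nat -> nat) (s : st) (e : exp) : nat :=
  match e with
  | EVar x => var s x
  | ECst k => k
  | EGet a e1 e2 => arr s a (ev inp s e1) (ev inp s e2)
  | EInp e => inp (ev inp s e)
  | ESuc e => (ev inp s e).+1
  | ESub e1 e2 => ev inp s e1 - ev inp s e2
  | EHalf e => ev inp s e %/ 2
  end.

Inductive run (inp : nat -> nat) : cmd -> st -> st -> Prop :=
| run_skip s : run inp CSkip s (tick s)
| run_set x e s :
    run inp (CSet x e) s (St (upd (var s) x (ev inp s e)) (arr s) (out s) (tm s).+1)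
| run_put a e1 e2 e3 s :
    run inp (CPut a e1 e2 e3) s
      (St (var s) (aupd (arr s) a (ev inp s e1) (ev inp s e2) (ev inp s e3)) (out s) (tm s).+1)
| run_out e1 e2 s :
    run inp (COut e1 e2) s
      (St (var s) (arr s) (upd (out s) (ev inp s e1) (ev inp s e2)) (tm s).+1)
| run_seq c1 c2 s1 s2 s3 :
    run inp c1 s1 s2 -> run inp c2 s2 s3 -> run inp (CSeq c1 c2) s1 s3
| run_if e1 e2 c1 c2 s s' :
    run inp (if ev inp s e1 < ev inp s e2 then c1 else c2) (tick s) s' ->
    run inp (CIf e1 e2 c1 c2) s s'
| run_while_true e1 e2 c s1 s2 s3 :
    ev inp s1 e1 < ev inp s1 e2 -> run inp c (tick s1) s2 ->
    run inp (CWhile e1 e2 c) s2 s3 -> run inp (CWhile e1 e2 c) s1 s3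
| run_while_false e1 e2 c s :
    ev inp s e2 <= ev inp s e1 -> run inp (CWhile e1 e2 c) s (tick s).

Lemma run_tm inp c s s' : run inp c s s' -> tm s <= tm s'.
Proof. elim=> //=; lia. Qed.

(** * Compilation *)

(* The weight of a constant is related to its value because [csize] bounds the
   growth of values, too. *)
Fixpoint esize (e : exp) : nat :=
  match e with
  | EVar _ => 1
  | ECst k => k.+1
  | EGet _ e1 e2 => (esize e1 + esize e2).+1
  | EInp e => (esize e).+1
  | ESuc e => (esize e).+1
  | ESub e1 e2 => (esize e1 + esize e2).+1
  | EHalf e => (esize e).+1
  end.

Fixpoint csize (c : cmd) : nat :=
  match c with
  | CSkip => 1
  | CSet _ e => (esize e).+1
  | CPut _ e1 e2 e3 => (esize e1 + esize e2 + esize e3).+1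
  | COut e1 e2 => (esize e1 + esize e2).+1
  | CSeq c1 c2 => csize c1 + csize c2
  | CIf e1 e2 c1 c2 => (esize e1 + esize e2 + csize c1 + csize c2).+1
  | CWhile e1 e2 c => (esize e1 + esize e2 + csize c).+1
  end.

Fixpoint earrays (k : nat) (e : exp) : bool :=
  match e with
  | EVar _ | ECst _ => true
  | EGet a e1 e2 => [&& a < k, earrays k e1 & earrays k e2]
  | EInp e | ESuc e | EHalf e => earrays k e
  | ESub e1 e2 => earrays k e1 && earrays k e2
  end.

Fixpoint carrays (k : nat) (c : cmd) : bool :=
  match c with
  | CSkip => true
  | CSet _ e => earrays k e
  | CPut a e1 e2 e3 => [&& a < k, earrays k e1, earrays k e2 & earrays k e3]
  | COut e1 e2 => earrays k e1 && earrays k e2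
  | CSeq c1 c2 => carrays k c1 && carrays k c2
  | CIf e1 e2 c1 c2 => [&& earrays k e1, earrays k e2, carrays k c1 & carrays k c2]
  | CWhile e1 e2 c => [&& earrays k e1, earrays k e2 & carrays k c]
  end.

(* Variables live in the odd registers.  Registers 0, 2, 4, 6 hold the base of
   the output, the base of the arrays, the row stride and the number [k] of
   arrays; the even registers from 8 on are temporaries.  Entry (i, j) of
   array a sits at base + (i * stride + j) * k + a. *)
Definition vreg (x : nat) : nat := x.*2.+1.

Definition caddr (a r : nat) : prog :=
  Seq (Arith Mul r r 4) (Seq (Arith Add r r r.+2)
  (Seq (Arith Mul r r 6) (Seq (Const r.+2 a) (Seq (Arith Add r r r.+2) (Arith Add r r 2))))).

(** A copy is an addition to 0, there being no move instruction. The test in the case [EInp] guards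
    against reading the arrays, which occupy the memory from the end of the input on, where [inp] is
    0. *)
Fixpoint cexp (e : exp) (r : nat) : prog :=
  match e with
  | EVar x => Seq (Const r 0) (Arith Add r r (vreg x))
  | ECst k => Const r k
  | EGet a e1 e2 =>
      Seq (cexp e1 r) (Seq (cexp e2 r.+2) (Seq (caddr a r) (Read r r)))
  | EInp e => Seq (cexp e r) (If r 2 (Read r r) (Const r 0))
  | ESuc e => Seq (cexp e r) (Seq (Const r.+2 1) (Arith Add r r r.+2))
  | ESub e1 e2 => Seq (cexp e1 r) (Seq (cexp e2 r.+2) (Arith Sub r r r.+2))
  | EHalf e => Seq (cexp e r) (Seq (Const r.+2 2) (Arith Div r r r.+2))
  end.

Fixpoint compile (c : cmd) : prog :=
  match c with
  | CSkip => Const 8 0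
  | CSet x e => Seq (cexp e 8) (Seq (Const (vreg x) 0) (Arith Add (vreg x) (vreg x) 8))
  | CPut a e1 e2 e3 =>
      Seq (cexp e1 8) (Seq (cexp e2 10) (Seq (cexp e3 12) (Seq (Const 14 0)
      (Seq (Arith Add 14 14 12) (Seq (caddr a 8) (Write 8 14))))))
  | COut e1 e2 => Seq (cexp e1 8) (Seq (cexp e2 10) (Seq (Arith Add 8 8 0) (Write 8 10)))
  | CSeq c1 c2 => Seq (compile c1) (compile c2)
  | CIf e1 e2 c1 c2 => Seq (cexp e1 8) (Seq (cexp e2 10) (If 8 10 (compile c1) (compile c2)))
  | CWhile e1 e2 c =>
      Seq (Seq (cexp e1 8) (cexp e2 10))
          (While 8 10 (Seq (compile c) (Seq (cexp e1 8) (cexp e2 10))))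
  end.

Section Compilation.

Variables (inp : nat -> nat) (base k B outb W : nat).

Definition addr (a i j : nat) : nat := (i * B.+1 + j) * k + a + base.

Definition bounded (s : st) (b : nat) : Prop :=
  (forall x, var s x <= b) /\ (forall a i j, arr s a i j <= b).

Definition repr (s : st) (m : store) : Prop :=
  [/\ forall x, reg m (vreg x) = var s x,
      [/\ reg m 0 = outb, reg m 2 = base, reg m 4 = B.+1 & reg m 6 = k],
      forall a i j, a < k -> i <= B -> j <= B -> mem m (addr a i j) = arr s a i j,
      forall i, i < base -> mem m i = inp i
    & forall i, i <= B -> mem m (outb + i) = out s i].

Definition lwp (p : prog) (m : store) (T : nat) (Q : store -> Prop) : Prop :=
  exists t m', [/\ exec W p m t m', t <= T & Q m'].

Lemma lwp_le T' p m T (Q : store -> Prop) : T' <= T -> lwp p m T' Q -> lwp p m T Q.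
Proof. by move=> HT [t [m' [H1 H2 H3]]]; exists t, m'; split=> //; lia. Qed.

Lemma lwp_seq p q m T1 T2 (Q : store -> Prop) :
  lwp p m T1 (fun m' => lwp q m' T2 Q) -> lwp (Seq p q) m (T1 + T2) Q.
Proof.
move=> [t1 [m1 [H1 L1 [t2 [m2 [H2 L2 HQ]]]]]].
by exists (t1 + t2), m2; split=> //; [exact: exec_seq H1 H2 | lia].
Qed.

Lemma lwp_const r v m (Q : store -> Prop) :
  v < W -> Q (set_reg m r v) -> lwp (Const r v) m 1 Q.
Proof. by move=> h HQ; exists 1, (set_reg m r v); split=> //; exact: exec_const. Qed.

Lemma lwp_arith o r a b m (Q : store -> Prop) :
  eval o (reg m a) (reg m b) < W -> Q (set_reg m r (eval o (reg m a) (reg m b))) ->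
  lwp (Arith o r a b) m 1 Q.
Proof. by move=> h HQ; eexists 1, _; split=> //; [exact: exec_arith | ]. Qed.

Lemma lwp_read r a m (Q : store -> Prop) :
  mem m (reg m a) < W -> Q (set_reg m r (mem m (reg m a))) -> lwp (Read r a) m 1 Q.
Proof. by move=> h HQ; eexists 1, _; split=> //; [exact: exec_load | ]. Qed.

Lemma lwp_write a b m (Q : store -> Prop) :
  Q (set_mem m (reg m a) (reg m b)) -> lwp (Write a b) m 1 Q.
Proof. by move=> HQ; exists 1, (set_mem m (reg m a) (reg m b)); split=> //; constructor. Qed.

Lemma lwp_if a b p q m T (Q : store -> Prop) :
  lwp (if reg m a < reg m b then p else q) m T Q -> lwp (If a b p q) m T.+1 Q.
Proof.
case: ltnP => h [t [m' [H1 H2 H3]]]; exists t.+1, m'; split=> //.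
  exact: exec_if_true.
exact: exec_if_false.
Qed.

Hypothesis k_gt0 : 0 < k.
Hypothesis inp_out : forall i, base <= i -> inp i = 0.
Hypothesis outb_ge : addr 0 B.+1 0 <= outb.
Hypothesis W_gt : outb + B.+2 < W.

Lemma addr_lt a i j : a < k -> i <= B -> j <= B -> addr a i j < outb.
Proof.
move=> ak iB jB; apply: leq_trans outb_ge; rewrite /addr addn0.
have: i * B.+1 + j < B.+1 * B.+1 by nia.
by move=> h; nia.
Qed.

Lemma addr_inj a i j a' i' j' : a < k -> a' < k -> j <= B -> j' <= B ->
  addr a i j = addr a' i' j' -> [/\ a = a', i = i' & j = j'].
Proof.
rewrite /addr => ak ak' jB jB' /addIn e.
have e1 : a = a' by have := congr1 (modn^~ k) e; rewrite !modnMDl !modn_small.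
move: e; rewrite e1 => /addIn /eqP; rewrite eqn_pmul2r // => /eqP e.
have e2 : j = j'.
  by have := congr1 (modn^~ B.+1) e; rewrite !modnMDl !modn_small.
move: e; rewrite e2 => /addIn /eqP; rewrite eqn_pmul2r // => /eqP e.
by split.
Qed.

Definition saves (r : nat) (m m' : store) : Prop :=
  mem m' = mem m /\ forall q, odd q || (q < r) -> reg m' q = reg m q.

Lemma saves_trans r r' m1 m2 m3 :
  saves r m1 m2 -> saves r' m2 m3 -> r <= r' -> saves r m1 m3.
Proof.
move=> [a1 b1] [a2 b2] rr; split; first by rewrite a2.
by move=> q hq; rewrite b2 ?b1 //; case: (odd q) hq => //=; lia.
Qed.

Lemma saves_repr r s m m' : 8 <= r -> repr s m -> saves r m m' -> repr s m'.
Proof.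
move=> r8 [h1 [p1 p2 p3 p4] h2 h3 h4] [em er]; split; rewrite ?em //.
  by move=> x; rewrite er // /vreg /= odd_double.
by rewrite !er //; lia.
Qed.

Lemma ev_bound s b e : bounded s b -> (forall i, inp i <= b) -> ev inp s e <= b + esize e.
Proof.
move=> [bv ba] bi.
elim: e => //=.
- by move=> x; have := bv x; lia.
- lia.
- by move=> a e1 _ e2 _; have := ba a (ev inp s e1) (ev inp s e2); lia.
- by move=> e _; have := bi (ev inp s e); lia.
- lia.
- lia.
- move=> e h; have := leq_div (ev inp s e) 2; lia.
Qed.

Lemma lwp_addr a r m (Q : store -> Prop) :
  ~~ odd r -> 8 <= r -> a < k -> reg m r <= B -> reg m r.+2 <= B ->
  [/\ reg m 2 = base, reg m 4 = B.+1 & reg m 6 = k] ->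
  (forall m', mem m' = mem m -> (forall q, q != r -> q != r.+2 -> reg m' q = reg m q) ->
     reg m' r = addr a (reg m r) (reg m r.+2) -> Q m') ->
  lwp (caddr a r) m 6 Q.
Proof.
move=> or r8 ak h1 h2 [g2 g4 g6] HQ.
have L := addr_lt ak h1 h2.
rewrite /addr in L.
have rr : (r == r.+2) = false by lia.
have rr' : (r.+2 == r) = false by lia.
have r2 : (2 == r) = false by lia.
have r4 : (4 == r) = false by lia.
have r6 : (6 == r) = false by lia.
have r2' : (2 == r.+2) = false by lia.
have r6' : (6 == r.+2) = false by lia.
(* Intermediate results do not overflow: as [k] is positive, the unscaled index is at most the final
   address. *)
have X : reg m r * B.+1 + reg m r.+2 <= (reg m r * B.+1 + reg m r.+2) * k by nia.
rewrite /caddr.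
do 5! [apply: (@lwp_seq _ _ _ 1);
  (apply: lwp_arith || apply: lwp_const);
  rewrite /= /upd ?eqxx ?rr ?rr' ?r2 ?r4 ?r6 ?r2' ?r6' ?g2 ?g4 ?g6; first by lia].
apply: lwp_arith; rewrite /= /upd ?eqxx ?rr ?rr' ?r2 ?r4 ?r6 ?r2' ?r6' ?g2 ?g4 ?g6; first by lia.
apply: HQ => //=; last by rewrite /upd eqxx /addr.
by move=> q /negbTE qr /negbTE qr2; rewrite /upd qr qr2.
Qed.

Lemma saves_but2 r m m' :
  ~~ odd r -> mem m' = mem m -> (forall q, q != r -> q != r.+2 -> reg m' q = reg m q) ->
  saves r m m'.
Proof.
move=> ro em er; split=> // q hq; apply: er; apply/eqP => e; move: hq; rewrite e ?(negbTE ro) //=.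
  by rewrite ltnn.
by rewrite negbK (negbTE ro); lia.
Qed.

Lemma saves_set r q m v : ~~ odd r -> ~~ odd q -> r <= q -> saves r m (set_reg m q v).
Proof.
move=> ro qo rq; split=> //= x hx; rewrite /upd; case: eqP => // e.
by move: hx; rewrite e (negbTE qo) ltnNge rq.
Qed.

Lemma lwp_exp e r m s b (Q : store -> Prop) :
  earrays k e -> bounded s b -> (forall i, inp i <= b) -> b + esize e <= B ->
  ~~ odd r -> 8 <= r -> repr s m ->
  (forall m', saves r m m' -> reg m' r = ev inp s e -> Q m') ->
  lwp (cexp e r) m (12 * esize e) Q.
Proof.
move=> + bs bi; elim: e r m Q => [x|c|a e1 IH1 e2 IH2|e IH|e IH|e1 IH1 e2 IH2|e IH] r m Q /=.
- move=> _ hB ro r8 R HQ.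
  have [h _ _ _ _] := R; have := bs.1 x => bx.
  apply: (@lwp_le (1 + 1)) => //.
  have ne : (vreg x == r) = false.
    by apply/eqP => q; move: ro; rewrite -q /vreg /= odd_double.
  apply: lwp_seq; apply: lwp_const; first by lia.
  apply: lwp_arith; rewrite /= /upd eqxx ne h add0n; first by lia.
  apply: HQ; last by rewrite /= /upd eqxx.
  by apply: (@saves_trans r r _ (set_reg m r 0)) => //; exact: saves_set.
- move=> _ hB ro r8 R HQ; apply: (@lwp_le 1) => //.
  apply: lwp_const; first by lia.
  by apply: HQ; [exact: saves_set | rewrite /= /upd eqxx].
- case/and3P=> ak k1 k2 hB ro r8 R HQ.
  apply: (@lwp_le (12 * esize e1 + (12 * esize e2 + (6 + 1)))) => //; first by lia.
  apply/lwp_seq/IH1 => //; first by lia.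
  move=> m1 S1 E1; apply/lwp_seq/IH2 => //; [lia | lia | lia | exact: saves_repr S1 |].
  move=> m2 S2 E2.
  have S12 : saves r m m2 by apply: saves_trans S1 S2 _; lia.
  have [h1 hs h2 h3 h4] := saves_repr r8 R S12.
  have E1' : reg m2 r = ev inp s e1 by rewrite S2.2 //; lia.
  have B1 := @ev_bound s b e1 bs bi; have B2 := @ev_bound s b e2 bs bi.
  apply/lwp_seq/lwp_addr => //; [lia | lia | by case: hs |].
  move=> m3 M3 R3; rewrite E1' E2 => E3; have S3 := saves_but2 ro M3 R3.
  have [g1 gs g2 g3 g4] := saves_repr r8 R (saves_trans S12 S3 (leqnn _)).
  have B3 := bs.2 a (ev inp s e1) (ev inp s e2).
  have E4 : mem m3 (reg m3 r) = arr s a (ev inp s e1) (ev inp s e2) by rewrite E3 g2 //; lia.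
  apply: lwp_read; rewrite E4; first by lia.
  apply: HQ; last by rewrite /= /upd eqxx.
  by apply: (saves_trans S12 _ (leqnn r)); apply: (saves_trans S3 _ (leqnn r)); exact: saves_set.
- move=> ke hB ro r8 R HQ.
  apply: (@lwp_le (12 * esize e + 2)) => //; first by lia.
  apply/lwp_seq/IH => //; first by lia.
  move=> m1 S1 E1.
  have [h1 [hs hs2 _ _] h2 h3 h4] := saves_repr r8 R S1.
  apply: lwp_if; rewrite E1 hs2; case: ltnP => h.
    apply: lwp_read; rewrite E1 h3 //; first by have := bi (ev inp s e); lia.
    apply: HQ; last by rewrite /= /upd eqxx.
    by apply: (saves_trans S1 _ (leqnn r)); exact: saves_set.
  apply: lwp_const; first by lia.
  apply: HQ; last by rewrite /= /upd eqxx inp_out.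
  by apply: (saves_trans S1 _ (leqnn r)); exact: saves_set.
- move=> ke hB ro r8 R HQ.
  apply: (@lwp_le (12 * esize e + (1 + 1))) => //; first by lia.
  apply/lwp_seq/IH => //; first by lia.
  move=> m1 S1 E1; have B1 := @ev_bound s b e bs bi.
  have ne : (r == r.+2) = false by lia.
  apply: lwp_seq; apply: lwp_const; first by lia.
  apply: lwp_arith; rewrite /= /upd eqxx ne E1 addn1; first by lia.
  apply: HQ; last by rewrite /= /upd eqxx.
  apply: (saves_trans S1 _ (leqnn r)).
  apply: (@saves_trans r r _ (set_reg m1 r.+2 1)) => //; apply: saves_set => //=; lia.
- case/andP=> k1 k2 hB ro r8 R HQ.
  apply: (@lwp_le (12 * esize e1 + (12 * esize e2 + 1))) => //; first by lia.
  apply/lwp_seq/IH1 => //; first by lia.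
  move=> m1 S1 E1; apply/lwp_seq/IH2 => //; [lia | lia | lia | exact: saves_repr S1 |].
  move=> m2 S2 E2.
  have S12 : saves r m m2 by apply: saves_trans S1 S2 _; lia.
  have E1' : reg m2 r = ev inp s e1 by rewrite S2.2 //; lia.
  have B1 := @ev_bound s b e1 bs bi.
  apply: lwp_arith; rewrite /= E1' E2; first by lia.
  apply: HQ; last by rewrite /= /upd eqxx.
  by apply: (saves_trans S12 _ (leqnn r)); exact: saves_set.
- move=> ke hB ro r8 R HQ.
  apply: (@lwp_le (12 * esize e + (1 + 1))) => //; first by lia.
  apply/lwp_seq/IH => //; first by lia.
  move=> m1 S1 E1; have B1 := @ev_bound s b e bs bi.
  have ne : (r == r.+2) = false by lia.
  apply: lwp_seq; apply: lwp_const; first by lia.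
  apply: lwp_arith; rewrite /= /upd eqxx ne E1; first by have := leq_div (ev inp s e) 2; lia.
  apply: HQ; last by rewrite /= /upd eqxx.
  apply: (saves_trans S1 _ (leqnn r)).
  apply: (@saves_trans r r _ (set_reg m1 r.+2 2)) => //; apply: saves_set => //=; lia.
Qed.

Lemma bounded_le s b b' : bounded s b -> b <= b' -> bounded s b'.
Proof.
by move=> [h1 h2] bb; split=> [x|a i j]; [move: (h1 x) | move: (h2 a i j)] => /leq_trans; apply.
Qed.

Lemma lwp_exp2 e1 e2 m s b (Q : store -> Prop) :
  earrays k e1 -> earrays k e2 -> bounded s b -> (forall i, inp i <= b) ->
  b + esize e1 <= B -> b + esize e2 <= B -> repr s m ->
  (forall m', repr s m' -> reg m' 8 = ev inp s e1 -> reg m' 10 = ev inp s e2 -> Q m') ->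
  lwp (Seq (cexp e1 8) (cexp e2 10)) m (12 * esize e1 + 12 * esize e2) Q.
Proof.
move=> k1 k2 bs bi h1 h2 R HQ.
apply: lwp_seq; apply: (lwp_exp k1 bs bi) => // m1 S1 E1.
have R1 := saves_repr (leqnn 8) R S1.
apply: (lwp_exp k2 bs bi h2 _ _ R1) => // m2 S2 E2.
by apply: HQ => //; [apply: saves_repr R1 S2 | rewrite S2.2].
Qed.

Lemma lwp_assoc p q r m T Q : lwp (Seq (Seq p q) r) m T Q -> lwp (Seq p (Seq q r)) m T Q.
Proof.
move=> [t [m' [H L HQ]]].
inversion H as [| | | |? ? ? t1 ? t2 ? H1 H2| | | |]; subst.
inversion H1 as [| | | |? ? ? t3 ? t4 ? H3 H4| | | |]; subst.
exists (t3 + (t4 + t2)), m'; rewrite addnA; split=> //.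
by rewrite -addnA; exact: (exec_seq H3 (exec_seq H4 H2)).
Qed.

Lemma vreg_inj : injective vreg.
Proof. by move=> x y /eqP; rewrite eqSS => /eqP /double_inj. Qed.

Lemma vreg_odd q x : ~~ odd q -> (q == vreg x) = false.
Proof. by move=> qo; apply/eqP => e; move: qo; rewrite e /= odd_double. Qed.

Lemma repr_set s m x v :
  repr s m -> repr (St (upd (var s) x v) (arr s) (out s) (tm s).+1) (set_reg m (vreg x) v).
Proof.
move=> [h1 hs h2 h3 h4]; split=> //=; last by rewrite /upd !vreg_odd.
by move=> y; rewrite /upd (inj_eq vreg_inj); case: eqP.
Qed.

Lemma repr_ext s m m' :
  repr s m -> mem m' = mem m -> (forall q, reg m' q = reg m q) -> repr s m'.
Proof. by move=> [h1 hs h2 h3 h4] em er; split=> *; rewrite ?em ?er; auto. Qed.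

Lemma repr_put s m a i j v (m' : store) :
  a < k -> i <= B -> j <= B -> repr s m -> (forall q, odd q || (q < 8) -> reg m' q = reg m q) ->
  mem m' = upd (mem m) (addr a i j) v ->
  repr (St (var s) (aupd (arr s) a i j v) (out s) (tm s).+1) m'.
Proof.
move=> ak iB jB [h1 [s1 s2 s3 s4] h2 h3 h4] er em; split=> /=.
- by move=> x; rewrite er // /vreg /= odd_double.
- by rewrite !er.
- move=> a' i' j' ak' iB' jB'; rewrite em /upd /aupd.
  case: eqP => [/(addr_inj ak' ak jB' jB) [-> -> ->]|ne]; first by rewrite !eqxx.
  case: eqP => [ea|_] /=; last by rewrite h2.
  case: andP => [[/eqP ei /eqP ej]|_]; last by rewrite ea h2.
  by case: ne; rewrite ea ei ej.
- move=> q hq; rewrite em /upd; case: eqP => [eq|_]; last exact: h3.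
  by move: hq; rewrite eq /addr; lia.
- move=> q hq; rewrite em /upd; case: eqP => [eq|_]; last exact: h4.
  by have := addr_lt ak iB jB; lia.
Qed.

Lemma repr_out s m i v (m' : store) :
  i <= B -> repr s m -> (forall q, odd q || (q < 8) -> reg m' q = reg m q) ->
  mem m' = upd (mem m) (outb + i) v ->
  repr (St (var s) (arr s) (upd (out s) i v) (tm s).+1) m'.
Proof.
move=> iB [h1 [s1 s2 s3 s4] h2 h3 h4] er em; split=> /=.
- by move=> x; rewrite er // /vreg /= odd_double.
- by rewrite !er.
- move=> a' i' j' ak' iB' jB'; rewrite em /upd.
  by case: eqP => [eq|_]; [have := addr_lt ak' iB' jB'; lia | rewrite h2].
- move=> q hq; rewrite em /upd; case: eqP => [eq|_]; last exact: h3.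
  by move: outb_ge; rewrite /addr; lia.
- by move=> q hq; rewrite em /upd eqn_add2l; case: eqP => // _; exact: h4.
Qed.

Lemma repr_tick s m : repr s m -> repr (tick s) m.
Proof. by case=> *; split. Qed.

(** At any time all values are at most [b0 + Z * tm], hence at most [B] until the end of the run:
    indices stay inside the arrays and nothing reaches [W]. An array access takes at most 9
    instructions besides its subexpressions, so 12 per unit of size and time suffice. *)
Lemma compile_correct Z b0 c s s' m :
  run inp c s s' -> csize c <= Z -> carrays k c -> (forall i, inp i <= b0) ->
  b0 + Z * tm s' <= B -> repr s m -> bounded s (b0 + Z * tm s) ->
  lwp (compile c) m (12 * Z * (tm s' - tm s))
      (fun m' => repr s' m' /\ bounded s' (b0 + Z * tm s')).
Proof.
move=> Hr + + bi; elim: Hr m => {c s s'}.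
- move=> s m /= cz _ hB R bs.
  apply: (@lwp_le 1); first by nia.
  apply: lwp_const; first by lia.
  split; last by apply: bounded_le bs _; nia.
  by apply: repr_tick; apply: (saves_repr (leqnn 8) R); exact: saves_set.
- move=> x e s m /= cz ke hB R bs.
  have bi' i : inp i <= b0 + Z * tm s by have := bi i; lia.
  have be := ev_bound e bs bi'.
  apply: (@lwp_le (12 * esize e + (1 + 1))); first by nia.
  apply: lwp_seq.
  apply: (lwp_exp ke bs bi') => //; first by nia.
  move=> m1 S1 E1; apply: lwp_seq; apply: lwp_const; first by lia.
  have n8 : (8 == vreg x) = false by exact: vreg_odd.
  apply: lwp_arith; rewrite /= {1 2}/upd eqxx /upd n8 E1 add0n; first by nia.
  split; last first.
    split=> /=; last by move=> a i j; have := bs.2 a i j; nia.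
    by move=> y; rewrite /upd; case: eqP => _; [nia | have := bs.1 y; nia].
  apply: (repr_ext (repr_set x (ev inp s e) (saves_repr (leqnn 8) R S1))) => //= q.
  by rewrite /upd; case: eqP.
- move=> a e1 e2 e3 s m /= cz /and4P[ak k1 k2 k3] hB R bs.
  have bi' i : inp i <= b0 + Z * tm s by have := bi i; lia.
  have be1 := ev_bound e1 bs bi'; have be2 := ev_bound e2 bs bi'; have be3 := ev_bound e3 bs bi'.
  apply: (@lwp_le (12 * esize e1 + (12 * esize e2 + (12 * esize e3 + (1 + (1 + (6 + 1))))))).
    by nia.
  apply: lwp_seq.
  apply: (lwp_exp k1 bs bi') => //; first by nia.
  move=> m1 S1 E1; have R1 := saves_repr (leqnn 8) R S1; apply: lwp_seq.
  apply: (lwp_exp k2 bs bi' _ _ _ R1) => //; first by nia.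
  move=> m2 S2 E2; have R2 := saves_repr (isT : 8 <= 10) R1 S2; apply: lwp_seq.
  apply: (lwp_exp k3 bs bi' _ _ _ R2) => //; first by nia.
  move=> m3 S3 E3; have R3 := saves_repr (isT : 8 <= 12) R2 S3.
  apply: lwp_seq; apply: lwp_const; first by lia.
  apply: lwp_seq; apply: lwp_arith; rewrite /= /upd /= E3 add0n; first by nia.
  have S34 : saves 14 m3 (set_reg (set_reg m3 14 0) 14 (ev inp s e3)).
    by apply: (saves_trans (r' := 14) (m2 := set_reg m3 14 0)) => //; exact: saves_set.
  have R4 := saves_repr (isT : 8 <= 14) R3 S34.
  have E84 : reg m3 8 = ev inp s e1 by rewrite S3.2 // S2.2.
  have E104 : reg m3 10 = ev inp s e2 by rewrite S3.2.
  apply: lwp_seq; apply: lwp_addr => //=; rewrite /upd /= ?E84 ?E104; [nia | nia | by have [_ [] ] := R3 |].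
  move=> m5 M5 G5 E5; have R5 := saves_repr (leqnn 8) R4
    (@saves_but2 8 (set_reg (set_reg m3 14 0) 14 (ev inp s e3)) m5 isT M5 G5).
  apply: lwp_write; split; last first.
    split=> /=; first by move=> y; have := bs.1 y; nia.
    move=> a' i j; rewrite /aupd; case: eqP => _; last by have := bs.2 a' i j; nia.
    by case: ifP => _; [nia | have := bs.2 a i j; nia].
  have G14 : reg m5 14 = ev inp s e3 by rewrite G5.
  have M8 : mem m5 = mem m3 by rewrite M5.
  apply: (repr_ext (m := Mk (reg m5) (upd (mem m5) (addr a (ev inp s e1) (ev inp s e2)) (ev inp s e3)))).
  + by apply: (repr_put ak _ _ R5) => //; nia.
  + by rewrite /= E5 G14.
  + by [].
- move=> e1 e2 s m /= cz /andP[k1 k2] hB R bs.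
  have bi' i : inp i <= b0 + Z * tm s by have := bi i; lia.
  have be1 := ev_bound e1 bs bi'; have be2 := ev_bound e2 bs bi'.
  apply: (@lwp_le (12 * esize e1 + (12 * esize e2 + (1 + 1)))); first by nia.
  apply: lwp_seq; apply: (lwp_exp k1 bs bi') => //; first by nia.
  move=> m1 S1 E1; have R1 := saves_repr (leqnn 8) R S1; apply: lwp_seq.
  apply: (lwp_exp k2 bs bi' _ _ _ R1) => //; first by nia.
  move=> m2 S2 E2; have R2 := saves_repr (isT : 8 <= 10) R1 S2.
  have E82 : reg m2 8 = ev inp s e1 by rewrite S2.2.
  have E0 : reg m2 0 = outb by case: R2 => _ [].
  apply: lwp_seq; apply: lwp_arith; rewrite /= E82 E0; first by nia.
  apply: lwp_write; split; last first.
    split=> /=; first by move=> y; have := bs.1 y; nia.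
    by move=> a i j; have := bs.2 a i j; nia.
  have R3 := saves_repr (leqnn 8) R2 (@saves_set 8 8 m2 (ev inp s e1 + outb) isT isT (leqnn 8)).
  apply: (repr_out _ R3) => //=; first by nia.
  by rewrite /upd /= E2 addnC.
- move=> c1 c2 s1 s2 s3 r1 IH1 r2 IH2 m /= cz /andP[k1 k2] hB R bs.
  have t1 := run_tm r1; have t2 := run_tm r2.
  apply: (@lwp_le (12 * Z * (tm s2 - tm s1) + 12 * Z * (tm s3 - tm s2))); first by nia.
  apply: lwp_seq; have [||t [m' [h1 h2 [h3 h4]]]] := IH1 m _ k1 _ R bs; [lia | nia |].
  by exists t, m'; split=> //; apply: IH2 => //; lia.
- move=> e1 e2 c1 c2 s s' r1 IH m /= cz /and4P[k1 k2 kc1 kc2] hB R bs.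
  have t1 := run_tm r1; rewrite /= in t1.
  have bi' i : inp i <= b0 + Z * tm s by have := bi i; lia.
  apply: (@lwp_le (12 * esize e1 + 12 * esize e2 + (12 * Z * (tm s' - (tm s).+1)).+1)); first by nia.
  apply: lwp_assoc; apply: lwp_seq; apply: (lwp_exp2 k1 k2 bs bi' _ _ R); [nia | nia |].
  move=> m1 R1 E1 E2; apply: lwp_if; rewrite E1 E2.
  have bs' : bounded (tick s) (b0 + Z * (tm s).+1) by apply: bounded_le bs _; nia.
  move: IH; case: ifP => _ IH; apply: IH => //; try (exact: repr_tick); lia.
- move=> e1 e2 c s1 s2 s3 lt r1 IH1 r2 IH2 m /= cz /and3P[k1 k2 kc] hB R bs.
  have t1 := run_tm r1; have t2 := run_tm r2; rewrite /= in t1.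
  have bi' i : inp i <= b0 + Z * tm s1 by have := bi i; lia.
  have bs' : bounded (tick s1) (b0 + Z * (tm s1).+1) by apply: bounded_le bs _; nia.
  apply: (@lwp_le (12 * esize e1 + 12 * esize e2 + (12 * Z * (tm s2 - (tm s1).+1)
     + 12 * Z * (tm s3 - tm s2)).+1)); first by nia.
  apply: lwp_seq; apply: (lwp_exp2 k1 k2 bs bi' _ _ R); [nia | nia |].
  move=> m1 R1 E1 E2.
  have [||t [m' [h1 h2 [h3 h4]]]] := IH1 m1 _ kc _ (repr_tick R1) bs'; [lia | nia |].
  have [|||t' [m'' [g1 g2 g3]]] := IH2 m' _ _ _ h3 h4;
    [exact: cz | by rewrite /= k1 k2 | exact: hB |].
  (* The compiled loop evaluates its test once in front and again at the end of each body. The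
     evaluation that opens the remaining run is therefore the one that closes this iteration. *)
  inversion g1 as [| | | |? ? ? u1 m2 u2 ? j1 j2| | | |]; subst.
  exists (t + u1 + u2).+1, m''; split=> //; first last.
    by rewrite /= in h2; lia.
  by apply: exec_while_true (exec_seq h1 j1) j2; rewrite E1 E2.
- move=> e1 e2 c s le m /= cz /and3P[k1 k2 kc] hB R bs.
  have bi' i : inp i <= b0 + Z * tm s by have := bi i; lia.
  apply: (@lwp_le (12 * esize e1 + 12 * esize e2 + 1)); first by nia.
  apply: lwp_seq; apply: (lwp_exp2 k1 k2 bs bi' _ _ R); [nia | nia |].
  move=> m1 R1 E1 E2; exists 1, m1; split=> //.
    by apply: exec_while_false; rewrite E1 E2.
  by split; [exact: repr_tick | apply: bounded_le bs _; nia].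
Qed.
End Compilation.

(** * The merge forest *)

(* Nodes of the forest are numbered in order of creation, the leaves being the
   vertices; [nn] is the next fresh node, [pid v] the root above [v], and [par] is
   0 at roots.  [opc i j] is the kind of the step that resolved the nodes [i] and
   [j] (0 if there is none).  [col] is not stored by the program: 1 for the pairs
   in E, 2 for those in N, 0 for the others. *)
Record model := Model {
  pid : nat -> nat;
  par : nat -> nat;
  opc : nat -> nat -> nat;
  nn : nat;
  col : nat -> nat -> nat }.

Section Model.

Variable n : nat.

Definition code (o : op 'I_n) : nat := kind_code o.1.1.

Definition covers (m : model) (o : op 'I_n) (x y : nat) : bool :=
  (pid m x == pid m o.1.2) && (pid m y == pid m o.2) ||
  (pid m x == pid m o.2) && (pid m y == pid m o.1.2).

Definition mmerge (m : model) (A B : nat) : model :=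
  Model (fun v => if (pid m v == A) || (pid m v == B) then nn m else pid m v)
        (upd (upd (par m) A (nn m)) B (nn m)) (opc m) (nn m).+1 (col m).

(** The first colour of a pair is final, because a positive step spares N and a negative step spares
    E. In the same way only the first step between two nodes is recorded. *)
Definition mresolve (m : model) (A B c : nat) : model :=
  Model (pid m) (par m)
    (if opc m A B == 0 then
       fun i j => if (i == A) && (j == B) || (i == B) && (j == A) then c else opc m i j
     else opc m)
    (nn m)
    (fun x y => if col m x y != 0 then col m x y else
       if (pid m x == A) && (pid m y == B) || (pid m x == B) && (pid m y == A) then c else 0).

Definition mstep (m : model) (o : op 'I_n) : model :=
  if code o == 0 then mmerge m (pid m o.1.2) (pid m o.2)
  else mresolve m (pid m o.1.2) (pid m o.2) (code o).

Definition minit : model := Model id (fun=> 0) (fun _ _ => 0) n (fun _ _ => 0).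

Definition final (m : model) (ops : seq (op 'I_n)) : model := foldl mstep m ops.

(** [wf_col] ties the table of nodes to the colours of pairs. It shows that resolving the same two
    nodes again is idle, and that a step reaching an uncoloured pair is effective. *)
Record wf (m : model) : Prop := Wf {
  wf_pid : forall v : 'I_n, pid m v < nn m;
  wf_root : forall v : 'I_n, par m (pid m v) = 0;
  wf_par : forall i, par m i != 0 -> (i < nn m) && (i < par m i < nn m);
  wf_opcC : forall i j, opc m i j = opc m j i;
  wf_opc : forall i j, opc m i j != 0 -> i < nn m;
  wf_nn : n <= nn m;
  wf_col : forall x y : 'I_n, opc m (pid m x) (pid m y) != 0 -> col m x y != 0 }.

Lemma wf_opcr m i j : wf m -> opc m i j != 0 -> j < nn m.
Proof. by move=> w; rewrite wf_opcC //; exact: wf_opc. Qed.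

Lemma wf_init : wf minit.
Proof. by split=> //= v; exact: ltn_ord. Qed.

Lemma wf_merge m (a b : 'I_n) : wf m -> wf (mmerge m (pid m a) (pid m b)).
Proof.
move=> w; have wp := wf_pid w; split=> /=.
- by move=> v; case: ifP => _; [| have := wp v]; lia.
- move=> v; rewrite /upd; have [_|/norP[ha hb]] := boolP ((pid m v == pid m a) || _).
    rewrite !ifN; try (have := wp a; have := wp b; lia).
    by apply/eqP; apply: contraT => /(wf_par w); lia.
  by rewrite (negbTE ha) (negbTE hb); exact: wf_root.
- move=> i; rewrite /upd; case: (i =P pid m b) => [->|_]; first by have := wp b; lia.
  case: (i =P pid m a) => [->|_]; first by have := wp a; lia.
  by move/(wf_par w); lia.
- exact: wf_opcC.
- by move=> i j /(wf_opc w); lia.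
- by have := wf_nn w; lia.
- move=> x y; case: ifP => _; first by move/(wf_opc w); lia.
  case: ifP => _; first by move/(wf_opcr w); lia.
  exact: wf_col.
Qed.

Lemma wf_resolve m (a b : 'I_n) c : 0 < c -> wf m -> wf (mresolve m (pid m a) (pid m b) c).
Proof.
move=> c0 w; have wp := wf_pid w; split=> /=; try by case: w.
- move=> i j; case: ifP => _; last exact: wf_opcC.
  by rewrite orbC (andbC (i == _)) (andbC (j == _)) [in X in if _ then _ else X]wf_opcC // andbC
    [X in _ || X]andbC [X in X || _]andbC.
- move=> i j; case: ifP => _; last exact: wf_opc.
  by case: ifP => [/orP[] /andP[/eqP -> _] _|_]; [exact: wp | exact: wp | exact: wf_opc].
- move=> x y; case: ifP => _ h; last first.
    by rewrite (wf_col w h) (wf_col w h).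
  case: ifP => // /negbFE /eqP h0.
  move: h; case: ifP => [_|_ /(wf_col w)]; [lia | by rewrite h0].
Qed.

Lemma wf_step m o : wf m -> wf (mstep m o).
Proof.
rewrite /mstep => w; case: (code o =P 0) => [_|/eqP h]; first exact: wf_merge.
by apply: wf_resolve => //; rewrite lt0n.
Qed.

Lemma wf_final m ops : wf m -> wf (final m ops).
Proof. by elim: ops m => //= o ops IH m w; apply/IH/wf_step. Qed.

Lemma par_step m o i : wf m -> par m i != 0 -> par (mstep m o) i = par m i.
Proof.
rewrite /mstep => w h; case: (code o =P 0) => [_|_] //=; rewrite /upd.
by rewrite !ifN //; apply: contra h => /eqP ->; rewrite wf_root.
Qed.

Lemma par_final m ops i : wf m -> par m i != 0 -> par (final m ops) i = par m i.
Proof.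
elim: ops m => //= o ops IH m w h; rewrite IH ?par_step //; exact: wf_step.
Qed.

(** The number [nn m] serves as a common parent of the final roots, so that the recursion over pairs
    ends at [(nn m, nn m)]. *)
Definition parf (m : model) (i : nat) : nat := if par m i == 0 then nn m else par m i.

Lemma nn_step m o : nn m <= nn (mstep m o).
Proof. by rewrite /mstep; case: (code o =P 0) => _ /=. Qed.

(** Numbers are given out in order of creation, so the parent of a present root has not been created
    yet. *)
Lemma parf_ge m ops (v : 'I_n) : wf m -> nn m <= parf (final m ops) (pid m v).
Proof.
elim: ops m => [|o ops IH] m w /=; first by rewrite /parf wf_root.
have [e|ne] := eqVneq (pid (mstep m o) v) (pid m v).
  by rewrite -e; apply: leq_trans (nn_step _ o) (IH _ (wf_step _ w)).
have h : par (mstep m o) (pid m v) = nn m.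
  move: ne; rewrite /mstep; case: (code o =P 0) => _ /=; rewrite /upd ?eqxx //.
  have [/orP[/eqP ->|/eqP ->]|_] := boolP ((pid m v == pid m o.1.2) || (pid m v == pid m o.2));
    rewrite ?eqxx //= => _.
  by case: ifP.
have nz : nn m != 0 by rewrite -lt0n (leq_trans _ (wf_pid w v)).
rewrite /parf par_final ?h ?(negbTE nz) ?h //; exact: wf_step.
Qed.

Lemma opc_step m o i j : wf m -> opc m i j != 0 -> opc (mstep m o) i j = opc m i j.
Proof.
move=> w; rewrite /mstep; case: (code o =P 0) => _ //=; case: ifP => //= /eqP h h'.
case: ifP => //; case/orP=> /andP[/eqP ei /eqP ej].
  by rewrite ei ej h in h'.
by rewrite ei ej wf_opcC // h in h'.
Qed.

Lemma opc_final m ops i j : wf m -> opc m i j != 0 -> opc (final m ops) i j = opc m i j.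
Proof.
elim: ops m => //= o ops IH m w h; rewrite IH ?opc_step //; exact: wf_step.
Qed.

(** Steps act on roots only and numbers are never reused, so the row of a node that has been merged
    away is frozen. *)
Lemma opc_dead m ops i j : wf m -> i < nn m -> (forall v : 'I_n, pid m v != i) ->
  opc (final m ops) i j = opc m i j.
Proof.
elim: ops m => //= o ops IH m w lt h; rewrite IH.
- rewrite /mstep; case: (code o =P 0) => _ //=; case: ifP => // _.
  by rewrite !(eq_sym i) (negbTE (h _)) (negbTE (h _)).
- exact: wf_step.
- exact: leq_trans lt (nn_step _ _).
- move=> v; rewrite /mstep; case: (code o =P 0) => _ //=; case: ifP => // _; lia.
Qed.

(* First colour: the kind of the first resolving step that covers the pair. *)
Fixpoint fc (m : model) (ops : seq (op 'I_n)) (x y : nat) : nat :=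
  if ops is o :: ops' then
    if (code o != 0) && covers m o x y then code o else fc (mstep m o) ops' x y
  else 0.

Lemma col_final m ops x y :
  col (final m ops) x y = if col m x y != 0 then col m x y else fc m ops x y.
Proof.
elim: ops m => [|o ops IH] m /=; first by case: eqP => // ->.
rewrite IH /mstep /covers; case: (code o =P 0) => h //=.
case: (col m x y =P 0) => c0 /=; last by rewrite (introN eqP c0).
by case: (_ || _) => //; rewrite (introN eqP h).
Qed.

(** The node with the smaller parent is merged first, and the pair passes on to that parent. Equal
    parents mean siblings, two final roots, or twice the same node; in each case the next pair to
    look at is the parent with itself. *)
Definition tabF (m : model) (F : nat -> nat -> nat) : Prop :=
  F (nn m) (nn m) = 0 /\
  forall i j, i < nn m -> j < nn m ->
    F i j = if opc m i j != 0 then opc m i j else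
            if parf m i < parf m j then F (parf m i) j else
            if parf m j < parf m i then F i (parf m j) else F (parf m i) (parf m i).

Lemma parf_merged m o ops (v : 'I_n) : wf m -> code o = 0 ->
  (pid m v == pid m o.1.2) || (pid m v == pid m o.2) ->
  parf (final (mstep m o) ops) (pid m v) = nn m.
Proof.
move=> w c0 h.
have nz : nn m != 0 by rewrite -lt0n (leq_trans _ (wf_pid w v)).
have e : par (mstep m o) (pid m v) = nn m.
  by rewrite /mstep c0 /= /upd; case/orP: h => /eqP ->; rewrite ?eqxx //; case: ifP.
by rewrite /parf par_final ?e ?(negbTE nz) ?e //; exact: wf_step.
Qed.

Lemma nn_final m ops : nn m <= nn (final m ops).
Proof. by elim: ops m => //= o ops IH m; apply: leq_trans (nn_step _ _) (IH _). Qed.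

(** Induction over the steps still to come, with the table of the final forest fixed and read at the
    present roots. A resolving step is an entry of the table, and a merge that concerns the pair is
    one unfolding of the recursion. *)
Lemma tabF_fc m ops F (x y : 'I_n) : wf m -> tabF (final m ops) F ->
  F (pid m x) (pid m y) =
  if opc m (pid m x) (pid m y) != 0 then opc m (pid m x) (pid m y) else fc m ops x y.
Proof.
move=> w [F0 FE]; elim: ops m w F0 FE => [|o ops IH] m w F0 FE /=.
  have wp := wf_pid w.
  by rewrite FE // /parf !wf_root //= ltnn F0.
have w' := wf_step o w.
have wp (v : 'I_n) : pid m v < nn (final (mstep m o) ops).
  by apply: leq_trans (wf_pid w v) _; apply: leq_trans (nn_step _ o) (nn_final _ _).
have IH' := IH _ w' F0 FE.
case: ifP => [nz|/negbFE /eqP z].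
  have nz' : opc (mstep m o) (pid m x) (pid m y) != 0 by rewrite opc_step.
  by rewrite FE // (@opc_final _ ops _ _ w' nz') nz' opc_step.
case c0: (code o == 0); last first.
  have pE (v : 'I_n) : pid (mstep m o) v = pid m v by rewrite /mstep c0.
  have oE : opc (mstep m o) (pid m x) (pid m y) = if covers m o x y then code o else 0.
    rewrite /mstep c0 /= /covers; case: ifP => [_|nz] //=; case: ifP => // cv.
    by case/orP: cv z => /andP[/eqP -> /eqP ->] => e; move: nz; rewrite ?e // (wf_opcC w) e.
  move: IH'; rewrite !pE oE => ->.
  by case: (covers m o x y) => //=; rewrite c0.
move/eqP: c0 => c0 /=.
have pE (v : 'I_n) : pid (mstep m o) v =
    if (pid m v == pid m o.1.2) || (pid m v == pid m o.2) then nn m else pid m v.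
  by rewrite /mstep c0.
have oE : opc (mstep m o) = opc m by rewrite /mstep c0.
have lte : nn (mstep m o) = (nn m).+1 by rewrite /mstep c0.
have dead (v : 'I_n) : (pid m v == pid m o.1.2) || (pid m v == pid m o.2) ->
    forall j, opc (final (mstep m o) ops) (pid m v) j = opc m (pid m v) j.
  move=> hv j; rewrite opc_dead ?oE //.
    by case/orP: hv => /eqP ->; rewrite lte; apply: leq_trans (wf_pid w _) _.
  move=> u; rewrite pE; case: ifP => [_|].
    by case/orP: hv => /eqP ->; have := wf_pid w o.1.2; have := wf_pid w o.2; lia.
  by move=> hu; apply/eqP => e; rewrite e hv in hu.
have fresh i j : (i == nn m) || (j == nn m) -> opc m i j = 0.
  move=> h; apply/eqP; apply: contraT => hn.
  by have := wf_opc w hn; have := wf_opcr w hn; lia.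
have ge (v : 'I_n) : ~~ ((pid m v == pid m o.1.2) || (pid m v == pid m o.2)) ->
    nn m < parf (final (mstep m o) ops) (pid m v).
  by move=> hv; have := parf_ge ops v w'; rewrite pE (negbTE hv) lte.
move: IH'; rewrite !pE oE.
have [hx|hx] := boolP ((pid m x == pid m o.1.2) || (pid m x == pid m o.2));
have [hy|hy] := boolP ((pid m y == pid m o.1.2) || (pid m y == pid m o.2)).
- rewrite fresh ?eqxx //= => <-.
  by rewrite FE // dead // z /= !parf_merged // ltnn.
- rewrite fresh ?eqxx //= => <-.
  by rewrite FE // dead // z /= (parf_merged _ _ c0) // ge.
- rewrite fresh ?eqxx ?orbT //= => <-.
  rewrite FE // wf_opcC ?dead //; last exact: wf_final.
  by rewrite wf_opcC // z /= (parf_merged _ (v := y) _ c0) // ltnNge (ltnW (ge _ hx)) ge.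
- by rewrite z.
Qed.


(** * A vertex order in which all parts are intervals *)

Lemma pid_step_eq m o x y : pid m x = pid m y -> pid (mstep m o) x = pid (mstep m o) y.
Proof. by rewrite /mstep; case: (code o =P 0) => _ //= ->. Qed.

Lemma pid_final_eq m ops x y : pid m x = pid m y -> pid (final m ops) x = pid (final m ops) y.
Proof. by elim: ops m => //= o ops IH m /(pid_step_eq o); exact: IH. Qed.

(** On the vertices this is the order of the leaves in a traversal of the forest: siblings and final
    roots are compared by number, other nodes through their ancestors, by the same recursion as in
    [tabF]. *)
Definition tabG (m : model) (G : nat -> nat -> bool) : Prop :=
  forall i j, i < nn m -> j < nn m ->
    G i j = if parf m i < parf m j then G (parf m i) j else
            if parf m j < parf m i then G i (parf m j) else i < j.

Lemma tabG_step m o ops G (x y : 'I_n) : wf m -> tabG (final m (o :: ops)) G ->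
  pid m x != pid m y ->
  G (pid m x) (pid m y) =
  if pid (mstep m o) x == pid (mstep m o) y then pid m x < pid m y
  else G (pid (mstep m o) x) (pid (mstep m o) y).
Proof.
move=> w GE ne; have w' := wf_step o w.
have wp (v : 'I_n) : pid m v < nn (final (mstep m o) ops).
  by apply: leq_trans (wf_pid w v) _; apply: leq_trans (nn_step _ o) (nn_final _ _).
case c0: (code o == 0); last first.
  have pE (v : 'I_n) : pid (mstep m o) v = pid m v by rewrite /mstep c0.
  by rewrite !pE (negbTE ne).
move/eqP: c0 => c0 /=.
have pE (v : 'I_n) : pid (mstep m o) v =
    if (pid m v == pid m o.1.2) || (pid m v == pid m o.2) then nn m else pid m v.
  by rewrite /mstep c0.
have lte : nn (mstep m o) = (nn m).+1 by rewrite /mstep c0.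
have ge (v : 'I_n) : ~~ ((pid m v == pid m o.1.2) || (pid m v == pid m o.2)) ->
    nn m < parf (final (mstep m o) ops) (pid m v).
  by move=> hv; have := parf_ge ops v w'; rewrite pE (negbTE hv) lte.
have wx := wf_pid w x; have wy := wf_pid w y.
rewrite !pE.
have [hx|hx] := boolP ((pid m x == pid m o.1.2) || (pid m x == pid m o.2));
have [hy|hy] := boolP ((pid m y == pid m o.1.2) || (pid m y == pid m o.2)).
- by rewrite eqxx GE // !parf_merged // ltnn.
- by rewrite gtn_eqF // GE // (parf_merged _ _ c0) // ge.
- rewrite ltn_eqF // GE // (parf_merged _ (v := y) _ c0) //.
  by rewrite ltnNge (ltnW (ge _ hx)) ge.
- by rewrite (negbTE ne).
Qed.

(** While two vertices lie in different parts, comparing them amounts to comparing the parts. This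
    makes every part that occurs convex. *)
Lemma tabG_prefix m ops1 ops2 G (x y : 'I_n) : wf m -> tabG (final m (ops1 ++ ops2)) G ->
  pid (final m ops1) x != pid (final m ops1) y ->
  G (pid m x) (pid m y) = G (pid (final m ops1) x) (pid (final m ops1) y).
Proof.
elim: ops1 m => //= o ops1 IH m w GE ne.
have ne' : pid (mstep m o) x != pid (mstep m o) y.
  by apply: contra ne => /eqP /(pid_final_eq ops1) ->.
rewrite (tabG_step w GE) ?(negbTE ne'); first exact: IH (wf_step _ w) GE ne.
by apply: contra ne' => /eqP /(pid_step_eq o) ->.
Qed.

Lemma tabG_irr m ops G (x : 'I_n) : wf m -> tabG (final m ops) G ->
  G (pid m x) (pid m x) = false.
Proof.
move=> w GE; rewrite GE; [by rewrite ltnn ltnn|..];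
  exact: leq_trans (wf_pid w x) (nn_final _ _).
Qed.

(** Backwards over the steps: the nodes before a step are ordered like their successors after it,
    except that the two nodes being merged are compared by number. *)
Lemma tabG_order m ops G : wf m -> tabG (final m ops) G ->
  (forall x y : 'I_n, pid m x != pid m y -> G (pid m x) (pid m y) = ~~ G (pid m y) (pid m x)) /\
  (forall x y z : 'I_n, G (pid m x) (pid m y) -> G (pid m y) (pid m z) -> G (pid m x) (pid m z)).
Proof.
elim: ops m => [|o ops IH] m w GE.
  have E (x y : 'I_n) : G (pid m x) (pid m y) = (pid m x < pid m y).
    by rewrite GE ?wf_pid // /parf !wf_root //= ltnn.
  by split=> [x y|x y z]; rewrite !E; lia.
have [tot trans] := IH _ (wf_step o w) GE.
have S (x y : 'I_n) := @tabG_step m o ops G x y w GE.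
have I (x : 'I_n) := tabG_irr x w GE.
split=> [x y ne|x y z].
  rewrite (S x y) // (S y x) 1?eq_sym // (eq_sym (pid (mstep m o) y)); case: eqP => [_|/eqP ne']; last exact: tot.
  by move: ne; lia.
have [->|nxy] := eqVneq (pid m x) (pid m y); first by rewrite I.
have [->|nyz] := eqVneq (pid m y) (pid m z); first by rewrite I.
rewrite (S x y) // (S y z) //.
have [exz|nxz] := eqVneq (pid m x) (pid m z).
  have e' := pid_step_eq o exz.
  rewrite exz !e' eq_sym; case: eqP => [_|/eqP ne']; first by lia.
  by rewrite tot 1?eq_sym // => /negbTE ->.
rewrite S //; case: eqP => [e1|/eqP n1]; case: eqP => [e2|/eqP n2].
- by rewrite e1 e2 eqxx; lia.
- by rewrite e1 (negbTE n2).
- by rewrite -e2 (negbTE n1).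
- move=> h1 h2; case: eqP => [e3|_]; last exact: trans h1 h2.
  by move: h1; rewrite e3 tot ?h2 // eq_sym.
Qed.

Definition rank (G : nat -> nat -> bool) (x : nat) : nat := #|[set y : 'I_n | G y x]|.

Section Order.

Variables (ops : seq (op 'I_n)) (G : nat -> nat -> bool).
Hypothesis GE : tabG (final minit ops) G.

Lemma G_trans (x y z : 'I_n) : G x y -> G y z -> G x z.
Proof. by have [_ h] := tabG_order wf_init GE; exact: h. Qed.

Lemma G_irr (x : 'I_n) : G x x = false.
Proof. exact: (tabG_irr x wf_init GE). Qed.

Lemma G_total (x y : 'I_n) : x != y -> G x y = ~~ G y x.
Proof. by have [h _] := tabG_order wf_init GE; exact: h. Qed.

Lemma rank_lt (x y : 'I_n) : G x y -> rank G x < rank G y.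
Proof.
move=> h; apply: proper_card; apply/properP; split.
  by apply/subsetP => z; rewrite !inE => /G_trans; apply.
by exists x; rewrite !inE // G_irr.
Qed.

Lemma rank_ltE (x y : 'I_n) : (rank G x < rank G y) = G x y.
Proof.
have [->|ne] := eqVneq x y; first by rewrite ltnn G_irr.
apply/idP/idP; last exact: rank_lt.
by apply: contraLR; rewrite (G_total ne) negbK => /rank_lt; lia.
Qed.

Lemma rank_ltn (x : 'I_n) : rank G x < n.
Proof.
rewrite -[X in _ < X]card_ord -cardsT; apply: proper_card.
by rewrite properT; apply/eqP => /setP /(_ x); rewrite !inE G_irr.
Qed.

Lemma rank_inj (x y : 'I_n) : rank G x = rank G y -> x = y.
Proof.
move=> e; apply/eqP; apply: contraT => ne.
by have := G_total ne; rewrite -!rank_ltE e ltnn.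
Qed.

Lemma rank_surj i : i < n -> exists x : 'I_n, rank G x = i.
Proof.
move=> lt; pose f (x : 'I_n) := Ordinal (rank_ltn x).
have fi : injective f by move=> x y /(congr1 val) /rank_inj.
exists (invF fi (Ordinal lt)).
by have := f_invF fi (Ordinal lt) => /(congr1 val).
Qed.

Lemma rank_convex i (x y z : 'I_n) : let m := final minit (take i ops) in
  rank G x < rank G z < rank G y -> pid m x = pid m y -> pid m z = pid m x.
Proof.
move=> m; rewrite !rank_ltE => /andP[xz zy] e; apply/eqP; apply: contraT => ne.
have P (u v : 'I_n) : pid m u != pid m v -> G u v = G (pid m u) (pid m v).
  by move=> h; apply: (@tabG_prefix minit (take i ops) (drop i ops) _ _ _ wf_init); rewrite ?cat_take_drop.
have ne' : z != y by apply: contra ne => /eqP ->; rewrite e.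
(* [x] and [y] share a part that does not contain [z], so [z] is on the same side of both. *)
have: G x z = ~~ G z y by rewrite -(G_total (x := y)) 1?eq_sym // !P -?e // eq_sym.
by rewrite xz zy.
Qed.

End Order.

(** * Simulation of the construction sequence *)

Definition blk (m : model) (v : 'I_n) : {set 'I_n} := [set w : 'I_n | pid m w == pid m v].

Record sim (m : model) (s : state 'I_n) : Prop := Sim {
  sim_parts : parts s = [set blk m v | v : 'I_n];
  sim_pos : forall x y : 'I_n, x != y -> ([set x; y] \in pos s) = (col m x y == 1);
  sim_neg : forall x y : 'I_n, x != y -> ([set x; y] \in neg s) = (col m x y == 2);
  sim_col : forall x y : 'I_n, col m x y <= 2 }.

Lemma set2_eq (x y a b : 'I_n) : x != y ->
  ([set x; y] == [set a; b]) = (x == a) && (y == b) || (x == b) && (y == a).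
Proof.
move=> ne; apply/eqP/idP => [e|/orP[/andP[/eqP -> /eqP ->]|/andP[/eqP -> /eqP ->]] //]; last exact: setUC.
have hx : x \in [set a; b] by rewrite -e set21.
have hy : y \in [set a; b] by rewrite -e set22.
have ha : a \in [set x; y] by rewrite e set21.
have hb : b \in [set x; y] by rewrite e set22.
move: hx hy ha hb ne; rewrite !inE.
by do 2![case/orP=> /eqP ->]; rewrite ?eqxx ?orbT //= => [_|]; rewrite ?orbb => /eqP ->; rewrite ?eqxx.
Qed.

Lemma in_pairs (x y : 'I_n) (A B : {set 'I_n}) : x != y ->
  ([set x; y] \in pairs A B) = (x \in A) && (y \in B) || (x \in B) && (y \in A).
Proof.
move=> ne; rewrite inE; apply/exists_inP/idP.
  case=> a aA /exists_inP[b bB /andP[ab]]; rewrite set2_eq //.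
  by case/orP=> /andP[/eqP -> /eqP ->]; rewrite aA bB ?orbT.
case/orP=> /andP[hx hy]; [exists x | exists y] => //; apply/exists_inP; [exists y | exists x] => //.
  by rewrite ne eqxx.
by rewrite eq_sym ne setUC eqxx.
Qed.

Lemma blk_eq m (u v : 'I_n) : (blk m u == blk m v) = (pid m u == pid m v).
Proof.
apply/eqP/eqP => [/setP /(_ u)|e]; first by rewrite !inE eqxx => /esym /eqP.
by apply/setP => w; rewrite !inE e.
Qed.

Lemma sim_pblock m s (a : 'I_n) : sim m s -> pblock (parts s) a = blk m a.
Proof.
move=> h; apply: def_pblock; rewrite ?(sim_parts h).
- apply/trivIsetP => _ _ /imsetP[u _ ->] /imsetP[v _ ->].
  rewrite blk_eq => ne; apply/pred0P => w /=; rewrite !inE.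
  by apply/negP => /andP[/eqP e1 /eqP e2]; rewrite -e1 e2 eqxx in ne.
- exact: imset_f.
- by rewrite inE.
Qed.

Lemma pairs_set2 (A B : {set 'I_n}) f : f \in pairs A B -> exists x y, x != y /\ f = [set x; y].
Proof.
by rewrite inE => /exists_inP[a _ /exists_inP[b _ /andP[ab /eqP ->]]]; exists a, b.
Qed.

Lemma sim_init : sim minit (init 'I_n).
Proof.
split=> //= [|x y _|x y _]; rewrite ?inE //.
by apply: eq_imset => v; apply/setP => w; rewrite !inE.
Qed.

Lemma sim_step m s s' (o : op 'I_n) : wf m -> sim m s ->
  step o.1.1 (pblock (parts s) o.1.2) (pblock (parts s) o.2) s s' ->
  sim (mstep m o) s' /\ #|parts s'| + (code o == 0) = #|parts s|.
Proof.
case: o => [[k a] b] w S /=; rewrite !(sim_pblock _ S) /mstep /code /= => -[pA pB].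
case: k => [[ne ->]|->|->] /=.
- split; last first.
    have dis (u : 'I_n) : blk m u = blk m a :|: blk m b -> pid m u = pid m a /\ pid m u = pid m b.
      move=> e; have: a \in blk m u by rewrite e !inE eqxx.
      have: b \in blk m u by rewrite e !inE eqxx orbT.
      by rewrite !inE => /eqP -> /eqP ->.
    rewrite cardsU1 /parts /= -/(parts s) !inE.
    have -> : (blk m a :|: blk m b \in parts s) = false.
      apply/negP; rewrite (sim_parts S) => /imsetP[u _ /esym /dis]; case=> ea eb.
      by move: ne; rewrite blk_eq -ea eb eqxx.
    by rewrite !andbF /= (cardsD1 (blk m a) (parts s)) pA (cardsD1 (blk m b) (parts s :\ _)) !inE
      pB eq_sym ne -addnA (addnC _ 1).
  split=> /=; [|exact: (sim_pos S)|exact: (sim_neg S)|exact: (sim_col S)].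
  apply/setP => X; rewrite /parts /= -/(parts s) !inE.
  have bE (v : 'I_n) : blk (mmerge m (pid m a) (pid m b)) v =
      if (pid m v == pid m a) || (pid m v == pid m b) then blk m a :|: blk m b else blk m v.
    have wp := wf_pid w.
    apply/setP => z; rewrite inE /=; case hv: ((pid m v == _) || _); rewrite !inE.
      by case: ((pid m z == _) || _); [rewrite eqxx | have := wp z; lia].
    case hz: ((pid m z == _) || _) => //.
    have -> : (nn m == pid m v) = false by have := wp v; lia.
    by apply/esym/eqP => e; rewrite e hv in hz.
  apply/orP/imsetP => [[/eqP ->|]|[v _ ->]].
  + by exists a => //; rewrite bE eqxx.
  + case/and3P=> nb na; rewrite (sim_parts S) => /imsetP[v _ e].
    exists v => //; rewrite bE ifN //; apply/norP.
    by move: na nb; rewrite e !blk_eq.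
  + rewrite bE; case: ifP => [_|/negbT/norP[na nb]]; first by left.
    by right; rewrite !blk_eq na nb (sim_parts S) imset_f.
- split; last by rewrite addn0.
  split=> /=; first exact: (sim_parts S).
  + move=> x y ne; rewrite /pos /= -/(pos s) -/(neg s) 2!inE in_pairs // !inE.
    rewrite (sim_pos S) // (sim_neg S) //; have := sim_col S x y; case: (col m x y) => [|[|[|c]]] //= _.
    by case: ifP.
  + move=> x y ne; rewrite (sim_neg S) //; case: (col m x y) => [|[|c]] //=; by case: ifP.
  + by move=> x y; have := sim_col S x y; case: ifP => // _; case: ifP.
- split; last by rewrite addn0.
  split=> /=; first exact: (sim_parts S).
  + move=> x y ne; rewrite (sim_pos S) //; case: (col m x y) => [|[|c]] //=; by case: ifP.
  + move=> x y ne; rewrite /neg /= -/(pos s) -/(neg s) 2!inE in_pairs // !inE.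
    rewrite (sim_pos S) // (sim_neg S) //; have := sim_col S x y; case: (col m x y) => [|[|[|c]]] //= _.
    by case: ifP.
  + by move=> x y; have := sim_col S x y; case: ifP => // _; case: ifP.
Qed.

Definition eff (m : model) (o : op 'I_n) : bool :=
  (code o != 0) && (opc m (pid m o.1.2) (pid m o.2) == 0).

(** By [wf_col] every pair between the two parts has a colour, so the set difference in the step
    contributes nothing new. *)
Lemma sim_idle m s s' (o : op 'I_n) : wf m -> sim m s ->
  step o.1.1 (pblock (parts s) o.1.2) (pblock (parts s) o.2) s s' ->
  code o != 0 -> ~~ eff m o -> s = s'.
Proof.
move=> w S; rewrite !(sim_pblock _ S) /eff => -[_ _ h] c0; rewrite c0 /= => ne.
have P f : f \in pairs (blk m o.1.2) (blk m o.2) -> (f \in pos s) || (f \in neg s).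
  move=> hf; have [x [y [xy ef]]] := pairs_set2 hf.
  move: hf; rewrite {f}ef in_pairs // !inE (sim_pos S) // (sim_neg S) // => hf.
  have: col m x y != 0.
    apply: (wf_col w); case/orP: hf => /andP[/eqP -> /eqP ->] //.
    by rewrite wf_opcC.
  by have := sim_col S x y; lia.
move: h c0; rewrite /code; case: s P S => [[p e] q] P _.
case: o.1.1 => //= -> _; congr (_, _, _); apply/esym/setUidPl/subsetP => f;
  rewrite inE => /andP[nf /P] /=; move: nf; rewrite /pos /neg /= => /negbTE ->; by rewrite ?orbF.
Qed.

Fixpoint esum (m : model) (ops : seq (op 'I_n)) (f : model -> op 'I_n -> nat) : nat :=
  if ops is o :: ops' then f m o + esum (mstep m o) ops' f else 0.

Lemma esum_rcons m ops o f : esum m (rcons ops o) f = esum m ops f + f (final m ops) o.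
Proof. by elim: ops m => [|a ops IH] m /=; rewrite ?addn0 // IH addnA. Qed.

Lemma final_rcons m ops o : final m (rcons ops o) = mstep (final m ops) o.
Proof. by rewrite /final foldl_rcons. Qed.

Lemma esum_le m ops f g :
  (forall ops1 o ops2, ops = ops1 ++ o :: ops2 -> f (final m ops1) o <= g (final m ops1) o) ->
  esum m ops f <= esum m ops g.
Proof.
elim: ops m => //= o ops IH m h; apply: leq_add; first exact: (h [::] o ops).
by apply: IH => ops1 o' ops2 e; have := h (o :: ops1) o' ops2; rewrite /= e; apply.
Qed.

Lemma esum_sum (I : Type) (r : seq I) (P : pred I) m ops (f : I -> model -> op 'I_n -> nat) :
  \sum_(i <- r | P i) esum m ops (f i) = esum m ops (fun m o => \sum_(i <- r | P i) f i m o).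
Proof.
by elim: ops m => [|o ops IH] m /=; rewrite ?big1_eq // big_split /= IH.
Qed.

Lemma esum_muln m ops f c : esum m ops (fun m o => f m o * c) = esum m ops f * c.
Proof. by elim: ops m => //= o ops IH m; rewrite IH mulnDl. Qed.

(** * Counting effective steps *)

Definition live (m : model) (k : nat) : bool := [exists v : 'I_n, pid m v == k].

(* Pairs of current parts that are resolved, hence at distance at most 1. *)
Definition fpair (m : model) (k j : nat) : bool := [&& live m k, live m j & opc m k j != 0].

Definition alive (m : model) : nat := \sum_(k < n + n) \sum_(j < n + n) fpair m k j.

Lemma liveP m k : reflect (exists v : 'I_n, pid m v = k) (live m k).
Proof. by apply: (iffP existsP) => -[v /eqP h]; exists v; rewrite ?h //; apply/eqP. Qed.

Lemma fpairC m k j : wf m -> fpair m k j = fpair m j k.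
Proof. by move=> w; rewrite /fpair wf_opcC // andbCA. Qed.

Definition swidth (r : nat) (s : state 'I_n) : nat :=
  \max_(v : 'I_n) #|[set A in parts s | A :&: ball (resolved s) r v != set0]|.

(** Fix one vertex [v] of the part [k]. Every part [j] resolved against [k] meets the ball of radius
    1 around [v], since [v] itself is resolved against all vertices of [j] other than [v]; distinct
    [j] are distinct parts. *)
Lemma row_le m s k : wf m -> sim m s -> \sum_(j < n + n) fpair m k j <= swidth 1 s.
Proof.
move=> w S; have [/liveP[v ev]|nl] := boolP (live m k); last first.
  by rewrite big1 // => j _; rewrite /fpair (negbTE nl).
apply: leq_trans (leq_bigmax v).
rewrite -[X in X <= _](_ : #|[set j : 'I_(n + n) | fpair m k j]| = _); last first.
  by rewrite -sum1_card big_mkcond /=; apply: eq_bigr => j _; rewrite inE; case: fpair.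
pose g (j : 'I_(n + n)) := [set u : 'I_n | pid m u == j].
have gi : {in [set j : 'I_(n + n) | fpair m k j] &, injective g}.
  move=> j j'; rewrite !inE => /and3P[_ /liveP[u eu] _] _ /setP /(_ u).
  by rewrite !inE eu eqxx => /esym /eqP h; apply: val_inj.
rewrite -(card_in_imset gi); apply/subset_leq_card/subsetP => X /imsetP[j + ->].
rewrite inE => /and3P[_ /liveP[u eu] nz].
have eg : g j = blk m u by apply/setP => z; rewrite !inE eu.
rewrite inE eg (sim_parts S) imset_f //=; apply/set0Pn; exists u.
rewrite !inE eqxx /=; have [->|ne] := eqVneq v u.
  by apply/existsP; exists ord0; apply/existsP; exists [tuple]; rewrite /= eqxx.
apply/existsP; exists (inord 1); rewrite inordK //; apply/existsP; exists [tuple u].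
rewrite /= eqxx andbT andbT /resolved inE (sim_pos S) // (sim_neg S) //.
have: col m v u != 0 by apply: (wf_col w); rewrite ev eu.
by have := sim_col S v u; lia.
Qed.

Lemma alive_le m s : wf m -> sim m s -> alive m <= n * swidth 1 s.
Proof.
move=> w S; apply: (@leq_trans (\sum_(k < n + n) live m k * swidth 1 s)).
  apply: leq_sum => k _; have := row_le k w S; rewrite /fpair.
  by case: (live m k) => /= h; rewrite ?mul1n // big1.
rewrite -big_distrl leq_mul2r; apply/orP; right.
rewrite -[X in X <= _](_ : #|[set k : 'I_(n + n) | live m k]| = _); last first.
  by rewrite -sum1_card big_mkcond /=; apply: eq_bigr => j _; rewrite inE; case: live.
have [n0|n0] := posnP n.
  by rewrite [X in _ <= X]n0 leqn0 cards_eq0; apply/eqP/setP => k; rewrite !inE; apply/negbTE/negP => /liveP[v _]; have := ltn_ord v; lia.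
have d : 0 < n + n by lia.
pose h (v : 'I_n) : 'I_(n + n) := insubd (Ordinal d) (pid m v).
apply: (@leq_trans #|[set h v | v : 'I_n]|); last first.
  by apply: leq_trans (leq_imset_card _ _) _; rewrite card_ord.
apply/subset_leq_card/subsetP => k; rewrite inE => /liveP[v e].
by apply/imsetP; exists v => //; apply: val_inj; rewrite val_insubd e ltn_ord.
Qed.

Lemma fpair_merge m (a b : 'I_n) k j :
  fpair m k j <= fpair (mmerge m (pid m a) (pid m b)) k j
    + (k == pid m a) * fpair m (pid m a) j + (k == pid m b) * fpair m (pid m b) j
    + (j == pid m a) * fpair m k (pid m a) + (j == pid m b) * fpair m k (pid m b).
Proof.
set m' := mmerge _ _ _; case f: (fpair m k j) => //.
have [ka|ka] := eqVneq k (pid m a); first by rewrite -ka f; lia.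
have [kb|kb] := eqVneq k (pid m b); first by rewrite -kb f; lia.
have [ja|ja] := eqVneq j (pid m a); first by rewrite -ja f; lia.
have [jb|jb] := eqVneq j (pid m b); first by rewrite -jb f; lia.
have L i : i != pid m a -> i != pid m b -> live m i -> live m' i.
  by move=> ia ib /liveP[v e]; apply/liveP; exists v; rewrite /= e (negbTE ia) (negbTE ib).
case/and3P: f => lk lj o; have -> : fpair m' k j by rewrite /fpair !L.
lia.
Qed.

Lemma sum_eqn_mul (D c : nat) (F : nat -> nat) : \sum_(k < D) (k == c :> nat) * F k <= F c.
Proof.
have [lt|ge] := ltnP c D; last first.
  by rewrite big1 // => k _; rewrite ltn_eqF // (leq_trans (ltn_ord k)).
rewrite (bigD1 (Ordinal lt)) //= eqxx mul1n big1 ?addn0 // => k.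
by rewrite -val_eqE /= => /negbTE ->.
Qed.

Lemma alive_merge m s (a b : 'I_n) : wf m -> sim m s ->
  alive m <= alive (mmerge m (pid m a) (pid m b)) + 4 * swidth 1 s.
Proof.
move=> w S; set m' := mmerge m _ _.
have R k : \sum_(j < n + n) fpair m k j <= swidth 1 s by exact: row_le.
have C j : \sum_(k < n + n) fpair m k j <= swidth 1 s.
  by apply: leq_trans (R j); apply: leq_sum => k _; rewrite fpairC.
have E1 c : \sum_(k < n + n) \sum_(j < n + n) (k == c :> nat) * fpair m c j <= swidth 1 s.
  apply: leq_trans (R c); under eq_bigr do rewrite -big_distrr /=.
  exact: (@sum_eqn_mul _ c (fun=> _)).
have E2 c : \sum_(k < n + n) \sum_(j < n + n) (j == c :> nat) * fpair m k c <= swidth 1 s.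
  rewrite exchange_big; apply: leq_trans (C c); under eq_bigr do rewrite -big_distrr /=.
  exact: (@sum_eqn_mul _ c (fun=> _)).
apply: (@leq_trans (alive m' + \sum_(k < n + n) \sum_(j < n + n) (k == pid m a :> nat) * fpair m (pid m a) j
  + \sum_(k < n + n) \sum_(j < n + n) (k == pid m b :> nat) * fpair m (pid m b) j
  + \sum_(k < n + n) \sum_(j < n + n) (j == pid m a :> nat) * fpair m k (pid m a)
  + \sum_(k < n + n) \sum_(j < n + n) (j == pid m b :> nat) * fpair m k (pid m b))); last first.
  by have := E1 (pid m a); have := E1 (pid m b); have := E2 (pid m a); have := E2 (pid m b); lia.
rewrite /alive -!big_split /=; apply: leq_sum => k _; rewrite -!big_split /=; apply: leq_sum => j _.
exact: fpair_merge.
Qed.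

Lemma alive_resolve m (a b : 'I_n) c : 0 < c -> wf m -> nn m <= n + n ->
  alive m + (opc m (pid m a) (pid m b) == 0) <= alive (mresolve m (pid m a) (pid m b) c).
Proof.
move=> c0 w nn2; set m' := mresolve _ _ _ _.
have mono k j : fpair m k j <= fpair m' k j.
  case f: (fpair m k j) => //; case/and3P: f => lk lj o; rewrite /fpair.
  rewrite [live m' k]lk [live m' j]lj /m' /=; case: ifP => _ /=; last by rewrite o.
  by case: ifP => _; [rewrite -lt0n c0 | rewrite o].
have la (v : 'I_n) : pid m v < n + n by apply: leq_trans (wf_pid w v) nn2.
rewrite /alive (bigD1 (Ordinal (la a))) //= [X in _ <= X](bigD1 (Ordinal (la a))) //=.
rewrite (bigD1 (Ordinal (la b))) //= [X in _ <= X + _](bigD1 (Ordinal (la b))) //=.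
have e : fpair m (pid m a) (pid m b) + (opc m (pid m a) (pid m b) == 0) <=
         fpair m' (pid m a) (pid m b).
  have l (v : 'I_n) : live m (pid m v) by apply/liveP; exists v.
  rewrite /fpair /= [live m' _]l [live m' _]l !l /=; case: (opc m _ _ =P 0) => [h|/eqP h] /=.
    by rewrite h !eqxx /= -lt0n c0.
  by rewrite (negbTE h) /= ?(negbTE h).
have h1 : \sum_(j < n + n | j != Ordinal (la b)) fpair m (pid m a) j <=
          \sum_(j < n + n | j != Ordinal (la b)) fpair m' (pid m a) j by exact: leq_sum.
have h2 : \sum_(k < n + n | k != Ordinal (la a)) \sum_(j < n + n) fpair m k j <=
          \sum_(k < n + n | k != Ordinal (la a)) \sum_(j < n + n) fpair m' k j.
  by apply: leq_sum => k _; apply: leq_sum.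
have AC (p q r t : nat) : p + q + r + t = p + t + q + r by lia.
rewrite AC; exact: leq_add (leq_add e h1) h2.
Qed.

Section Trace.

Variables (cs : seq (state 'I_n)) (ops : seq (op 'I_n)) (e : rel 'I_n) (d : nat).
Hypotheses (eC : symmetric e) (eirr : irreflexive e).
Hypotheses (hcs : construction_sequence e cs) (hdes : describes ops cs) (hd : width 1 cs = d).

Local Notation M i := (final minit (take i ops)).
Local Notation St i := (nth (init 'I_n) cs i).

Lemma swidth_le i : i <= size ops -> swidth 1 (St i) <= d.
Proof.
move=> le; rewrite -hd /width; apply: (@leq_bigmax_seq _ _ _ (swidth 1)) => //.
by apply: mem_nth; rewrite hdes.1.
Qed.

Lemma trace_step i : i < size ops -> exists o : op 'I_n,
  [/\ take i.+1 ops = rcons (take i ops) o,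
      step o.1.1 (pblock (parts (St i)) o.1.2) (pblock (parts (St i)) o.2) (St i) (St i.+1)
    & exists ops2, ops = take i ops ++ o :: ops2].
Proof.
move=> lt; case ho: (onth ops i) => [[[k a] b]|]; last first.
  by have := onthTE ops i; rewrite ho lt.
exists (k, a, b); have nthi := @onth_nth _ (k, a, b) _ _ _ ho; split.
- by rewrite (take_nth (k, a, b)) // nthi.
- by have := hdes.2 i k a b ho.
- by exists (drop i.+1 ops); rewrite -[in LHS](cat_take_drop i ops) (drop_nth (k, a, b)) // nthi.
Qed.

Lemma trace i : i <= size ops ->
  [/\ wf (M i), sim (M i) (St i) & #|parts (St i)| + nn (M i) = n + n].
Proof.
elim: i => [_|i IH lt].
  have e0 : St 0 = init 'I_n by have [-> _ _] := hcs.
  rewrite take0 e0; split; [exact: wf_init | exact: sim_init |].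
  rewrite /= card_imset ?card_ord //.
  by move=> x y /setP /(_ x); rewrite !inE eqxx => /esym /eqP.
have [w S c] := IH (ltnW lt); have [o [et st _]] := trace_step lt.
have [S' c'] := sim_step w S st.
have eM : M i.+1 = mstep (M i) o by rewrite et final_rcons.
rewrite eM; split; [exact: wf_step | exact: S' | move: c c'].
by rewrite /mstep; case: (code o == 0) => /=; lia.
Qed.

Lemma nn_le i : i <= size ops -> nn (M i) <= n + n.
Proof. by move=> /trace[_ _]; lia. Qed.

Definition effs (i : nat) : nat := esum minit (take i ops) eff.

(** [alive] is the potential: an effective step raises it by at least one, and no resolving step
    lowers it. Each of the [nn - n] merges so far has taken away at most [4 * d]. *)
Lemma effs_le i : i <= size ops -> effs i <= alive (M i) + 4 * d * (nn (M i) - n).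
Proof.
elim: i => [|i IH] lt; first by rewrite /effs take0.
have {}IH := IH (ltnW lt); have [w S c] := trace (ltnW lt); have [o [et st _]] := trace_step lt.
have eM : M i.+1 = mstep (M i) o by rewrite et final_rcons.
have sw := swidth_le (ltnW lt); have nw := wf_nn w; have n2 := nn_le (ltnW lt).
rewrite eM /effs et esum_rcons -/(effs i) /mstep /eff.
case: (code o =P 0) => [c0|/eqP c0] /=.
  have := alive_merge o.1.2 o.2 w S; rewrite subSn // mulnS.
  move: IH sw; move: (4 * d * _) (alive (mmerge _ _ _)) (alive _) (swidth 1 _) (effs i) => *; lia.
have h0 : 0 < code o by rewrite lt0n.
have := alive_resolve o.1.2 o.2 h0 w n2.
move: IH; move: (4 * d * _) (nat_of_bool _) (alive _) (alive _) (effs i) => *; lia.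
Qed.

Lemma effs_bound : effs (size ops) <= 5 * d * n.
Proof.
have := effs_le (leqnn _); have [w S c] := trace (leqnn (size ops)).
have := alive_le w S; have := swidth_le (leqnn _); have := nn_le (leqnn _); have := wf_nn w; nia.
Qed.

(** A step is a merge, of which there are at most [n], or effective, or idle. *)
Lemma size_ops_le : size ops <= n + effs (size ops) + idle_steps cs.
Proof.
pose idle i := \sum_(j < i) (St j == St j.+1).
have -> : idle_steps cs = idle (size ops) by rewrite /idle_steps hdes.1.
suff H i : i <= size ops -> i <= nn (M i) - n + effs i + idle i.
  by have := H _ (leqnn _); have := nn_le (leqnn _); lia.
elim: i => // i IH lt; have {}IH := IH (ltnW lt).
have [w S c] := trace (ltnW lt); have [o [et st _]] := trace_step lt.
have eM : M i.+1 = mstep (M i) o by rewrite et final_rcons.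
have nw := wf_nn w.
rewrite eM /idle big_ord_recr /= -/(idle i) /effs et esum_rcons -/(effs i).
have := sim_idle w S st; rewrite /mstep /eff.
case: (code o =P 0) => [c0|/eqP c0] /=; first by lia.
case: (opc _ _ _ =P 0) => _ /=; first by lia.
by move=> /(_ isT isT) ->; rewrite eqxx; lia.
Qed.

Lemma edge_fc (x y : 'I_n) : x != y -> e x y = (fc minit ops x y == 1).
Proof.
move=> ne; have [w S _] := trace (leqnn (size ops)).
have := sim_pos S ne; rewrite take_size col_final /= => <-.
have -> : St (size ops) = last (init 'I_n) cs by rewrite (last_nth (init 'I_n)) hdes.1.
have [_ _ ->] := hcs; rewrite inE; apply/idP/existsP => [h|[a /existsP[b /andP[h]]]].
  by exists x; apply/existsP; exists y; rewrite h eqxx.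
by rewrite set2_eq // => /orP[] /andP[/eqP -> /eqP ->] //; rewrite eC.
Qed.

End Trace.

(** * Crossing a node of the heap *)

(* [A] meets the rows [X] without containing all of them; [b] stands for the presence of a padding row. *)
Definition cuts (m : model) (A : nat) (X : {set 'I_n}) (b : bool) : bool :=
  [exists x in X, pid m x == A] && (b || [exists x in X, pid m x != A]).

Definition separates (m : model) (B : nat) (y y' : 'I_n) : bool :=
  (pid m y == B) != (pid m y' == B).

Definition crosses (m : model) (o : op 'I_n) (X : {set 'I_n}) (b : bool) (y y' : 'I_n) : bool :=
  let A := pid m o.1.2 in let B := pid m o.2 in
  separates m B y y' && cuts m A X b || separates m A y y' && cuts m B X b.

Definition splits (m : model) (o : op 'I_n) (y y' : 'I_n) : bool :=
  separates m (pid m o.2) y y' || separates m (pid m o.1.2) y y'.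

Lemma covers_eq m o (x x' y y' : nat) : pid m x = pid m x' -> pid m y = pid m y' ->
  covers m o x y = covers m o x' y'.
Proof. by rewrite /covers => -> ->. Qed.

Lemma fc_eq m ops (x x' y y' : nat) : pid m x = pid m x' -> pid m y = pid m y' ->
  fc m ops x y = fc m ops x' y'.
Proof.
elim: ops m => //= o ops IH m ex ey; rewrite (covers_eq o ex ey).
by case: ifP => // _; apply: IH; exact: pid_step_eq.
Qed.

Lemma coversP m o (x y : nat) : covers m o x y ->
  exists A B, [/\ pid m x = A, pid m y = B &
    (A, B) = (pid m o.1.2, pid m o.2) \/ (A, B) = (pid m o.2, pid m o.1.2)].
Proof. by case/orP=> /andP[/eqP -> /eqP ->]; do 2!eexists; split; auto. Qed.

(** The induction stops at the first resolving step that covers a pair of a row in [X] and one of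
    the two columns. If the columns share a part by then, they agree for good. Otherwise the step
    separates them, and its other part either cuts [X] or contains all of [X]; in the latter case
    all rows are treated alike from then on. *)
Lemma fc_cross m ops (X : {set 'I_n}) (b : bool) (y y' : 'I_n) : wf m ->
  (forall x, x \in X -> col m x y = 0 /\ col m x y' = 0) ->
  {in X, forall x : 'I_n, fc m ops x y = fc m ops x y'} \/
  0 < esum m ops (fun m o => eff m o && splits m o y y') /\
  (0 < esum m ops (fun m o => eff m o && crosses m o X b y y') \/
   ~~ b /\ {in X &, forall x x' : 'I_n,
     fc m ops x y = fc m ops x' y /\ fc m ops x y' = fc m ops x' y'}).
Proof.
elim: ops m => [|o ops IH] m w c0; first by left.
have [/andP[co /exists_inP[x0 x0X cov]]|no] :=
  boolP ((code o != 0) && [exists x in X, covers m o x y || covers m o x y']); last first.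
  have fE x : x \in X -> fc m (o :: ops) x y = fc (mstep m o) ops x y /\
                        fc m (o :: ops) x y' = fc (mstep m o) ops x y'.
    move=> xX /=; move: no; case: (code o != 0) => //= /exists_inPn /(_ x xX).
    by rewrite negb_or => /andP[/negbTE -> /negbTE ->].
  have w' := wf_step o w.
  have c0' x : x \in X -> col (mstep m o) x y = 0 /\ col (mstep m o) x y' = 0.
    move=> xX; have [h h'] := c0 _ xX; move: no; rewrite /mstep.
    case: (code o =P 0) => //= _ /exists_inPn /(_ x xX).
    by rewrite negb_or h h' /= /covers => /andP[/negbTE -> /negbTE ->].
  have [h|[h1 h2]] := IH _ w' c0'.
    by left=> x xX; have [-> ->] := fE x xX; exact: h.
  right; split; first by rewrite /= addn_gt0 h1 orbT.
  case: h2 => [h2|[h2 h3]]; first by left; rewrite /= addn_gt0 h2 orbT.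
  right; split=> // x x' xX x'X; have [-> ->] := fE x xX; have [-> ->] := fE x' x'X; exact: h3.
have [eyy|nyy] := eqVneq (pid m y) (pid m y'); first by left=> x _; exact: fc_eq.
right; have [u [uy hu]] : exists u : 'I_n, covers m o x0 u /\ (u = y \/ u = y').
  by case/orP: cov => ?; [exists y | exists y']; auto.
(* The pair [(x0, u)] is uncoloured so far, so its two parts cannot have been resolved against each
   other. *)
have effo : eff m o.
  rewrite /eff co /=; have cz : col m x0 u = 0 by have [? ?] := c0 _ x0X; case: hu => ->.
  apply: contraT => nz; case/orP: uy => /andP[/eqP ex /eqP ey].
    by have := @wf_col m w x0 u; rewrite ex ey cz nz => /(_ isT).
  by have := @wf_col m w x0 u; rewrite ex ey (wf_opcC w) cz nz => /(_ isT).
have sep B : pid m u = B -> separates m B y y'.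
  by rewrite /separates; case: hu => -> <-; rewrite eqxx // ?(eq_sym (pid m y')) (negbTE nyy).
have [A [B [eA eB hAB]]] := coversP uy.
split; first by rewrite /= effo /= addn_gt0 lt0b /splits; case: hAB => -[_ <-]; rewrite (sep B) ?orbT.
have [/orP hb|/norP[nb]] := boolP (b || [exists x in X, pid m x != A]).
  have cutA : cuts m A X b.
    by rewrite /cuts; apply/andP; split; [apply/exists_inP; exists x0 => //; apply/eqP | apply/orP].
  left; rewrite /= effo /= addn_gt0 lt0b /crosses; apply/orP; left.
  by case: hAB => -[<- <-]; rewrite (sep B) // cutA ?orbT.
move/exists_inPn => allA; right; split=> // x x' xX x'X.
have pE z : z \in X -> pid m z = A by move/allA; rewrite negbK => /eqP.
by split; apply: fc_eq; rewrite ?(pE x) ?(pE x').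
Qed.

(** * Counting the intervals of the sets S_q *)

Section Rises.

Variables (ops : seq (op 'I_n)) (G : nat -> nat -> bool) (L : nat).
Hypothesis GE : tabG (final minit ops) G.
Hypothesis n_le : n <= 2 ^ L.
Local Notation N := (2 ^ L).

Definition pos_of (x : nat) : nat := N + rank G x.

Definition inpos (m : model) (A p : nat) : bool :=
  [exists x : 'I_n, (pos_of x == p) && (pid m x == A)].

Lemma inposP m A p : reflect (exists x : 'I_n, pos_of x = p /\ pid m x = A) (inpos m A p).
Proof.
by apply: (iffP existsP) => -[x]; [case/andP=> /eqP ? /eqP ?|case=> /eqP ? /eqP ?];
  exists x => //; apply/andP.
Qed.

Lemma pos_inj (x y : 'I_n) : pos_of x = pos_of y -> x = y.
Proof. by move=> /addnI; exact: (rank_inj GE). Qed.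

Lemma pos_ltn (x : 'I_n) : N <= pos_of x < N + n.
Proof. by rewrite /pos_of leq_addr ltn_add2l (rank_ltn GE). Qed.

Lemma pos_surj p : N <= p < N + n -> exists x : 'I_n, pos_of x = p.
Proof.
case/andP=> h1 h2; have [|x e] := @rank_surj ops G GE (p - N); first by lia.
by exists x; rewrite /pos_of e; lia.
Qed.

Lemma inpos_pid m A (x : 'I_n) : inpos m A (pos_of x) = (pid m x == A).
Proof.
apply/inposP/eqP => [[z [/pos_inj -> //]]|e]; by exists x.
Qed.

Lemma inpos_interval i A : exists lo hi,
  forall p, inpos (final minit (take i ops)) A p = (lo <= p < hi).
Proof.
set m := final _ _.
have [/existsP[x0 /eqP e0]|no] := boolP [exists x : 'I_n, pid m x == A]; last first.
  exists 0, 0 => p; rewrite ltn0 andbF; apply/negbTE; apply: contra no => /inposP[x [_ e]].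
  by apply/existsP; exists x; apply/eqP.
have ex : exists p, inpos m A p by exists (pos_of x0); rewrite inpos_pid e0.
have ub p : inpos m A p -> p <= N + n.
  by move=> /inposP[x [<- _]]; have := pos_ltn x; lia.
case: (ex_minnP ex) => lo /inposP[a [ea ma]] hlo.
case: (ex_maxnP ex ub) => hi /inposP[b [eb mb]] hhi.
exists lo, hi.+1 => p; apply/idP/idP => [h|/andP[h1 h2]].
  by rewrite hlo // ltnS hhi.
have [|x ex'] := @pos_surj p; first by have := pos_ltn a; have := pos_ltn b; lia.
rewrite -ex' inpos_pid; have [->|xa] := eqVneq x a; first by apply/eqP.
have [->|xb] := eqVneq x b; first by apply/eqP.
apply/eqP; rewrite -ma; apply: (rank_convex GE (y := b)); last by rewrite ma mb.
have na : pos_of x != pos_of a by apply: contra xa => /eqP /pos_inj ->.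
have nb : pos_of x != pos_of b by apply: contra xb => /eqP /pos_inj ->.
by move: na nb; rewrite /pos_of in ea eb ex' *; lia.
Qed.

Definition under (q c : nat) : bool := [exists j : 'I_L.+1, c %/ 2 ^ j == q].

Lemma underP q c : reflect (exists2 j, j <= L & c %/ 2 ^ j = q) (under q c).
Proof.
apply: (iffP existsP) => [[j /eqP e]|[j h e]].
  by exists j; rewrite // -ltnS.
by exists (Ordinal (h : j < L.+1)); apply/eqP.
Qed.

(** The nodes at height [j] have numbers from [2 ^ (L - j)] to just below [2 ^ (L.+1 - j)], and
    these ranges are disjoint. *)
Lemma level_uniq c c' j j' : N <= c < 2 * N -> N <= c' < 2 * N -> j <= L -> j' <= L ->
  c %/ 2 ^ j = c' %/ 2 ^ j' -> j = j'.
Proof.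
wlog lt : c c' j j' / j < j' => [H|] hc hc' hj hj' e.
  have [h|h|//] := ltngtP j j'; first exact: H h hc hc' hj hj' e.
  by apply/esym; apply: H h hc' hc hj' hj (esym e).
have h1 : 2 ^ (L - j) <= c %/ 2 ^ j.
  by rewrite leq_divRL ?expn_gt0 // -expnD subnK //; lia.
have h2 : c' %/ 2 ^ j' < 2 ^ (L.+1 - j').
  by rewrite ltn_divLR ?expn_gt0 // -expnD subnK ?expnS; lia.
have h3 : 2 ^ (L.+1 - j') <= 2 ^ (L - j) by rewrite leq_exp2l //; lia.
by lia.
Qed.

Lemma under_half q c : c < 2 * N -> 1 < q -> under q c -> under (q %/ 2) c.
Proof.
move=> hc q1 /underP[j hj e]; apply/underP; exists j.+1; last by rewrite expnSr divnMA e.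
rewrite -ltnS -(ltn_exp2l _ _ (isT : 1 < 2)).
apply: leq_ltn_trans (_ : c < _); last by rewrite expnS.
by rewrite expnS -leq_divRL ?expn_gt0 // e.
Qed.

(* Nodes of the complete binary tree are numbered from the root 1, and [q] has the
   children [2 * q] and [2 * q + 1].  [Ub q y]: the vertex at position [y] is adjacent
   to all vertices below [q].  The leaves from [N + n] on are padding, adjacent to
   nothing; with this convention [pos_of x] is both a leaf and a column. *)
Variable Ub : nat -> nat -> bool.
Hypothesis U_leaf : forall x y : 'I_n, Ub (pos_of x) (pos_of y) = (fc minit ops x y == 1).
Hypothesis U_pad : forall c y, N + n <= c < 2 * N -> Ub c y = false.
Hypothesis U_node : forall q y, 0 < q < N -> Ub q y = Ub (2 * q) y && Ub (2 * q).+1 y.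

(* Membership in S_q. *)
Definition top (q y : nat) : bool := Ub q y && ~~ Ub (q %/ 2) y.

Lemma U_half q y : 1 < q < 2 * N -> Ub (q %/ 2) y -> Ub q y.
Proof.
move=> h; rewrite U_node; last by lia.
case/andP=> h1 h2; have := divn_eq q 2; have := ltn_pmod q (isT : 0 < 2).
case: (q %% 2) => [|[|//]] _ e; rewrite e mulnC; first by rewrite addn0.
by rewrite addn1.
Qed.

Lemma U_leaves q y c : 0 < q -> N <= c < 2 * N -> under q c -> Ub q y -> Ub c y.
Proof.
move=> h0 hc /underP[j _ e]; rewrite -{q}e in h0 *; elim: j h0 => [|j IH]; first by rewrite expn0 divn1.
rewrite expnSr divnMA; move: IH (leq_div c (2 ^ j)); move: (c %/ 2 ^ j) => r IH le h0 h1.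
have r1 : 1 < r by move: h0; rewrite leq_divRL.
by apply: IH; [exact: ltnW | apply: U_half h1; rewrite r1 /=; case/andP: hc => _; exact: leq_ltn_trans].
Qed.

Lemma U_of_leaves q y : 0 < q < 2 * N ->
  (forall c, N <= c < 2 * N -> under q c -> Ub c y) -> Ub q y.
Proof.
have [k] := ubnP (2 * N - q); elim: k q => // k IH q hk hq h.
have [le|lt] := leqP N q; first by apply: h; [lia | apply/underP; exists 0; rewrite // expn0 divn1].
rewrite U_node; last by lia.
apply/andP; split; apply: IH; try lia; move=> c hc hu; apply: h => //.
  have -> : q = (2 * q) %/ 2 by rewrite mulKn.
  by apply: under_half hu; lia.
have -> : q = (2 * q).+1 %/ 2 by lia.
by apply: under_half hu; lia.
Qed.

Lemma under_ex q : 0 < q < 2 * N -> exists2 c, N <= c < 2 * N & under q c.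
Proof.
have [k] := ubnP (2 * N - q); elim: k q => // k IH q hk hq.
have [le|lt] := leqP N q; first by exists q; [lia | apply/underP; exists 0; rewrite // expn0 divn1].
have [||c hc hu] := IH (2 * q); try lia.
exists c => //; have -> : q = (2 * q) %/ 2 by rewrite mulKn.
by apply: under_half hu; lia.
Qed.

Definition rows (q : nat) : {set 'I_n} := [set x : 'I_n | under q (pos_of x)].

Definition padded (q : nat) : bool := [exists c : 'I_N, (n <= c) && under q (N + c)].

Lemma leaf_cases c : N <= c < 2 * N ->
  (exists x : 'I_n, c = pos_of x) \/ (exists i : 'I_N, n <= i /\ c = N + i).
Proof.
move=> hc; have [lt|ge] := ltnP c (N + n).
  by left; have [|x e] := @pos_surj c; [lia | exists x].
have h : c - N < N by lia.
by right; exists (Ordinal h) => /=; lia.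
Qed.

(** [fc_cross] for the rows below the parent of [q] leaves two cases to exclude. Equal columns would
    be both inside or both outside S_q. If each column is constant on these rows, then adjacency of
    [y'] to the rows below [q] extends to all rows below the parent, so [y'] is not in S_q. *)
Lemma top_rise q (y y' : 'I_n) : 1 < q < 2 * N ->
  ~~ top q (pos_of y) -> top q (pos_of y') ->
  0 < esum minit ops (fun m o => eff m o && crosses m o (rows (q %/ 2)) (padded (q %/ 2)) y y').
Proof.
move=> hq ny hy; have hq2 : 0 < q %/ 2 < 2 * N by lia.
have leafE c : N <= c < 2 * N -> under (q %/ 2) c ->
    (exists2 x : 'I_n, x \in rows (q %/ 2) & c = pos_of x) \/
    (padded (q %/ 2) /\ forall z : nat, Ub c z = false).
  move=> hc hu; case: (leaf_cases hc) => [[x e]|[i [ni e]]].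
    by left; exists x; rewrite // inE -e.
  right; split; first by apply/existsP; exists i; rewrite ni -e.
  by move=> z; apply: U_pad; rewrite e; have := ltn_ord i; lia.
case: (@fc_cross minit ops (rows (q %/ 2)) (padded (q %/ 2)) y y' wf_init) => //.
  move=> same.
  have E c : N <= c < 2 * N -> under (q %/ 2) c -> Ub c (pos_of y) = Ub c (pos_of y').
    move=> hc hu; case: (leafE c hc hu) => [[x xX ->]|[_ h]]; last by rewrite !h.
    by rewrite !U_leaf same.
  have U2 z z' : (forall c, N <= c < 2 * N -> under (q %/ 2) c -> Ub c z = Ub c z') ->
      Ub (q %/ 2) z -> Ub (q %/ 2) z'.
    by move=> h h1; apply: U_of_leaves => // c hc hu; rewrite -h //; apply: U_leaves h1; lia.
  have U1 z z' : (forall c, N <= c < 2 * N -> under (q %/ 2) c -> Ub c z = Ub c z') ->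
      Ub q z -> Ub q z'.
    move=> h h1; apply: U_of_leaves => [|c hc hu]; first by lia.
    rewrite -h //; first by apply: U_leaves h1; lia.
    by apply: under_half hu; lia.
  move: hy ny; rewrite /top => /andP[h1 h2] /negP[]; rewrite (U1 _ _ _ h1) /=.
    by apply: contra h2; apply: U2.
  by move=> c hc hu; rewrite E.
case=> _ [//|[npad const]].
move: hy; rewrite /top => /andP[h1 /negP[]].
apply: U_of_leaves => // c hc hu.
have [c0 hc0 hu0] : exists2 c, N <= c < 2 * N & under q c by apply: under_ex; lia.
have hu0' : under (q %/ 2) c0 by apply: under_half hu0; lia.
case: (leafE c hc hu) => [[x xX ex]|[h _]]; last by rewrite h in npad.
case: (leafE c0 hc0 hu0') => [[x0 x0X ex0]|[h _]]; last by rewrite h in npad.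
have : Ub c0 (pos_of y') by apply: U_leaves h1; lia.
by rewrite ex ex0 !U_leaf; have [_ ->] := const x x0 xX x0X.
Qed.

Lemma root_rise (y y' : 'I_n) : ~~ top 1 (pos_of y) -> top 1 (pos_of y') ->
  Ub 0 (pos_of y) = false ->
  0 < esum minit ops (fun m o => eff m o && splits m o y y').
Proof.
move=> ny /andP[hy _] h0.
case: (@fc_cross minit ops setT true y y' wf_init) => //; last by case.
move=> same; case/negP: ny; rewrite /top h0 andbT.
have N0 : 0 < N by rewrite expn_gt0.
apply: U_of_leaves => [|c hc hu]; first by lia.
have h : Ub c (pos_of y') by apply: U_leaves hy.
move: h; case: (leaf_cases hc) => [[x ->]|[i [ni e]]]; first by rewrite !U_leaf same // inE.
by rewrite U_pad // e; have := ltn_ord i; lia.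
Qed.

(** Some leaf below [q] is inside the interval of [A] and some leaf on the same level is outside.
    Division by a power of 2 is monotone, so the end of the interval between them lies below [q] as
    well. *)
Lemma cuts_node i A q lo hi : let m := final minit (take i ops) in
  (forall p, inpos m A p = (lo <= p < hi)) -> 0 < q ->
  cuts m A (rows q) (padded q) -> exists2 j, j <= L & (q = lo %/ 2 ^ j) \/ (q = hi %/ 2 ^ j).
Proof.
move=> m hA q0 /andP[/exists_inP[x]]; rewrite inE => /underP[j hj ej] /eqP ex h2.
have hx := pos_ltn x.
have ix : lo <= pos_of x < hi by rewrite -hA inpos_pid ex.
have [c' [hc' nc' [j' hj' ej']]] : exists c', [/\ N <= c' < 2 * N, ~~ (lo <= c' < hi) &
    exists2 j', j' <= L & c' %/ 2 ^ j' = q].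
  case/orP: h2 => [/existsP[c /andP[nc /underP hu]]|/exists_inP[z]].
    exists (N + c); split=> //; first by have := ltn_ord c; lia.
    by rewrite -hA; apply/negP => /inposP[z [e _]]; have := pos_ltn z; lia.
  rewrite inE => /underP hu nz; exists (pos_of z); split=> //; first by have := pos_ltn z; lia.
  by rewrite -hA inpos_pid.
have ejj : j = j'.
  apply: (@level_uniq (pos_of x) c') => //; first by lia.
  by rewrite ej ej'.
rewrite -{}ejj in ej'; exists j => //; move: nc'; rewrite negb_and -ltnNge -leqNgt.
case/orP=> h; [left | right]; apply/eqP; rewrite eqn_leq; apply/andP; split.
- by rewrite -ej' leq_div2r //; lia.
- by rewrite -ej leq_div2r //; lia.
- by rewrite -ej leq_div2r //; lia.
- by rewrite -ej' leq_div2r //; lia.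
Qed.

Definition vat (x0 : 'I_n) (k : nat) : 'I_n := odflt x0 [pick x : 'I_n | rank G x == k].

Lemma vatP x0 k : k < n -> pos_of (vat x0 k) = N + k.
Proof.
move=> lt; rewrite /vat; case: pickP => [x /eqP e|no]; first by rewrite /pos_of e.
by have [x e] := rank_surj GE lt; have := no x; rewrite e eqxx.
Qed.

Definition rise (q y : nat) : bool := ~~ top q y && top q y.+1.

(** An interval beginning at the first column is not a rise, so S_q has at most one interval more
    than this. *)
Definition rises (q : nat) : nat := \sum_(y < n) (y.+1 < n) && rise q (N + y).

(** The root has no parent whose rows could be cut, so its rises are charged to any step separating
    the two columns. Being a single node, it can afford this. *)
Definition hits (q : nat) (y : 'I_n) (m : model) (o : op 'I_n) : bool :=
  let y1 := vat y y in let y2 := vat y y.+1 in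
  if q == 1 then splits m o y1 y2 else crosses m o (rows (q %/ 2)) (padded (q %/ 2)) y1 y2.

Lemma sum_pred1_le (D : nat) (c : nat) : \sum_(k < D) (k == c :> nat) <= 1.
Proof. by have := @sum_eqn_mul D c (fun=> 1); under eq_bigr do rewrite muln1. Qed.

Lemma sum_mem_le (D : nat) (s : seq nat) (f : nat -> nat) c :
  (forall z, \sum_(k < D) (f k == z) <= c) ->
  \sum_(k < D) (f k \in s) <= size s * c.
Proof.
move=> h; elim: s => [|z s IH] /=; first by rewrite big1.
rewrite mulSn; apply: leq_trans (leq_add (h z) IH); rewrite -big_split /=.
by apply: leq_sum => k _; rewrite inE; case: eqP => _ /=; lia.
Qed.

Lemma hits_le i o :
  \sum_(q < 2 * N) \sum_(y < n)
    ((0 < q) && (y.+1 < n) && hits q y (final minit (take i ops)) o) <= 16 * L + 20.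
Proof.
move mE : (final minit (take i ops)) => m.
have [loA [hiA hA]] := inpos_interval i (pid m o.1.2).
have [loB [hiB hB]] := inpos_interval i (pid m o.2).
rewrite mE in hA hB.
pose cutl lo hi := [seq lo %/ 2 ^ j | j <- iota 0 L.+1] ++ [seq hi %/ 2 ^ j | j <- iota 0 L.+1].
pose sepl (lo hi : nat) := [:: lo; hi].
(* Either [q] is the root, or the parent of [q] lies on the path from the root to [lo] or to
   [hi]. *)
pose cut lo hi (q : nat) := (q \in [:: 1]) + (q %/ 2 \in cutl lo hi).
have sepE A lo hi (y : 'I_n) : (forall p, inpos m A p = (lo <= p < hi)) -> y.+1 < n ->
    separates m A (vat y y) (vat y y.+1) -> (N + y).+1 \in sepl lo hi.
  move=> hp lt; rewrite /separates -!inpos_pid !hp !vatP //; rewrite !inE; lia.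
have cutE A lo hi q : (forall p, inpos m A p = (lo <= p < hi)) -> 1 < q ->
    cuts m A (rows (q %/ 2)) (padded (q %/ 2)) -> q %/ 2 \in cutl lo hi.
  move=> hp q1; rewrite -mE in hp *; move/(cuts_node hp) => []; first by lia.
  move=> j hj e; rewrite mem_cat; apply/orP.
  by case: e => ->; [left | right]; apply/mapP; exists j => //; rewrite mem_iota.
have pt (q : 'I_(2 * N)) (y : 'I_n) : ((0 < q) && (y.+1 < n) && hits q y m o : nat) <=
   cut loA hiA q * ((N + y).+1 \in sepl loB hiB) + cut loB hiB q * ((N + y).+1 \in sepl loA hiA).
  rewrite -andbA; case h: (_ && _) => //; case/and3P: h => q0 lt; rewrite /hits /cut.
  case: eqP => [->|/eqP q1]; first by case/orP=> [/(sepE _ _ _ _ hB lt) | /(sepE _ _ _ _ hA lt)] ->; rewrite inE eqxx; lia.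
  have {}q1 : 1 < q by lia.
  case/orP=> /andP[].
    by move=> /(sepE _ _ _ _ hB lt) -> /(cutE _ _ _ _ hA q1) ->; lia.
  by move=> /(sepE _ _ _ _ hA lt) -> /(cutE _ _ _ _ hB q1) ->; lia.
(* One for the root, and two children for each of the [2 * (L + 1)] candidates for the parent. *)
have cutS lo hi : \sum_(q < 2 * N) cut lo hi q <= 4 * L + 5.
  rewrite big_split /= (_ : 4 * L + 5 = 1 + (4 * L + 4)); last by lia.
  apply: leq_add.
    by apply: leq_trans (sum_pred1_le (2 * N) 1); apply: leq_sum => q _; rewrite inE.
  have -> : 4 * L + 4 = size (cutl lo hi) * 2 by rewrite size_cat !size_map size_iota; lia.
  apply: (@sum_mem_le (2 * N) (cutl lo hi) (fun q => q %/ 2)) => z.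
  apply: (@leq_trans (\sum_(k < 2 * N) (k == 2 * z :> nat) + \sum_(k < 2 * N) (k == (2 * z).+1 :> nat))).
    rewrite -big_split; apply: leq_sum => k _ /=; lia.
  by have := sum_pred1_le (2 * N) (2 * z); have := sum_pred1_le (2 * N) (2 * z).+1; lia.
have sepS lo hi : \sum_(y < n) ((N + y).+1 \in sepl lo hi) <= 2.
  rewrite -[X in _ <= X]/(size (sepl lo hi) * 1).
  apply: (@sum_mem_le n (sepl lo hi) (fun y => (N + y).+1)) => z.
  by apply: leq_trans (sum_pred1_le n (z - N.+1)); apply: leq_sum => k _; lia.
apply: (@leq_trans (\sum_(q < 2 * N) \sum_(y < n)
   (cut loA hiA q * ((N + y).+1 \in sepl loB hiB) + cut loB hiB q * ((N + y).+1 \in sepl loA hiA)))).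
  by apply: leq_sum => q _; apply: leq_sum => y _; exact: pt.
under eq_bigr do rewrite big_split -!big_distrr /=.
(* Two summands for the two roles of the parts of a step; the factor 2 stands for the two ends at
   which a part can separate neighbouring columns. *)
rewrite big_split -!big_distrl /= (_ : 16 * L + 20 = (4 * L + 5) * 2 + (4 * L + 5) * 2); last by lia.
by apply: leq_add; apply: leq_mul.
Qed.

(** Double counting: every rise is hit by an effective step, and [hits_le] bounds the pairs [(q, y)]
    hit by one step. *)
Lemma rises_le : (forall y, Ub 0 y = false) ->
  \sum_(q < 2 * N | 0 < q) rises q <= (16 * L + 20) * esum minit ops eff.
Proof.
move=> U0.
apply: (@leq_trans (esum minit ops (fun m o => eff m o * (16 * L + 20)))); last first.
  by rewrite esum_muln mulnC.
apply: (@leq_trans (\sum_(q < 2 * N) \sum_(y < n)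
  esum minit ops (fun m o => eff m o * ((0 < q) && (y.+1 < n) && hits q y m o)))).
  rewrite big_mkcond /=; apply: leq_sum => q _; case: ifP => // q0.
  apply: leq_sum => y _; case lt: (y.+1 < n) => //=; case r: (rise q _) => //.
  have e1 := vatP y (ltn_ord y); have e2 := vatP y lt; rewrite addnS in e2.
  move: r; rewrite /rise -e2 -e1 => /andP[r1 r2].
  have [q1|q1] := eqVneq (q : nat) 1.
    rewrite q1 in r1 r2 *; apply: leq_trans (root_rise r1 r2 (U0 _)) _.
    by apply: esum_le => ops1 o ops2 _; rewrite /hits /=; case: (eff _ _); case: (splits _ _ _ _).
  have q2 : 1 < q < 2 * N by rewrite ltn_ord andbT; lia.
  apply: leq_trans (top_rise q2 r1 r2) _.
  apply: esum_le => ops1 o ops2 _; rewrite /hits (negbTE q1).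
  by case: (eff _ _); case: (crosses _ _ _ _ _ _).
under eq_bigr do rewrite esum_sum.
rewrite esum_sum; apply: esum_le => ops1 o ops2 eops.
under eq_bigr do rewrite -big_distrr /=.
rewrite -big_distrr leq_mul2l; apply/orP; right.
have := hits_le (size ops1) o; rewrite eops take_size_cat //.
Qed.

End Rises.

End Model.

(** * Program logic *)

Arguments upd _ _ _ _ /.
Arguments aupd _ _ _ _ _ / _.

Fixpoint wvars (c : cmd) : seq nat :=
  match c with
  | CSkip | CPut _ _ _ _ | COut _ _ => [::]
  | CSet x _ => [:: x]
  | CSeq c1 c2 | CIf _ _ c1 c2 => wvars c1 ++ wvars c2
  | CWhile _ _ c => wvars c
  end.

Fixpoint warrs (c : cmd) : seq nat :=
  match c with
  | CSkip | CSet _ _ | COut _ _ => [::]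
  | CPut a _ _ _ => [:: a]
  | CSeq c1 c2 | CIf _ _ c1 c2 => warrs c1 ++ warrs c2
  | CWhile _ _ c => warrs c
  end.

Fixpoint wout (c : cmd) : bool :=
  match c with
  | CSkip | CSet _ _ | CPut _ _ _ _ => false
  | COut _ _ => true
  | CSeq c1 c2 | CIf _ _ c1 c2 => wout c1 || wout c2
  | CWhile _ _ c => wout c
  end.

(** What a command writes is read off its syntax, so a loop invariant need not mention anything
    else. *)
Definition frame (c : cmd) (s s' : st) : Prop :=
  [/\ forall x, x \notin wvars c -> var s' x = var s x,
      forall a, a \notin warrs c -> arr s' a = arr s a
    & ~~ wout c -> out s' = out s].

Lemma frame_refl c s : frame c s s. Proof. by []. Qed.

Lemma frame_tick c s s' : frame c s s' -> frame c s (tick s'). Proof. by []. Qed.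

Lemma frame_trans c s1 s2 s3 : frame c s1 s2 -> frame c s2 s3 -> frame c s1 s3.
Proof.
move=> [a1 b1 d1] [a2 b2 d2]; split=> [x h|a h|h]; first by rewrite a2 ?a1.
  by rewrite b2 ?b1.
by rewrite d2 ?d1.
Qed.

Lemma frame_sub c c' s s' : frame c s s' -> {subset wvars c <= wvars c'} ->
  {subset warrs c <= warrs c'} -> (wout c -> wout c') -> frame c' s s'.
Proof.
move=> [a b d] sv sa so; split=> [x h|x h|h]; [apply: a | apply: b | apply: d].
- by apply: contra h; apply: sv.
- by apply: contra h; apply: sa.
- by apply: contra h.
Qed.

Lemma run_frame inp c s s' : run inp c s s' -> frame c s s'.
Proof.
elim=> {c s s'}.
- by [].
- move=> x e s; split=> //= y; rewrite inE; by case: eqP.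
- move=> a e1 e2 e3 s; split=> //= a'; rewrite inE; by case: eqP.
- by [].
- move=> c1 c2 s1 s2 s3 _ F1 _ F2.
  apply: (@frame_trans _ _ s2); [apply: frame_sub F1 _ _ _ | apply: frame_sub F2 _ _ _] => /=;
    try (by move=> x h; rewrite mem_cat h ?orbT); by move=> ->; rewrite ?orbT.
- move=> e1 e2 c1 c2 s s' _ F; apply: (@frame_trans _ _ (tick s)) => //.
  apply: frame_sub F _ _ _; case: ifP => _ /=;
    try (by move=> x h; rewrite mem_cat h ?orbT); by move=> ->; rewrite ?orbT.
- move=> e1 e2 c s1 s2 s3 _ _ F1 _ F2.
  by apply: (@frame_trans _ _ s2) => //; apply: (@frame_trans _ _ (tick s1)).
- by [].
Qed.

Lemma frV c s s' x : frame c s s' -> x \notin wvars c -> var s' x = var s x.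
Proof. by case=> h _ _; exact: h. Qed.

Lemma frA c s s' a : frame c s s' -> a \notin warrs c -> arr s' a = arr s a.
Proof. by case=> _ h _; exact: h. Qed.

Lemma frO c s s' : frame c s s' -> ~~ wout c -> out s' = out s.
Proof. by case=> _ _ h; exact: h. Qed.

Section WP.

Variable inp : nat -> nat.

Definition wp (c : cmd) (Q : st -> Prop) (s : st) : Prop := exists2 s', run inp c s s' & Q s'.

Lemma wp_conseq c (Q Q' : st -> Prop) s :
  wp c Q s -> (forall s', Q s' -> frame c s s' -> Q' s') -> wp c Q' s.
Proof. by case=> s' r q h; exists s' => //; apply: h => //; exact: run_frame r. Qed.

Lemma wp_skip (Q : st -> Prop) s : Q (tick s) -> wp CSkip Q s.
Proof. by move=> q; exists (tick s) => //; constructor. Qed.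

Lemma wp_set x e (Q : st -> Prop) s :
  Q (St (upd (var s) x (ev inp s e)) (arr s) (out s) (tm s).+1) -> wp (CSet x e) Q s.
Proof. by move=> q; eexists; [constructor | exact: q]. Qed.

Lemma wp_put a e1 e2 e3 (Q : st -> Prop) s :
  Q (St (var s) (aupd (arr s) a (ev inp s e1) (ev inp s e2) (ev inp s e3)) (out s) (tm s).+1) ->
  wp (CPut a e1 e2 e3) Q s.
Proof. by move=> q; eexists; [constructor | exact: q]. Qed.

Lemma wp_out e1 e2 (Q : st -> Prop) s :
  Q (St (var s) (arr s) (upd (out s) (ev inp s e1) (ev inp s e2)) (tm s).+1) ->
  wp (COut e1 e2) Q s.
Proof. by move=> q; eexists; [constructor | exact: q]. Qed.

Lemma wp_seq c1 c2 (Q : st -> Prop) s : wp c1 (wp c2 Q) s -> wp (CSeq c1 c2) Q s.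
Proof. by case=> s1 r1 [s2 r2 q]; exists s2 => //; exact: run_seq r1 r2. Qed.

Lemma wp_if e1 e2 c1 c2 (Q : st -> Prop) s :
  (ev inp s e1 < ev inp s e2 -> wp c1 Q (tick s)) ->
  (ev inp s e2 <= ev inp s e1 -> wp c2 Q (tick s)) -> wp (CIf e1 e2 c1 c2) Q s.
Proof.
case: (ltnP (ev inp s e1) (ev inp s e2)) => h h1 h2.
  by have [s' r q] := h1 isT; exists s' => //; apply: run_if; rewrite h.
by have [s' r q] := h2 isT; exists s' => //; apply: run_if; rewrite ltnNge h.
Qed.

Lemma wp_while (I : st -> Prop) (m : st -> nat) e1 e2 c (Q : st -> Prop) s :
  I s ->
  (forall s1, I s1 -> frame c s s1 -> ev inp s1 e1 < ev inp s1 e2 ->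
     wp c (fun s2 => I s2 /\ m s2 < m s1) (tick s1)) ->
  (forall s1, I s1 -> frame c s s1 -> ev inp s1 e2 <= ev inp s1 e1 -> Q (tick s1)) ->
  wp (CWhile e1 e2 c) Q s.
Proof.
move=> I0 body exit.
suff H k s1 : I s1 -> m s1 < k -> frame c s s1 -> wp (CWhile e1 e2 c) Q s1.
  exact: (H (m s).+1).
elim: k s1 => // k IH s1 I1 mk F.
have [lt|ge] := ltnP (ev inp s1 e1) (ev inp s1 e2); last first.
  by exists (tick s1); [exact: run_while_false | exact: exit].
have [s2 r2 [I2 m2]] := body s1 I1 F lt.
have [||s3 r3 q3] := IH s2 I2; first by lia.
  by apply: frame_trans F _; exact: (frame_trans (frame_tick (frame_refl _ _)) (run_frame r2)).
by exists s3 => //; exact: run_while_true lt r2 r3.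
Qed.

(** [cb] pays for the body together with the test before it; the failing test at the end is the last
    [tick]. *)
Lemma wp_for hi cb (I : nat -> st -> Prop) x e c (Q : st -> Prop) s :
  var s x <= hi -> (forall s1, frame c s s1 -> ev inp s1 e = hi) ->
  I (var s x) s ->
  (forall k s1, var s x <= k < hi -> var s1 x = k -> I k s1 -> frame c s s1 ->
     wp c (fun s2 => [/\ var s2 x = k.+1, I k.+1 s2 & tm s2 <= tm s1 + cb]) (tick s1)) ->
  (forall s1, var s1 x = hi -> I hi s1 -> frame c s s1 ->
     tm s1 <= tm s + (hi - var s x) * cb -> Q (tick s1)) ->
  wp (CWhile (EVar x) e c) Q s.
Proof.
move=> le eE I0 body exit.
pose J s1 := [/\ var s x <= var s1 x <= hi, I (var s1 x) s1 & tm s1 <= tm s + (var s1 x - var s x) * cb].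
apply: (@wp_while J (fun s1 => hi - var s1 x)).
- by split; rewrite ?leqnn ?subnn ?addn0.
- move=> s1 [h1 h2 h3] F /=; rewrite eE // => lt.
  have [||s2 r [a b t]] := body (var s1 x) s1 _ _ h2 F; [lia | by [] |].
  exists s2 => //; split; last by rewrite a; lia.
  split; rewrite a //; first by lia.
  by rewrite subSn ?mulSn; lia.
- move=> s1 [h1 h2 h3] F /=; rewrite eE // => ge.
  have e1 : var s1 x = hi by lia.
  by apply: exit => //; rewrite -e1.
Qed.

Lemma wp_down lo cb (I : nat -> st -> Prop) x e c (Q : st -> Prop) s :
  lo <= var s x -> (forall s1, frame c s s1 -> ev inp s1 e = lo) ->
  I (var s x) s ->
  (forall k s1, lo <= k < var s x -> var s1 x = k.+1 -> I k.+1 s1 -> frame c s s1 ->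
     wp c (fun s2 => [/\ var s2 x = k, I k s2 & tm s2 <= tm s1 + cb]) (tick s1)) ->
  (forall s1, var s1 x = lo -> I lo s1 -> frame c s s1 ->
     tm s1 <= tm s + (var s x - lo) * cb -> Q (tick s1)) ->
  wp (CWhile e (EVar x) c) Q s.
Proof.
move=> le eE I0 body exit.
pose J s1 := [/\ lo <= var s1 x <= var s x, I (var s1 x) s1 & tm s1 <= tm s + (var s x - var s1 x) * cb].
apply: (@wp_while J (fun s1 => var s1 x)).
- by split; rewrite ?leqnn ?subnn ?addn0 ?andbT.
- move=> s1 [h1 h2 h3] F /=; rewrite eE // => lt.
  have p1 : (var s1 x).-1.+1 = var s1 x by rewrite prednK //; lia.
  have [|||s2 r [a b t]] := body (var s1 x).-1 s1 _ _ _ F; [lia | by rewrite p1 | by rewrite p1 |].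
  exists s2 => //; split; last by rewrite a; lia.
  split; rewrite a //; first by lia.
  have -> : var s x - (var s1 x).-1 = (var s x - var s1 x).+1 by lia.
  by rewrite mulSn; lia.
- move=> s1 [h1 h2 h3] F /=; rewrite eE // => ge.
  have e1 : var s1 x = lo by lia.
  by apply: exit => //; rewrite -e1.
Qed.

End WP.

Ltac wstep :=
  match goal with
  | |- wp _ (CSeq _ _) _ _ => apply: wp_seq
  | |- wp _ (CSet _ _) _ _ => apply: wp_set
  | |- wp _ (CPut _ _ _ _) _ _ => apply: wp_put
  | |- wp _ (COut _ _) _ _ => apply: wp_out
  | |- wp _ CSkip _ _ => apply: wp_skip
  end.

Ltac wsteps := repeat wstep; rewrite /=.

Ltac fr :=
  repeat match goal with
  | F : frame _ _ ?s' |- context [var ?s' ?x] => rewrite (frV (x := x) F isT)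
  | F : frame _ _ ?s' |- context [arr ?s' ?a] => rewrite (frA (a := a) F isT)
  end.

Ltac frs := rewrite /=; fr; rewrite /=; fr; rewrite /=; fr; rewrite /=.

(** * The algorithm *)

Declare Scope cmd_scope.
Coercion EVar : nat >-> exp.
Notation "# k" := (ECst k) (at level 8, k at level 0, format "# k") : cmd_scope.
Notation "x ::= e" := (CSet x e) (at level 60) : cmd_scope.
Notation "c1 ;; c2" := (CSeq c1 c2) (at level 62, right associativity) : cmd_scope.
Local Open Scope cmd_scope.

Definition get (a : nat) (e : exp) : exp := EGet a e #0.
Definition put (a : nat) (e e' : exp) : cmd := CPut a e #0 e'.
Definition eeq (e e' : exp) : exp := ESub (ESub #1 (ESub e e')) (ESub e' e).
Definition incr (x : nat) : cmd := x ::= ESuc x.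

Arguments get _ _ /.
Arguments eeq _ _ /.

Notation vn := 0 (only parsing).
Notation vl := 1 (only parsing).
Notation vp := 2 (only parsing).
Notation vt := 3 (only parsing).
Notation vnn := 4 (only parsing).
Notation vk := 5 (only parsing).
Notation va := 6 (only parsing).
Notation vb := 7 (only parsing).
Notation vi := 8 (only parsing).
Notation vj := 9 (only parsing).
Notation vf := 10 (only parsing).
Notation vN := 11 (only parsing).
Notation vNE := 12 (only parsing).
Notation vN2 := 13 (only parsing).
Notation vu := 14 (only parsing).
Notation vz := 15 (only parsing).
Notation vx := 16 (only parsing).
Notation vy := 17 (only parsing).
Notation vc := 18 (only parsing).
Notation vq := 19 (only parsing).
Notation vo := 20 (only parsing).
Notation vqh := 21 (only parsing).
Notation vqt := 22 (only parsing).
Notation vw := 23 (only parsing).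
Notation vdv := 24 (only parsing).
Notation vd := 25 (only parsing).
Notation vh := 26 (only parsing).

Notation aPID := 0 (only parsing).
Notation aPAR := 1 (only parsing).
Notation aOPC := 2 (only parsing).
Notation aF := 3 (only parsing).
Notation aG := 4 (only parsing).
Notation aPOS := 5 (only parsing).
Notation aU := 6 (only parsing).
Notation aEX := 7 (only parsing).
Notation aCL := 8 (only parsing).
Notation aLO := 9 (only parsing).
Notation aHI := 10 (only parsing).
Notation aDI := 11 (only parsing).
Notation aPR := 12 (only parsing).
Notation aQ := 13 (only parsing).

(** * Replaying the construction sequence *)

Definition c_leaves : cmd :=
  vi ::= #0 ;; CWhile vi vn (put aPID vi vi ;; incr vi).

Definition c_relabel : cmd :=
  vi ::= #0 ;;
  CWhile vi vn
    (CIf #0 (eeq (get aPID vi) va) (put aPID vi vnn)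
       (CIf #0 (eeq (get aPID vi) vb) (put aPID vi vnn) CSkip) ;;
     incr vi).

Definition c_merge : cmd :=
  put aPAR va vnn ;; put aPAR vb vnn ;; c_relabel ;; incr vnn.

Definition c_op : cmd :=
  vk ::= EInp vp ;;
  va ::= get aPID (EInp (ESuc vp)) ;;
  vb ::= get aPID (EInp (ESuc (ESuc vp))) ;;
  CIf #0 vk
    (CIf #0 (EGet aOPC va vb) CSkip (CPut aOPC va vb vk ;; CPut aOPC vb va vk))
    c_merge ;;
  vp ::= ESuc (ESuc (ESuc vp)) ;;
  incr vt.

Definition c_ops : cmd := CWhile vt vl c_op.

Definition c_roots : cmd :=
  vi ::= #0 ;;
  CWhile vi vnn (CIf #0 (get aPAR vi) CSkip (put aPAR vi vnn) ;; incr vi).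

Section Forest.

Variable inp : nat -> nat.

Lemma eqE (a b : nat) : 1 - (a - b) - (b - a) = (a == b).
Proof. by case: eqP; lia. Qed.

Lemma leaves_ok n s : var s vn = n ->
  wp inp c_leaves (fun s' => (forall v, v < n -> arr s' aPID v 0 = v) /\
    tm s' <= tm s + (3 * n + 2)) s.
Proof.
move=> en; rewrite /c_leaves /put /incr; wsteps.
apply: (@wp_for _ n 3 (fun k s => forall v, v < k -> arr s aPID v 0 = v)) => //=.
- by move=> s1 F; fr.
- move=> k s1 hk ek IH F; wsteps; split; rewrite ?ek //; last by lia.
  by move=> v hv; rewrite andbT; case: eqP => // /eqP ne; apply: IH; lia.
- by move=> s1 e1 I F t; split; [exact: I | lia].
Qed.

Lemma relabel_ok n s : var s vn = n -> 
  wp inp c_relabel (fun s' => (forall v, v < n -> arr s' aPID v 0 =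
     if (arr s aPID v 0 == var s va) || (arr s aPID v 0 == var s vb) then var s vnn else arr s aPID v 0) /\
    tm s' <= tm s + (5 * n + 2)) s.
Proof.
move=> en; rewrite /c_relabel /put /incr; wsteps.
set f := fun v => if (arr s aPID v 0 == var s va) || (arr s aPID v 0 == var s vb) then var s vnn else arr s aPID v 0.
apply: (@wp_for _ n 5 (fun k s1 => forall v, v < n -> arr s1 aPID v 0 = if v < k then f v else arr s aPID v 0)) => //=.
- by move=> s1 F; fr.
- move=> k s1 hk ek IH F.
  have H b : (forall v, v < n -> arr s1 aPID v 0 = if v < k then f v else arr s aPID v 0) ->
      (b = f k) -> forall v, v < n -> 
      (if v == k then b else arr s1 aPID v 0) = if v < k.+1 then f v else arr s aPID v 0.
    by move=> h -> v hv; case: eqP => [->|/eqP ne]; rewrite ?ltnS ?leqnn // h // ltn_neqAle ne.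
  have IHk := IH k; rewrite ltnn in IHk.
  wsteps; apply: wp_if; rewrite /= eqE ek => h.
    wsteps; split; rewrite ?ek //; last by lia.
    move=> v hv; rewrite andbT; apply: H => //; fr => /=.
    rewrite /f -IHk; last by lia.
    move: h; fr => /=; by case: eqP.
  apply: wp_if; rewrite /= eqE ek => h'.
    wsteps; split; rewrite ?ek //; last by lia.
    move=> v hv; rewrite andbT; apply: H => //; fr => /=.
    rewrite /f -IHk; last by lia.
    move: h'; fr => /=; by case: eqP => // ->; rewrite ?orbT.
  wsteps; split; rewrite ?ek //; last by lia.
  move=> v hv; rewrite -(H (f k)) //; case: eqP => // ->.
  rewrite IHk; last by lia.
  rewrite /f -IHk; last by lia.
  move: h h'; fr => /=; by case: eqP => // _; case: eqP.
- move=> s1 e1 I F t; split; last by lia.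
  by move=> v hv; rewrite I // hv.
Qed.


Variable n : nat.

Definition mrep (m : model) (s : st) : Prop :=
  [/\ var s vn = n, var s vnn = nn m, forall v, v < n -> arr s aPID v 0 = pid m v,
      forall i, arr s aPAR i 0 = par m i & forall i j, arr s aOPC i j = opc m i j].

(** Only a merge visits all vertices. Its cost is charged to the growth of [nn], which is at most
    [n] in total. *)
Lemma op_ok m (o : op 'I_n) s p t : mrep m s -> var s vp = p -> var s vt = t ->
  inp p = code o -> inp p.+1 = o.1.2 -> inp p.+2 = o.2 ->
  wp inp c_op (fun s' => [/\ mrep (mstep m o) s', var s' vp = p.+3, var s' vt = t.+1 &
    tm s' <= tm s + 10 + (nn (mstep m o) - nn m) * (5 * n + 5)]) s.
Proof.
move=> [en enn epid epar eopc] ep et i0 i1 i2.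
rewrite /c_op /put /incr; wsteps.
have ea : arr s aPID (inp (var s vp).+1) 0 = pid m o.1.2 by rewrite ep i1 epid.
have eb : arr s aPID (inp (var s vp).+2) 0 = pid m o.2 by rewrite ep i2 epid.
rewrite ea eb ep i0; apply: wp_if => /= h.
  have c0 : (code o == 0) = false by rewrite eqn0Ngt h.
  apply: wp_if => /= ho; rewrite eopc in ho; wsteps; split=> //; rewrite ?ep ?et //;
    rewrite /mstep c0 /mresolve; try by rewrite /= subnn; lia.
    by split=> //= i j; rewrite eopc ifN // -lt0n.
  rewrite leqn0 in ho; split=> //= i j; rewrite ho eopc.
  by case: ((i == pid m o.2) && _); case: ((i == pid m o.1.2) && _).
have c0 : (code o == 0) by rewrite -leqn0.
rewrite /c_merge /put /incr; wsteps.
apply: (wp_conseq (relabel_ok (n := n) _)) => //= s1 [H1 T1] F1; wsteps.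
split; rewrite ?ep ?et; fr => /=; rewrite ?ep ?et //; last first.
  by rewrite /mstep c0 /= subSnn mul1n; lia.
rewrite /mstep c0 /mmerge; split=> /=; fr => //=.
- by rewrite enn.
- by move=> v hv; rewrite H1 // epid // enn.
- by move=> i; rewrite epar enn !andbT.
Qed.

Lemma ops_ok (ops : seq (op 'I_n)) s :
  (forall i, i < size ops -> exists o : op 'I_n,
    [/\ take i.+1 ops = rcons (take i ops) o, inp (2 + 3 * i) = code o,
        inp (2 + 3 * i).+1 = o.1.2 & inp (2 + 3 * i).+2 = o.2]) ->
  mrep (minit n) s -> var s vp = 2 -> var s vt = 0 -> var s vl = size ops ->
  wp inp c_ops (fun s' => mrep (final (minit n) ops) s' /\
    tm s' <= tm s + 11 * size ops + (nn (final (minit n) ops) - n) * (5 * n + 5) + 1) s.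
Proof.
move=> hin R0 ep et el.
pose m i := final (minit n) (take i ops).
pose I i s1 := [/\ mrep (m i) s1, var s1 vp = 2 + 3 * i, var s1 vt = i, i <= size ops &
   tm s1 <= tm s + 11 * i + (nn (m i) - n) * (5 * n + 5)].
apply: (@wp_while _ (fun s1 => I (var s1 vt) s1) (fun s1 => size ops - var s1 vt)).
- by rewrite et /I /m take0 ep /=; split=> //; lia.
- move=> s1 [R ep1 _ le t1] F /=; fr; rewrite el => lt.
  have [o [eo c0 c1 c2]] := hin _ lt.
  have em : m (var s1 vt).+1 = mstep (m (var s1 vt)) o by rewrite /m eo final_rcons.
  apply: (wp_conseq (op_ok (m := m (var s1 vt)) (p := 2 + 3 * var s1 vt) (t := var s1 vt) (o := o) _ _ _ _ _ _)) => //.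
  move=> s2 [R2 ep2 et2 T2] F2; rewrite et2; split; last by lia.
  rewrite /I em; split=> //; first by rewrite ep2; lia.
  have := nn_step (m (var s1 vt)) o; have : n <= nn (m (var s1 vt)) by exact: (nn_final (minit n)).
  move: T2 t1 => /=; set a := nn (mstep _ _); set b := nn (m _) => T2 t1 nb ba.
  have -> : a - n = (b - n) + (a - b) by lia.
  by rewrite mulnDl; lia.
- move=> s1 [R ep1 _ le t1] F /=; fr; rewrite el => ge.
  have e1 : var s1 vt = size ops by lia.
  rewrite e1 /m take_size in R t1; split; [exact: R | rewrite /=; lia].
Qed.

Lemma roots_ok m s : mrep m s ->
  wp inp c_roots (fun s' => (forall i, i < nn m -> arr s' aPAR i 0 = parf m i) /\
    tm s' <= tm s + (4 * nn m + 2)) s.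
Proof.
move=> [en enn epid epar eopc]; rewrite /c_roots /put /incr; wsteps.
apply: (@wp_for _ (nn m) 4 (fun k s1 => forall i, arr s1 aPAR i 0 = if i < k then parf m i else par m i)) => //=.
- by move=> s1 F; fr.
- move=> k s1 hk ek IH F.
  have IHk := IH k; rewrite ltnn in IHk.
  wsteps; apply: wp_if => /=; rewrite ek IHk => h; wsteps; split; rewrite ?ek //=; try lia;
    move=> i; rewrite ltnS leq_eqVlt; case: eqP => [->|_] //=; fr => //=; rewrite /parf ?IHk.
  + by rewrite eqn0Ngt h.
  + by rewrite enn -leqn0 h.
- move=> s1 e1 I F t; split; last by lia.
  by move=> i hi; rewrite I hi.
Qed.

End Forest.

(** * First colours and vertex order by recursion over pairs of nodes *)

Definition c_cell : cmd :=
  vj ::= ESub vj #1 ;;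
  va ::= get aPAR vi ;;
  vb ::= get aPAR vj ;;
  vf ::= EGet aOPC vi vj ;;
  CIf va vb
    (CIf #0 vf CSkip (vf ::= EGet aF va vj) ;; CPut aG vi vj (EGet aG va vj))
    (CIf vb va
       (CIf #0 vf CSkip (vf ::= EGet aF vi vb) ;; CPut aG vi vj (EGet aG vi vb))
       (CIf #0 vf CSkip (vf ::= EGet aF va va) ;;
        CPut aG vi vj (ESub #1 (ESub #1 (ESub vj vi))))) ;;
  CPut aF vi vj vf.

Definition c_table : cmd :=
  vi ::= vnn ;;
  CWhile #0 vi (vi ::= ESub vi #1 ;; vj ::= vnn ;; CWhile #0 vj c_cell).

Section Table.

Variable inp : nat -> nat.

Definition cellF (m : model) (F : nat -> nat -> nat) (i j : nat) : nat :=
  if opc m i j != 0 then opc m i j else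
  if parf m i < parf m j then F (parf m i) j else
  if parf m j < parf m i then F i (parf m j) else F (parf m i) (parf m i).

Definition cellG (m : model) (G : nat -> nat -> nat) (i j : nat) : nat :=
  if parf m i < parf m j then G (parf m i) j else
  if parf m j < parf m i then G i (parf m j) else i < j.

Lemma cell_ok m s i j : var s vi = i -> var s vj = j.+1 ->
  arr s aPAR i 0 = parf m i -> arr s aPAR j 0 = parf m j -> arr s aOPC i j = opc m i j ->
  wp inp c_cell (fun s' => [/\ var s' vj = j,
    forall i' j', arr s' aF i' j' =
      if (i' == i) && (j' == j) then cellF m (arr s aF) i j else arr s aF i' j',
    forall i' j', arr s' aG i' j' =
      if (i' == i) && (j' == j) then cellG m (arr s aG) i j else arr s aG i' j'
    & tm s' <= tm s + 10]) s.
Proof.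
move=> ei ej pi pj eo; rewrite /c_cell; wsteps.
have e1 : j.+1 - 1 = j by rewrite subn1.
rewrite ei ej e1 pi pj eo /cellF /cellG.
apply: wp_if => /= h; rewrite ?h.
  wsteps; apply: wp_if => /= ho; wsteps; split; rewrite ?ei ?e1 //; try lia;
    move=> i' j'; rewrite ?lt0n in ho *; rewrite ?ho //.
  by rewrite leqn0 in ho; rewrite ho.
rewrite (ltnNge (parf m i)) h /=.
apply: wp_if => /= h'; rewrite ?h'.
  wsteps; apply: wp_if => /= ho; wsteps; split; rewrite ?ei ?e1 //; try lia;
    move=> i' j'; rewrite ?lt0n in ho *; rewrite ?ho //.
  by rewrite leqn0 in ho; rewrite ho.
rewrite (ltnNge (parf m j)) h' /=.
have lte : 1 - (1 - (j - i)) = (i < j) by lia.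
wsteps; apply: wp_if => /= ho; wsteps; split; rewrite ?ei ?e1 //; try lia;
  move=> i' j'; rewrite ?lt0n in ho *; rewrite ?ho ?lte //.
by rewrite leqn0 in ho; rewrite ho.
Qed.

Lemma parf_bounds n (m : model) i : wf n m -> i < nn m -> i < parf m i <= nn m.
Proof.
move=> w h; rewrite /parf; case: eqP => [_|/eqP]; first by rewrite h leqnn.
by move/(wf_par w); lia.
Qed.

(** Parents have larger numbers than their children, so with both indices descending a cell reads
    finished cells only. The cell [(nn m, nn m)] lies outside the loops and keeps its initial 0. *)
Lemma table_ok n m s : wf n m -> var s vnn = nn m ->
  (forall i, i < nn m -> arr s aPAR i 0 = parf m i) ->
  (forall i j, arr s aOPC i j = opc m i j) ->
  arr s aF (nn m) (nn m) = 0 ->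
  wp inp c_table (fun s' => [/\ tabF m (arr s' aF), tabG m (fun i j => 0 < arr s' aG i j) &
    tm s' <= tm s + nn m * (11 * nn m + 4) + 2]) s.
Proof.
move=> w enn epar eopc e0; rewrite /c_table; wsteps.
pose good s1 i j := arr s1 aF i j = cellF m (arr s1 aF) i j /\
                    arr s1 aG i j = cellG m (arr s1 aG) i j.
pose D i k s1 := arr s1 aF (nn m) (nn m) = 0 /\ forall i' j', i' < nn m -> j' < nn m ->
  (i < i') || ((i' == i) && (k <= j')) -> good s1 i' j'.
have B i := @parf_bounds n m i w.
apply: (@wp_down _ 0 (11 * nn m + 4) (fun k s1 => D k 0 s1)) => //=.
- by split=> //= i' j'; rewrite enn; lia.
- move=> k s1 hk ek Dk F; wsteps; rewrite enn in hk.
  apply: (@wp_down _ 0 11 (fun j s2 => D k j s2)) => //=.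
  + split=> [|i' j' hi' hj' h]; first exact: Dk.1.
    apply: Dk.2 => //; move: h; fr => /=; rewrite ?enn; lia.
  + move=> j s2; fr => /=; rewrite enn => hj ej Dj F2.
    have ei2 : var s2 vi = k by fr => /=; rewrite ek subn1.
    apply: (wp_conseq (cell_ok (m := m) (i := k) (j := j) _ _ _ _ _)) => //=.
    * by fr => /=; fr => /=; rewrite epar.
    * by fr => /=; fr => /=; rewrite epar; lia.
    * by fr => /=; fr => /=; rewrite eopc.
    move=> s3 [ej3 EF EG T3] F3; split=> //; last by lia.
    have Bk := B k hk; have Bj := B j hj.
    split=> [|i' j' hi' hj' h].
      by rewrite EF; case: andP => [[/eqP a /eqP b]|_]; [lia | exact: Dj.1].
    have Bi' := B i' hi'; have Bj' := B j' hj'.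
    have [/andP[/eqP ei' /eqP ej']|ne] := boolP ((i' == k) && (j' == j)).
      rewrite /good EF EG ei' ej' !eqxx /= /cellF /cellG !EF !EG !eqxx /= andbT.
      by rewrite !(gtn_eqF (_ : k < parf m k)) ?(gtn_eqF (_ : j < parf m j)) //=; lia.
    have [gF gG] : good s2 i' j' by apply: Dj.2 => //; lia.
    rewrite /good EF EG (negbTE ne) gF gG /cellF /cellG !EF !EG; split.
      case: ifP => // _; case: ifP => _; first by rewrite ifN //; lia.
      case: ifP => _; first by rewrite ifN //; lia.
      by rewrite ifN //; lia.
    case: ifP => _; first by rewrite ifN //; lia.
    by case: ifP => _ //; rewrite ifN //; lia.
  + move=> s2 e2 D2 F2 T2; fr => /=; split; rewrite ?ek ?subn1 //; last first.
      by move: T2; fr => /=; rewrite enn; lia.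
- move=> s1 e1 D1 F T; have [z1 g1] := D1.
  split.
  + split=> // i j hi hj; have h0 : (0 < i) || ((i == 0) && (0 <= j)) by lia.
    by have [-> _] := g1 i j hi hj h0.
  + move=> i j hi hj; have h0 : (0 < i) || ((i == 0) && (0 <= j)) by lia.
    have [_ ->] := g1 i j hi hj h0.
    by rewrite /cellG; case: ifP => // _; case: ifP => // _; rewrite lt0b.
  + by move: T; rewrite enn; lia.
Qed.

End Table.

(** * Positions of the vertices and rows of the adjacency matrix *)

Definition c_pow : cmd :=
  vN ::= #1 ;;
  CWhile vN vn (vu ::= vN ;; vz ::= #0 ;; CWhile vz vu (incr vN ;; incr vz)).

Definition c_pos : cmd :=
  vx ::= #0 ;;
  CWhile vx vn
    (vc ::= vN ;; vy ::= #0 ;;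
     CWhile vy vn (CIf #0 (EGet aG vy vx) (incr vc) CSkip ;; incr vy) ;;
     put aPOS vx vc ;; incr vx).

Definition c_ends : cmd :=
  vNE ::= vN ;; vz ::= #0 ;; CWhile vz vn (incr vNE ;; incr vz) ;;
  vN2 ::= vN ;; vz ::= #0 ;; CWhile vz vN (incr vN2 ;; incr vz).

Definition c_fill : cmd :=
  vx ::= #0 ;;
  CWhile vx vn
    (vy ::= #0 ;;
     CWhile vy vn
       (CIf #0 (eeq (EGet aF vx vy) #1) (CPut aU (get aPOS vx) (get aPOS vy) #1) CSkip ;;
        incr vy) ;;
     incr vx).

Section Layout.

Variable inp : nat -> nat.

(** Doubling is done by increments, and its total cost is a geometric sum. *)
Lemma pow_ok n s : var s vn = n ->
  wp inp c_pow (fun s' => exists L, [/\ var s' vN = 2 ^ L, n <= 2 ^ L, 0 < L -> 2 ^ L.-1 < n &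
    tm s' <= tm s + 10 * 2 ^ L]) s.
Proof.
move=> en; rewrite /c_pow /incr; wsteps.
pose I s1 := exists L, [/\ var s1 vN = 2 ^ L, 0 < L -> 2 ^ L.-1 < n & tm s1 + 9 <= tm s + 10 * 2 ^ L].
apply: (@wp_while _ I (fun s1 => n - var s1 vN)) => /=.
- by exists 0; split=> //=; lia.
- move=> s1 [L [eN hL T]] F; fr => /=; rewrite en => lt; wsteps.
  apply: (@wp_for _ (2 ^ L) 3 (fun k s2 => var s2 vN = 2 ^ L + k)) => //=.
  + by move=> s2 F2; fr.
  + by rewrite eN addn0.
  + by move=> k s2 hk ek e2 F2; wsteps; split; rewrite ?ek ?e2 //; lia.
  + move=> s2 e2 eN2 F2 T2.
    have p : 0 < 2 ^ L by rewrite expn_gt0.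
    split; last by rewrite eN2 eN; rewrite eN in lt; lia.
    exists L.+1; split; rewrite ?eN2 ?expnS //=; first by lia.
      by rewrite eN in lt.
    by move: T2; rewrite /= => T2; lia.
- move=> s1 [L [eN hL T]] F; fr => /=; rewrite en => le.
  by exists L; split=> //; [rewrite -eN | lia].
Qed.

Lemma pos_ok n N s : var s vn = n -> var s vN = N ->
  wp inp c_pos (fun s' =>
    (forall x, x < n -> arr s' aPOS x 0 = N + \sum_(y < n) (0 < arr s aG y x)) /\
    tm s' <= tm s + n * (4 * n + 6) + 2) s.
Proof.
move=> en eN; rewrite /c_pos /put /incr; wsteps.
apply: (@wp_for _ n (4 * n + 6) (fun k s1 => forall x, x < k ->
   arr s1 aPOS x 0 = N + \sum_(y < n) (0 < arr s aG y x))) => //=.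
- by move=> s1 F; fr.
- move=> k s1 hk ek Ik F; wsteps.
  apply: (@wp_for _ n 4 (fun j s2 => var s2 vc = N + \sum_(y < j) (0 < arr s aG y k))) => //=.
  + by move=> s2 F2; fr => /=; fr.
  + by rewrite big_ord0 addn0; fr.
  + move=> j s2 hj ej Ij F2; wsteps; apply: wp_if; frs; rewrite ej ek => h; wsteps;
      split; rewrite ?ej //= ?Ij ?big_ord_recr /= ?h ?(ltnNge 0 (arr s _ j k)) ?h; try lia.
  + move=> s2 e2 I2 F2 T2; wsteps; split; frs; rewrite ?ek //.
      move=> x hx; rewrite andbT; case: eqP => [->|/eqP ne]; first by rewrite I2.
      by fr => /=; apply: Ik; lia.
    by move: T2 => /=; lia.
- by move=> s1 e1 I1 F T; split; [exact: I1 | lia].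
Qed.

Lemma ends_ok n N s : var s vn = n -> var s vN = N ->
  wp inp c_ends (fun s' => [/\ var s' vNE = N + n, var s' vN2 = 2 * N &
    tm s' <= tm s + 3 * n + 3 * N + 6]) s.
Proof.
move=> en eN; rewrite /c_ends /incr; wsteps.
apply: (@wp_for _ n 3 (fun k s1 => var s1 vNE = N + k)) => //=; rewrite ?eN ?addn0 //.
- by move=> s1 F; fr.
- by move=> k s1 hk ek Ik F; wsteps; split; rewrite ?ek ?Ik //; lia.
move=> s1 e1 I1 F T; wsteps.
apply: (@wp_for _ N 3 (fun k s1 => var s1 vN2 = N + k)) => //=; fr => /=; rewrite ?eN ?addn0 //.
- by move=> s2 F2; fr => /=; fr.
- by move=> k s2 hk ek Ik F2; wsteps; split; rewrite ?ek ?Ik //; lia.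
by move=> s2 e2 I2 F2 T2; split; fr => //=; rewrite ?I1 ?I2 //; lia.
Qed.

Lemma fill_ok n (P : nat -> nat) s : var s vn = n ->
  (forall x, x < n -> arr s aPOS x 0 = P x) -> (forall i j, arr s aU i j = 0) ->
  wp inp c_fill (fun s' => (forall c c', arr s' aU c c' =
     [exists x : 'I_n, exists y : 'I_n, [&& P x == c, P y == c' & arr s aF x y == 1]]) /\
    tm s' <= tm s + n * (5 * n + 4) + 2) s.
Proof.
move=> en eP eU; rewrite /c_fill /incr; wsteps.
pose D k j s1 := forall c c', arr s1 aU c c' =
  [exists x : 'I_n, exists y : 'I_n,
    [&& (x < k) || ((x == k :> nat) && (y < j)), P x == c, P y == c' & arr s aF x y == 1]] :> nat.
apply: (@wp_for _ n (5 * n + 4) (fun k s1 => D k 0 s1)) => //=.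
- by move=> s1 F; fr.
- move=> c c'; rewrite eU; case: existsP => // -[x /existsP[y]]; lia.
- move=> k s1 hk ek Ik F; wsteps.
  apply: (@wp_for _ n 5 (fun j s2 => D k j s2)) => //=.
  + by move=> s2 F2; fr => /=; fr.
  + move=> j s2 hj ej Ij F2; wsteps.
    have S b : b = (arr s aF k j == 1) -> forall c c',
       (if [&& b, c == P k & c' == P j] then 1 else arr s2 aU c c') =
       [exists x : 'I_n, exists y : 'I_n,
         [&& (x < k) || ((x == k :> nat) && (y < j.+1)), P x == c, P y == c' & arr s aF x y == 1]].
      move=> eb c c'; rewrite Ij; case: ifP => [/and3P[b1 /eqP -> /eqP ->]|nb].
        rewrite (introT existsP) //; exists (Ordinal hk).
        apply/existsP; exists (Ordinal hj); rewrite /= !eqxx leqnn orbT /=.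
        by rewrite -eb.
      congr (nat_of_bool _); apply/existsP/existsP => -[x /existsP[y h]]; exists x; apply/existsP; exists y.
        by case/and4P: h => h1 -> -> ->; rewrite !andbT; lia.
      case/and4P: h => h1 h2 h3 h4; rewrite h2 h3 h4 !andbT.
      case/orP: h1 => [->//|/andP[/eqP xk]]; rewrite ltnS leq_eqVlt => /orP[/eqP yj|yj]; last first.
        by rewrite xk eqxx yj orbT.
      by move: nb; rewrite eb -xk -yj h4 (eqP h2) (eqP h3) !eqxx.
    apply: wp_if; rewrite /= eqE; frs; rewrite ej ek => h; wsteps;
      split; rewrite ?ej //; try lia; move=> c c' /=; rewrite -(S _ (erefl _)).
      frs; rewrite ?ek ?ej /= !eP //.
      by have -> : arr s aF k j == 1 by move: h; case: eqP.
    by have -> : (arr s aF k j == 1) = false by move: h; case: eqP.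
  + move=> s2 e2 I2 F2 T2; wsteps; split; fr => //=; rewrite ?ek //; last first.
      by move: T2 => /=; lia.
    move=> c c'; rewrite I2; congr (nat_of_bool _).
    apply/existsP/existsP => -[x /existsP[y h]]; exists x; apply/existsP; exists y;
      by case/and4P: h => h1 -> -> ->; rewrite !andbT; have := ltn_ord y; lia.
- move=> s1 e1 I1 F T; split; last by lia.
  move=> c c'; rewrite I1; congr (nat_of_bool _).
  apply/existsP/existsP => -[x /existsP[y h]]; exists x; apply/existsP; exists y.
    by case/and4P: h => _ -> -> ->.
  by rewrite ltn_ord.
Qed.

End Layout.

(** * Common neighbourhoods in the tree and successors in S_q *)

Definition c_heap : cmd :=
  vc ::= vN2 ;;
  CWhile #2 vc
    (vq ::= EHalf (ESub vc #1) ;; vy ::= vN ;;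
     CWhile vy vNE
       (CIf #0 (EGet aU (ESub vc #1) vy)
          (CIf #0 (EGet aU (ESub vc #2) vy) (CPut aU vq vy #1) CSkip) CSkip ;;
        incr vy) ;;
     vc ::= ESub vc #2).

(** Halving the root 1 leads to row 0, which is empty in the heap, so that S_1 is U_1. The value
    [N + n] means that no element follows. *)
Definition c_next : cmd :=
  vq ::= #1 ;;
  CWhile vq vN2
    (vf ::= vNE ;; vy ::= vNE ;; CPut aEX vq vNE vNE ;;
     CWhile vN vy
       (vy ::= ESub vy #1 ;;
        CIf #0 (EGet aU vq vy) (CIf #0 (EGet aU (EHalf vq) vy) CSkip (vf ::= vy)) CSkip ;;
        CPut aEX vq vy vf) ;;
     incr vq).

Section Heap.

Variables (inp : nat -> nat) (n N : nat).

(** With no multiplication at hand, the loop runs over the children: for [vc = 2 * k] the nodes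
    [vc - 1] and [vc - 2] are the children of [k - 1], which is found by halving. *)
Lemma heap_ok s : 0 < N -> var s vN = N -> var s vNE = N + n -> var s vN2 = 2 * N ->
  (forall q y, q < N -> arr s aU q y = 0) ->
  wp inp c_heap (fun s' => [/\
    forall q y, 0 < q < N -> N <= y < N + n ->
      (0 < arr s' aU q y) = (0 < arr s' aU (2 * q) y) && (0 < arr s' aU (2 * q).+1 y),
    forall y, arr s' aU 0 y = 0, forall q y, N <= q -> arr s' aU q y = arr s aU q y
    & tm s' <= tm s + N * (5 * n + 5) + 2]) s.
Proof.
move=> N0 eN eNE eN2 eU; rewrite /c_heap /incr; wsteps.
pose I s1 := exists k, [/\ var s1 vc = 2 * k, 1 <= k <= N,
    forall q y, k <= q < N -> N <= y < N + n ->
      (0 < arr s1 aU q y) = (0 < arr s1 aU (2 * q) y) && (0 < arr s1 aU (2 * q).+1 y),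
    (forall q y, q < k -> arr s1 aU q y = 0) /\ (forall q y, N <= q -> arr s1 aU q y = arr s aU q y)
  & tm s1 <= (tm s).+1 + (N - k) * (5 * n + 5)].
apply: (@wp_while _ I (fun s1 => var s1 vc)) => /=.
- exists N; rewrite leqnn N0 subnn addn0; split=> // q y; lia.
- move=> s1 [k [ec hk eqs [z keep] T]] F; fr => /=; rewrite ec => lt; wsteps.
  have [k' ek] : exists k', k = k'.+1 by exists k.-1; lia.
  have hq : (2 * k - 1) %/ 2 = k' by lia.
  have k'k : k' < k by rewrite ek.
  have n1 : (2 * k').+1 != k' by lia.
  have n2 : 2 * k' != k' by lia.
  pose J j s2 := (forall q y, q != k' -> arr s2 aU q y = arr s1 aU q y) /\
    (forall y, arr s2 aU k' y = [&& N <= y, y < j, 0 < arr s1 aU (2 * k') y & 0 < arr s1 aU (2 * k').+1 y] :> nat).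
  apply: (@wp_for _ (N + n) 5 J) => //=.
  + by frs; rewrite eN; lia.
  + by move=> s2 F2; frs.
  + split=> // y; rewrite (z k') //.
    by case: and4P => // -[]; frs; rewrite ?eN; lia.
  + move=> j s2; frs; rewrite eN => hj ej [J1 J2] F2.
    have e1 : 2 * k - 1 = (2 * k').+1 by lia.
    have e2 : 2 * k - 2 = 2 * k' by lia.
    have S b : b = (0 < arr s1 aU (2 * k') j) && (0 < arr s1 aU (2 * k').+1 j) -> forall A,
       (forall q y, A q y = if b && ((q == k') && (y == j)) then 1 else arr s2 aU q y) ->
       (forall q y, q != k' -> A q y = arr s1 aU q y) /\
       (forall y, A k' y = [&& N <= y, y < j.+1, 0 < arr s1 aU (2 * k') y & 0 < arr s1 aU (2 * k').+1 y] :> nat).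
      move=> eb A eA; split=> [q y qk|y]; first by rewrite eA (negbTE qk) andbF J1.
      rewrite eA eqxx /= J2 eb (ltnS y j) (leq_eqVlt y j); have [->|ne] := eqVneq y j; last by rewrite andbF /=.
      by rewrite andbT ltnn /=; case/andP: hj => -> _; case: (_ && _).
    wsteps; apply: wp_if; frs; rewrite ec e1 ej J1 // => h.
      apply: wp_if; frs; rewrite ec e2 ej J1 // => h'; wsteps.
        split; rewrite ?ej //; try lia; apply: (S true); first by rewrite h h'.
        by move=> q y /=; frs; rewrite ?ec ?hq ?ej.
      split; rewrite ?ej //; try lia; apply: (S false) => //.
      by rewrite ltnNge h'.
    wsteps; split; rewrite ?ej //; try lia; apply: (S false) => //.
    by rewrite andbC ltnNge h.
  + move=> s2 e2 [J1 J2] F2 T2; wsteps; frs; rewrite ec; split; last by lia.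
    exists k'; split=> /=; first by lia.
    * by lia.
    * move=> q y hqq hy; have [->|ne] := eqVneq q k'.
        rewrite J2 (J1 _ y n1) (J1 _ y n2) lt0b.
        by case/andP: hy => -> ->.
      have m1 : 2 * q != k' by lia.
      have m2 : (2 * q).+1 != k' by lia.
      by rewrite (J1 q y ne) (J1 _ y m1) (J1 _ y m2); apply: eqs => //; lia.
    * split=> q y hqq; rewrite J1; try lia; [by apply: z; lia | exact: keep].
    * move: T2 T => /=; frs; rewrite eN ek (_ : N + n - N = n); last by lia.
      have -> : N - k' = (N - k).+1 by lia.
      by rewrite mulSn ek; lia.
- move=> s1 [k [ec hk eqs [z keep] T]] F; fr => /=; rewrite ec => ge.
  have e1 : k = 1 by lia.
  rewrite e1 in eqs z T; split=> //.
  + by move=> y; apply: z.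
  + have: (N - 1) * (5 * n + 5) <= N * (5 * n + 5) by rewrite leq_mul2r; lia.
    by move=> h; lia.
Qed.

Definition is_next (U : nat -> nat -> bool) (q y z : nat) : Prop :=
  [/\ y <= z <= N + n, forall w, y <= w < z -> ~~ top U q w & z < N + n -> top U q z].

Lemma next_ok s : 0 < N -> var s vN = N -> var s vNE = N + n -> var s vN2 = 2 * N ->
  wp inp c_next (fun s' => (forall q y, 0 < q < 2 * N -> N <= y <= N + n ->
      is_next (fun i j => 0 < arr s aU i j) q y (arr s' aEX q y))
    /\ tm s' <= tm s + 2 * N * (6 * n + 6) + 2) s.
Proof.
move=> N0 eN eNE eN2; rewrite /c_next /incr; wsteps.
set Ub := fun i j => 0 < arr s aU i j.
pose D k s1 := forall q y, 0 < q < k -> N <= y <= N + n -> is_next Ub q y (arr s1 aEX q y).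
apply: (@wp_for _ (2 * N) (6 * n + 6) D) => //=.
- by lia.
- by move=> s1 F; frs.
- by move=> q y; lia.
- move=> k s1 hk ek Dk F; wsteps.
  pose J j s2 := [/\ forall q y, 0 < q < k -> N <= y <= N + n -> is_next Ub q y (arr s2 aEX q y),
     forall y, j <= y <= N + n -> is_next Ub k y (arr s2 aEX k y) & is_next Ub k j (var s2 vf)].
  apply: (@wp_down _ N 6 J) => //=.
  + by frs; rewrite eNE; lia.
  + by move=> s2 F2; frs.
  + frs; rewrite /J /= eNE ek; frs; split.
    * by move=> q y hq hy; rewrite ifN; [exact: Dk | lia].
    * move=> y hy; have -> : y = N + n by lia.
      by rewrite !eqxx /=; split=> [|w|]; lia.
    * by split=> [|w|] /=; lia.
  + move=> j s2; frs; rewrite eNE => hj ej [J1 J2 J3] F2; wsteps.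
    have S z A : is_next Ub k j z -> (forall q y, A q y = if (q == k) && (y == j) then z else arr s2 aEX q y) ->
      (forall q y, 0 < q < k -> N <= y <= N + n -> is_next Ub q y (A q y)) /\
      (forall y, j <= y <= N + n -> is_next Ub k y (A k y)).
      move=> hz hA; split=> [q y hq hy|y hy]; rewrite hA.
        by rewrite ifN; [exact: J1 | lia].
      by rewrite eqxx /=; case: eqP => [->//|ne]; apply: J2; lia.
    have [a1 a2 a3] := J3.
    have nt : ~~ top Ub k j -> is_next Ub k j (var s2 vf).
      move=> h; split=> //; first by lia.
      by move=> w hw; have [->//|ne] := eqVneq w j; apply: a2; lia.
    apply: wp_if; frs; rewrite ej ek subn1 /= => h.
      apply: wp_if; frs; rewrite ?ej ?ek ?subn1 /= => h'; wsteps; frs; rewrite ?ej ?subn1 ?ek /=.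
        have nt' : is_next Ub k j (var s2 vf) by apply: nt; rewrite /top /Ub h' andbF.
        have [b1 b2] := S _ _ nt' (fun q y => erefl).
        by split; [by [] | split | lia].
      have nt' : is_next Ub k j j.
        split=> [|w|_]; [by lia | by lia | by rewrite /top /Ub h -leqNgt h'].
      have [b1 b2] := S _ _ nt' (fun q y => erefl).
      by split; [by [] | split | lia].
    wsteps; frs; rewrite ?ej ?subn1 ?ek /=.
    have nt' : is_next Ub k j (var s2 vf) by apply: nt; rewrite /top /Ub ltnNge h.
    have [b1 b2] := S _ _ nt' (fun q y => erefl).
    by split; [by [] | split | lia].
  + move=> s2 e2 [J1 J2 J3] F2 T2; wsteps; frs; rewrite ek; split=> //.
      move=> q y hq hy; have [->|ne] := eqVneq q k; first by apply: J2.
      by apply: J1 => //; lia.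
    by move: T2 => /=; frs; rewrite eNE; lia.
- move=> s1 e1 D1 F T; split; first by move=> q y hq hy; apply: D1.
  have: (2 * N - 1) * (6 * n + 6) <= 2 * N * (6 * n + 6) by rewrite leq_mul2r; lia.
  by lia.
Qed.

End Heap.

(** * Union-find on intervals of positions *)

Definition c_union : cmd :=
  vc ::= get aCL vw ;; vd ::= get aCL (ESuc vw) ;;
  CIf (ESub (get aHI vd) vw) (ESub (ESuc vw) (get aLO vc))
    (vz ::= ESuc vw ;; vh ::= get aHI vd ;; put aHI vc vh ;;
     CWhile vz (ESuc vh) (put aCL vz vc ;; incr vz))
    (vz ::= get aLO vc ;; put aLO vd vz ;;
     CWhile vz (ESuc vw) (put aCL vz vd ;; incr vz)).

Definition c_visit : cmd :=
  put aDI vw vdv ;; put aQ vqt vw ;; incr vqt ;; c_union.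

Section Union.

Variables (inp : nat -> nat) (n N : nat).

(* [LO c] and [HI c] bound the interval labelled [c].  The only unvisited element
   of an interval is its last one, and [N + n] is a sentinel that is never
   visited: [HI (CL y)] is the first unvisited position from [y] on. *)
Definition ufok (CL LO HI : nat -> nat) (vis : nat -> bool) : Prop :=
  forall y, N <= y <= N + n ->
    [/\ N <= LO (CL y) <= y, y <= HI (CL y) <= N + n,
        forall z, LO (CL y) <= z <= HI (CL y) -> CL z = CL y,
        ~~ vis (HI (CL y)) & forall z, LO (CL y) <= z < HI (CL y) -> vis z].

(* Relabelling the smaller of two intervals at least doubles the length of the
   interval of every relabelled element, so this potential pays for it. *)
Definition Phi (CL LO HI : nat -> nat) : nat :=
  \sum_(i < n.+1) trunc_log 2 (HI (CL (N + i)) - LO (CL (N + i))).+1.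

Lemma sum_interval m a b : a <= b <= m -> \sum_(i < m) (a <= i < b) = b - a.
Proof.
have E k : \sum_(i < k) (a <= i < b) = minn b k - a.
  by elim: k => [|k IH]; rewrite ?big_ord0 ?big_ord_recr /= ?IH; lia.
by move=> h; rewrite E; lia.
Qed.

Lemma trunc_log_double a b : 0 < a -> 2 * a <= b -> (trunc_log 2 a).+1 <= trunc_log 2 b.
Proof. by move=> a0 h; rewrite -trunc_logMp //; apply: leq_trunc_log. Qed.

(** Visiting [w], the last element of its interval, joins this interval to the one starting at
    [w.+1]. The label [r] of either may survive; the potential rises by at least the length of the
    shorter interval. *)
Lemma union_pure CL LO HI vis CL' LO' HI' w r : ufok CL LO HI vis ->
  N <= w < N + n -> ~~ vis w ->
  (r == CL w) || (r == CL w.+1) ->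
  (forall z, N <= z <= N + n -> CL' z = if LO (CL w) <= z <= HI (CL w.+1) then r else CL z) ->
  (forall x, LO' x = if x == r then LO (CL w) else LO x) ->
  (forall x, HI' x = if x == r then HI (CL w.+1) else HI x) ->
  ufok CL' LO' HI' (fun z => vis z || (z == w)) /\
  Phi CL LO HI + minn (w.+1 - LO (CL w)) (HI (CL w.+1) - w) <= Phi CL' LO' HI'.
Proof.
move=> U hw nv hr eCL eLO eHI.
have [a1 a2 a3 a4 a5] := U w ltac:(lia).
have [b1 b2 b3 b4 b5] := U w.+1 ltac:(lia).
set c := CL w in a1 a2 a3 a4 a5 hr eCL eLO *.
set d := CL w.+1 in b1 b2 b3 b4 b5 hr eCL eHI *.
(* All elements of an interval but the last are visited, and [w] is not. *)
have ec : HI c = w.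
  by apply/eqP; rewrite eqn_leq; case/andP: a2 => -> _; rewrite andbT leqNgt;
    apply: contra nv => h; apply: a5; lia.
have ed : LO d = w.+1.
  apply/eqP; rewrite eqn_leq; case/andP: b1 => _ ->; rewrite ltnNge; apply/negP => h.
  have e : c = d by apply: b3; lia.
  by move: b2; rewrite -e ec; lia.
have cE z : N <= z <= N + n -> CL z = c -> LO c <= z <= w.
  by move=> hz e; have [h1 h2 _ _ _] := U z hz; move: h1 h2; rewrite e ec; lia.
have dE z : N <= z <= N + n -> CL z = d -> w.+1 <= z <= HI d.
  by move=> hz e; have [h1 h2 _ _ _] := U z hz; move: h1 h2; rewrite e ed; lia.
split.
- move=> y hy; rewrite eCL //; case: ifP => hin.
    rewrite eLO eHI !eqxx; split=> /=; try lia.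
    + by move=> z hz; rewrite eCL; [rewrite hz | lia].
    + move=> z hz; have [-> | ne] := eqVneq z w; first by rewrite orbT.
      rewrite orbF; have [lt|ge] := ltnP z w; first by apply: a5; lia.
      by apply: b5; lia.
  have [h1 h2 h3 h4 h5] := U y hy.
  have nr : (CL y == r) = false.
    by apply/negP => /eqP e; case/orP: hr => /eqP er;
      [have := cE y hy | have := dE y hy]; rewrite e er => /(_ erefl); lia.
  rewrite eLO eHI nr; split=> //=.
  + move=> z hz; rewrite eCL; last by lia.
    case: ifP => hin'; last exact: h3.
    have e := h3 z hz; exfalso.
    have [le|gt] := leqP z w.
      by have := cE y hy; rewrite -e; have -> := a3 z ltac:(lia) => /(_ erefl); lia.
    by have := dE y hy; rewrite -e; have -> := b3 z ltac:(lia) => /(_ erefl); lia.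
  + rewrite negb_or h4 /=; apply/negP => /eqP e.
    by have e2 := h3 w; rewrite e in h2 e2; have := cE y hy; rewrite -e2; [move/(_ erefl) | ]; lia.
  + by move=> z hz; rewrite h5.
(* The offsets of the shorter interval: for its elements the length at least doubles, for all others
   it does not shrink. *)
have [lo [hi H]] : exists lo hi,
    (lo = LO c - N /\ hi = w.+1 - N /\ w.+1 - LO c <= HI d - w) \/
    (lo = w.+1 - N /\ hi = (HI d).+1 - N /\ HI d - w < w.+1 - LO c).
  by have [h|h] := leqP (w.+1 - LO c) (HI d - w); do 2!eexists; [left | right].
have -> : minn (w.+1 - LO c) (HI d - w) = \sum_(i < n.+1) (lo <= i < hi).
  by rewrite sum_interval; lia.
rewrite /Phi -big_split /=; apply: leq_sum => i _.
have hi' : N <= N + i <= N + n by have := ltn_ord i; lia.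
rewrite eCL //; case: ifP => hin; last first.
  have nr : (CL (N + i) == r) = false.
    by apply/negP => /eqP e; case/orP: hr => /eqP er;
      [have := cE _ hi' | have := dE _ hi']; rewrite e er => /(_ erefl); lia.
  rewrite eLO eHI nr (_ : (lo <= i < hi) = false) ?addn0 //.
  by lia.
rewrite eLO eHI !eqxx.
have D a b (t : bool) : 0 < a -> a <= b -> (t -> 2 * a <= b) -> trunc_log 2 a + t <= trunc_log 2 b.
  case: t => a0 ab h; first by rewrite addn1; apply: trunc_log_double => //; exact: h.
  by rewrite addn0; apply: leq_trunc_log.
have [le|gt] := leqP (N + i) w.
  have -> : CL (N + i) = c by apply: a3; lia.
  by rewrite ec; apply: D => //; lia.
have -> : CL (N + i) = d by apply: b3; lia.
by rewrite ed; apply: D => //; lia.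
Qed.

Definition CLs (s : st) (y : nat) : nat := arr s aCL y 0.
Definition LOs (s : st) (y : nat) : nat := arr s aLO y 0.
Definition HIs (s : st) (y : nat) : nat := arr s aHI y 0.
Definition uf (s : st) (vis : nat -> bool) : Prop := ufok (CLs s) (LOs s) (HIs s) vis.
Definition Phis (s : st) : nat := Phi (CLs s) (LOs s) (HIs s).

Lemma eq_uf s s' vis vis' : arr s' aCL = arr s aCL -> arr s' aLO = arr s aLO ->
  arr s' aHI = arr s aHI -> vis =1 vis' -> uf s vis -> uf s' vis'.
Proof.
rewrite /uf /ufok /CLs /LOs /HIs => -> -> -> ev U y hy.
have [h1 h2 h3 h4 h5] := U y hy; split=> //; first by rewrite -ev.
by move=> z hz; rewrite -ev; exact: h5.
Qed.

(** The time of relabelling, 3 per element, is matched by the growth of [Phis]. The potential thus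
    records work already done, and its final value bounds all visits of one source. *)
Lemma visit_ok s vis w : var s vw = w -> N <= w < N + n -> ~~ vis w -> uf s vis ->
  wp inp c_visit (fun s' => [/\ uf s' (fun z => vis z || (z == w)),
    forall y, arr s' aDI y 0 = if y == w then var s vdv else arr s aDI y 0,
    forall i, arr s' aQ i 0 = if i == var s vqt then w else arr s aQ i 0,
    var s' vqt = (var s vqt).+1 &
    tm s' + 3 * Phis s <= tm s + 3 * Phis s' + 11]) s.
Proof.
move=> ew hw nv U; rewrite /c_visit /c_union /put /incr; wsteps; rewrite ew.
have [a1 a2 a3 a4 a5] := U w ltac:(lia).
have [b1 b2 b3 b4 b5] := U w.+1 ltac:(lia).
have Hpost s1 r : (r == CLs s w) || (r == CLs s w.+1) ->
    (forall z, N <= z <= N + n ->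
       CLs s1 z = if LOs s (CLs s w) <= z <= HIs s (CLs s w.+1) then r else CLs s z) ->
    (forall x, LOs s1 x = if x == r then LOs s (CLs s w) else LOs s x) ->
    (forall x, HIs s1 x = if x == r then HIs s (CLs s w.+1) else HIs s x) ->
    tm s1 <= tm s + 10 + 3 * minn (w.+1 - LOs s (CLs s w)) (HIs s (CLs s w.+1) - w) ->
    uf s1 (fun z => vis z || (z == w)) /\ tm s1 + 3 * Phis s <= tm s + 3 * Phis s1 + 10.
  move=> h1 h2 h3 h4 h5; have [U' P'] := union_pure U hw nv h1 h2 h3 h4.
  by split; [exact: U' | rewrite /Phis; lia].
have ec : forall z, LOs s (CLs s w) <= z <= w -> CLs s z = CLs s w.
  by move=> z hz; apply: a3; lia.
have ed : forall z, w < z <= HIs s (CLs s w.+1) -> CLs s z = CLs s w.+1.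
  by move=> z hz; apply: b3; lia.
move: Hpost ec ed a1 a2 b1 b2; rewrite /LOs /HIs /CLs; set c := arr s aCL w 0; set d := arr s aCL w.+1 0.
move=> Hpost ec ed a1 a2 b1 b2.
apply: wp_if => /=; rewrite ?ew => h; wsteps.
- apply: (@wp_for _ (arr s aHI d 0).+1 3 (fun k s1 => forall z,
    arr s1 aCL z 0 = if w < z < k then c else arr s aCL z 0)) => //=; rewrite ?ew.
  + by lia.
  + by move=> s1 F; frs; rewrite ?ew.
  + by move=> z; case: ifP => //; lia.
  + move=> k s1; rewrite ?ew => hk ek I1 F; wsteps; split; rewrite ?ek //; last by lia.
    move=> z; rewrite andbT; frs; rewrite ?ew; case: eqP => [->|ne].
      by rewrite ifT //; lia.
    by rewrite I1; congr (if _ then _ else _); lia.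
  + move=> s1 e1 I1 F1 T1; have := Hpost (tick s1) c; frs; rewrite ?ew eqxx => /(_ isT) [].
    * move=> z hz; rewrite I1; case: ifP => h1; case: ifP => h2 //; try lia.
      by apply: ec; lia.
    * by move=> x; case: eqP => // ->.
    * by move=> x; rewrite andbT.
    * by move: T1 => /=; lia.
    move=> U' T'; split=> //.
    * by move=> y; rewrite andbT.
    * by move=> i; rewrite andbT.
    * by move: T' => /=; rewrite /Phis /CLs /LOs /HIs; frs; lia.
- apply: (@wp_for _ w.+1 3 (fun k s1 => forall z,
    arr s1 aCL z 0 = if arr s aLO c 0 <= z < k then d else arr s aCL z 0)) => //=; rewrite ?ew.
  + by lia.
  + by move=> s1 F; frs; rewrite ?ew.
  + by move=> z; case: ifP => //; lia.
  + move=> k s1; rewrite ?ew => hk ek I1 F; wsteps; split; rewrite ?ek //; last by lia.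
    move=> z; rewrite andbT; frs; rewrite ?ew; case: eqP => [->|ne].
      by rewrite ifT //; lia.
    by rewrite I1; congr (if _ then _ else _); lia.
  + move=> s1 e1 I1 F1 T1; have := Hpost (tick s1) d; frs; rewrite ?ew eqxx orbT => /(_ isT) [].
    * move=> z hz; rewrite I1; case: ifP => h1; case: ifP => h2 //; try lia.
      by apply: ed; lia.
    * by move=> x; rewrite andbT.
    * by move=> x; case: eqP => // ->.
    * by move: T1 => /=; lia.
    move=> U' T'; split=> //.
    * by move=> y; rewrite andbT.
    * by move=> i; rewrite andbT.
    * by move: T' => /=; rewrite /Phis /CLs /LOs /HIs; frs; lia.
Qed.

End Union.

(* [aEX q w] is the first element of S_q from [w] on. *)
Definition c_scan : cmd :=
  vw ::= get aHI (get aCL vN) ;;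
  CWhile vw vNE
    (CIf vw (EGet aEX vq vw)
       (vw ::= get aHI (get aCL (EGet aEX vq vw)))
       (c_visit ;; vw ::= get aHI (get aCL vw))).

Definition c_climb : cmd :=
  vq ::= vu ;;
  CWhile #0 vq
    (CIf #0 (get aPR vq) CSkip (put aPR vq #1 ;; c_scan) ;;
     vq ::= EHalf vq).

(** * Scanning S_q along the ancestors of a vertex *)

Section Scan.

Variables (inp : nat -> nat) (n L : nat) (Ub : nat -> nat -> bool) (P : nat -> nat).
Local Notation N := (2 ^ L).

Definition static (s : st) : Prop :=
  [/\ var s vn = n, var s vN = N, var s vNE = N + n, var s vN2 = 2 * N &
    (forall x, x < n -> arr s aPOS x 0 = P x) /\
    (forall q y, 0 < q < 2 * N -> N <= y <= N + n -> is_next n N Ub q y (arr s aEX q y))].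

Lemma static_frame c s s' : frame c s s' -> 
  all (fun x => x \notin wvars c) [:: vn; vN; vNE; vN2] ->
  all (fun a => a \notin warrs c) [:: aPOS; aEX] -> static s -> static s'.
Proof.
move=> F /= /and5P[h1 h2 h3 h4 _] /and3P[g1 g2 _].
by rewrite /static (frV F h1) (frV F h2) (frV F h3) (frV F h4) (frA F g1) (frA F g2).
Qed.

Definition queue (s : st) (qs : seq nat) : Prop :=
  [/\ var s vqt = size qs, forall i, i < size qs -> arr s aQ i 0 = nth 0 qs i, uniq qs,
      {in qs, forall y, N <= y < N + n} & uf n N s (fun y => y \in qs)].

Lemma find_next s qs y : queue s qs -> N <= y <= N + n ->
  let z := arr s aHI (arr s aCL y 0) 0 in
  [/\ y <= z <= N + n, z \notin qs & forall v, y <= v < z -> v \in qs].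
Proof.
move=> [_ _ _ _ U] hy; have [h1 h2 h3 h4 h5] := U y hy.
by split=> // v hv; apply: h5; move: h1 hv; rewrite /HIs /LOs /CLs; lia.
Qed.

(** The rises still ahead of a scan that has reached [w]; they pay for its jumps over gaps of
    S_q. *)
Definition rises_from (q w : nat) : nat :=
  \sum_(i < n) (i.+1 < n) && (w <= N + i) && rise Ub q (N + i).

Lemma rises_from0 q : rises_from q N = rises n L Ub q.
Proof. by apply: eq_bigr => i _; rewrite leq_addr andbT. Qed.

Lemma rises_from_le q w w' : w <= w' -> rises_from q w' <= rises_from q w.
Proof.
move=> le; apply: leq_sum => i _; case: (_ < n) => //=; case: (leqP w' (N + i)) => h //=.
by rewrite (leq_trans le h).
Qed.

Lemma rises_from_lt q w w' z : N <= w -> w < z -> z < N + n -> z <= w' ->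
  ~~ top Ub q z.-1 -> top Ub q z -> (rises_from q w').+1 <= rises_from q w.
Proof.
move=> Nw wz zn zw h1 h2.
have lt : z.-1 - N < n by lia.
rewrite /rises_from (bigD1 (Ordinal lt)) //= [X in _ <= X](bigD1 (Ordinal lt)) //=.
have e : N + (z.-1 - N) = z.-1 by lia.
rewrite e (_ : w' <= z.-1 = false); last by lia.
rewrite andbF add0n /rise h1 prednK ?h2; last by lia.
have -> : (z.-1 - N).+1 < n by lia.
have -> : w <= z.-1 by lia.
rewrite add1n ltnS; apply: leq_sum => i _; case: (_ < n) => //=; case: (leqP w' (N + i)) => h //=.
by have -> : w <= N + i by lia.
Qed.

(** Each iteration either visits a new vertex, at a cost of 14 besides relabelling, or jumps to a
    later element of S_q and thereby passes a rise. Visited stretches are skipped by union-find and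
    cost nothing extra. *)
Lemma scan_ok s qs q : static s -> queue s qs -> var s vq = q -> 0 < q < 2 * N ->
  wp inp c_scan (fun s' => exists ns, [/\ queue s' (qs ++ ns),
    {in ns, forall y, top Ub q y},
    forall y, arr s' aDI y 0 = if y \in ns then var s vdv else arr s aDI y 0,
    forall y, N <= y < N + n -> top Ub q y -> y \in qs ++ ns &
    tm s' + 3 * Phis n N s <= tm s + 3 * Phis n N s' + 14 * size ns + 3 * rises n L Ub q + 5]) s.
Proof.
move=> ST Q eq hq; rewrite /c_scan; wsteps.
have [en eN eNE eN2 [eP eEX]] := ST.
(* The term with [w < N + n] is a reserve for the last jump, the one to the sentinel, which passes
   no rise. *)
pose I s1 := exists ns w, [/\ var s1 vw = w, queue s1 (qs ++ ns), 
   {in ns, forall y, top Ub q y} /\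
   (forall y, arr s1 aDI y 0 = if y \in ns then var s vdv else arr s aDI y 0),
   [/\ N <= w <= N + n, w \notin qs ++ ns & forall y, N <= y < w -> top Ub q y -> y \in qs ++ ns] &
   tm s1 + 3 * Phis n N s + 3 * rises_from q w + 3 * (w < N + n) <=
   tm s + 3 * Phis n N s1 + 14 * size ns + 3 * rises n L Ub q + 4].
apply: (@wp_while _ I (fun s1 => N + n - var s1 vw)) => /=.
- exists [::], (arr s aHI (arr s aCL N 0) 0); rewrite cats0 eN.
  have [|h1 h2 h3] := @find_next s qs N Q; first by lia.
  split=> //.
    by split=> // y hy _; apply: h3.
  rewrite -rises_from0 /=; have := @rises_from_le q N (arr s aHI (arr s aCL N 0) 0).
  rewrite /Phis /CLs /LOs /HIs /=; case: (_ < N + n); lia.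
- move=> s1 [ns [w [ew Q1 [T1 D1] [hw nw cov] TM]]] F; frs; rewrite ew eNE => lt.
  rewrite lt in TM.
  have eEX1 : arr s1 aEX = arr s aEX by frs.
  have eq1 : var s1 vq = q by frs.
  have edv : var s1 vdv = var s vdv by frs.
  have [c1 c2 c3] := eEX q w hq ltac:(lia).
  apply: wp_if => /=; rewrite ew eq1 eEX1 => h.
    wsteps; rewrite eq1 eEX1 ew.
    set z := arr s aEX q w in c1 c2 c3 h *.
    have [|h1 h2 h3] := @find_next s1 _ z Q1; first by lia.
    set w' := arr s1 aHI _ 0 in h1 h2 h3 *.
    split; last by rewrite ?ew; lia.
    exists ns, w'; split=> //.
      split=> //; first by lia.
      move=> y hy ty; have [ltw|gew] := ltnP y w; first by apply: cov => //; lia.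
      have [ltz|gez] := ltnP y z; last by apply: h3; lia.
      by have := c2 y; rewrite ty => /(_ ltac:(lia)).
    have k1 : 3 * rises_from q w' + 3 * (w' < N + n) + 3 <= 3 * rises_from q w + 3.
      have [zlt|zge] := ltnP z (N + n).
        have := @rises_from_lt q w w' z; rewrite c3 // => /(_ _ _ _ _ _ isT) k.
        suff: (rises_from q w').+1 <= rises_from q w by case: (w' < N + n); lia.
        by apply: k; try lia; apply: c2; lia.
      have -> : w' < N + n = false by lia.
      by have := @rises_from_le q w w'; lia.
    by move: TM; rewrite /Phis /CLs /LOs /HIs /=; lia.
  have ez : arr s aEX q w = w by lia.
  rewrite ez in c2 c3; apply: wp_seq.
  have [q1 q2 q3 q4 q5] := Q1.
  have nv : ~~ (fun y => y \in qs ++ ns) w by [].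
  have hw' : N <= w < N + n by lia.
  apply: (wp_conseq (visit_ok inp (s := tick (tick s1)) ew hw' nv q5)) => //=.
  move=> s2 [U2 D2 A2 qt2 T2] F2; wsteps.
  have ew2 : var s2 vw = w by frs.
  rewrite ew2.
  have Q2 : queue s2 (qs ++ rcons ns w).
    rewrite -rcons_cat; split.
    + by rewrite qt2 /= q1 size_rcons.
    + move=> i; rewrite size_rcons ltnS A2 /= q1 nth_rcons leq_eqVlt.
      by case: eqP => [->|/eqP ne] /= h'; [rewrite ltnn | rewrite h' q2].
    + by rewrite rcons_uniq nw.
    + by move=> y; rewrite mem_rcons inE => /orP[/eqP ->|/q4 //]; lia.
    + by apply: eq_uf U2 => // y /=; rewrite mem_rcons inE orbC.
  have [|h1 h2 h3] := @find_next s2 _ w Q2; first by lia.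
  set w' := arr s2 aHI _ 0 in h1 h2 h3 *.
  have ww : w < w'.
    rewrite ltn_neqAle; case/andP: h1 => -> _; rewrite andbT; apply: contra h2 => /eqP <-.
    by rewrite mem_cat mem_rcons inE eqxx orbT.
  split; last by rewrite ?ew; lia.
  exists (rcons ns w), w'; split=> //.
  + split; first by move=> y; rewrite mem_rcons inE => /orP[/eqP ->|/T1 //]; apply: c3.
    move=> y; rewrite D2 /= mem_rcons inE edv D1.
    by case: (y == w).
  + split=> //; first by lia.
    move=> y hy ty; have [ltw|gew] := ltnP y w; last by apply: h3; lia.
    rewrite -rcons_cat mem_rcons inE cov ?orbT //; lia.
  + have := @rises_from_le q w w'; move: T2 TM; rewrite size_rcons /Phis /CLs /LOs /HIs /=.
    by case: (w' < N + n); lia.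
- move=> s1 [ns [w [ew Q1 [T1 D1] [hw nw cov] TM]]] F; frs; rewrite ew eNE => ge.
  have ew' : w = N + n by lia.
  exists ns; split=> //.
    by move=> y hy; apply: cov; lia.
  by move: TM; rewrite /Phis /CLs /LOs /HIs /=; lia.
Qed.

End Scan.

Section Climb.

Variables (inp : nat -> nat) (n L : nat) (Ub : nat -> nat -> bool) (P : nat -> nat).
Local Notation N := (2 ^ L).
Hypothesis n_le : n <= N.
Hypothesis U0 : forall y, Ub 0 y = false.
Hypothesis U_node : forall q y, 0 < q < N -> N <= y < N + n ->
  Ub q y = Ub (2 * q) y && Ub (2 * q).+1 y.

Definition scanned (s : st) (qs : seq nat) : Prop :=
  forall q, 0 < q < 2 * N -> arr s aPR q 0 != 0 ->
    forall y, N <= y < N + n -> top Ub q y -> y \in qs.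

(** The price of the scans made so far for the present source. The flag [aPR] lets each node be
    scanned once; the successor covers the overhead of a scan and an interval at the first
    column. *)
Definition Psi (s : st) : nat :=
  \sum_(q < 2 * N) (0 < arr s aPR q 0) * (rises n L Ub q).+1.

Lemma Psi_upd s s' q : q < 2 * N -> arr s aPR q 0 = 0 ->
  (forall i, arr s' aPR i 0 = if i == q then 1 else arr s aPR i 0) ->
  Psi s' = Psi s + (rises n L Ub q).+1.
Proof.
move=> lt z e; rewrite /Psi (bigD1 (Ordinal lt)) //= [in RHS](bigD1 (Ordinal lt)) //= e eqxx z /=.
rewrite mul0n add0n mul1n addnC; congr (_ + _); apply: eq_bigr => i ne.
by rewrite e ifN.
Qed.

Lemma Ub_shift u y j : 0 < u %/ 2 ^ j -> u < 2 * N -> N <= y < N + n ->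
  Ub (u %/ 2 ^ j) y -> Ub u y.
Proof.
move=> + hu hy; elim: j => [|j IH]; first by rewrite expn0 divn1.
rewrite expnSr divnMA; move: IH (leq_div u (2 ^ j)); move: (u %/ 2 ^ j) => r IH le h0 h1.
have h2 : 1 < r by lia.
apply: IH; first by lia.
move: h1; rewrite U_node //; last by lia.
case/andP=> a b; have := divn_eq r 2; have := ltn_pmod r (isT : 0 < 2).
case: (r %% 2) => [|[|//]] _ e; rewrite e mulnC; first by rewrite addn0.
by rewrite addn1.
Qed.

(** Going up from [u], the ancestor just before membership in U first fails has [y] in its S_q.
    Failure occurs at the latest at 0. *)
Lemma top_ancestor u y k : Ub u y -> u %/ 2 ^ k = 0 ->
  exists2 j, j < k & 0 < u %/ 2 ^ j /\ top Ub (u %/ 2 ^ j) y.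
Proof.
move=> hu hk.
have ex : exists j, ~~ Ub (u %/ 2 ^ j) y by exists k; rewrite hk U0.
case: (ex_minnP ex) => [[|j]] h1 h2; first by rewrite expn0 divn1 hu in h1.
have hj : Ub (u %/ 2 ^ j) y by apply: contraT => /h2; rewrite ltnn.
exists j; first by apply: h2; rewrite hk U0.
split; first by rewrite lt0n; apply: contraL hj => /eqP ->; rewrite U0.
by rewrite /top hj -divnMA -expnSr.
Qed.

(** An ancestor scanned before contributes nothing new, since its S_q has been visited entirely. So
    the walk to the root costs O(L), and everything else is paid by the two potentials and the newly
    queued vertices. *)
Lemma climb_ok s qs u : static n L Ub P s -> queue n L s qs -> scanned s qs ->
  var s vu = u -> N <= u < 2 * N ->
  wp inp c_climb (fun s' => exists ns,
    [/\ queue n L s' (qs ++ ns) /\ scanned s' (qs ++ ns),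
      {in ns, forall y, Ub u y},
      forall y, arr s' aDI y 0 = if y \in ns then var s vdv else arr s aDI y 0,
      forall y, N <= y < N + n -> Ub u y -> y \in qs ++ ns &
      tm s' + 3 * Phis n N s + 14 * Psi s <=
      tm s + 3 * Phis n N s' + 14 * Psi s' + 14 * size ns + 4 * L + 6]) s.
Proof.
move=> ST Q SC eu hu; rewrite /c_climb /put; wsteps.
pose I s1 := exists ns j, [/\ var s1 vq = u %/ 2 ^ j, queue n L s1 (qs ++ ns) /\ scanned s1 (qs ++ ns),
   {in ns, forall y, Ub u y} /\
   (forall y, arr s1 aDI y 0 = if y \in ns then var s vdv else arr s aDI y 0),
   j <= L.+1 /\ (forall i, i < j -> arr s1 aPR (u %/ 2 ^ i) 0 != 0) &
   tm s1 + 3 * Phis n N s + 14 * Psi s <=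
      tm s + 3 * Phis n N s1 + 14 * Psi s1 + 14 * size ns + 4 * j + 1].
apply: (@wp_while _ I (fun s1 => var s1 vq)) => /=.
- exists [::], 0; rewrite cats0 expn0 divn1 eu; split=> //.
  by rewrite /Phis /Psi /CLs /LOs /HIs /=; lia.
- move=> s1 [ns [j [eq1 [Q1 SC1] [T1 D1] [hj pr] TM]]] F; rewrite eq1 => gt; wsteps.
  have qlt : u %/ 2 ^ j < 2 * N by have := leq_div u (2 ^ j); lia.
  have jL : j <= L.
    rewrite leqNgt; apply: contraL gt => h; rewrite -leqNgt leqn0; apply/eqP/divn_small.
    apply: leq_trans (_ : 2 ^ L.+1 <= _); first by rewrite expnS; lia.
    by rewrite leq_exp2l.
  have half : (u %/ 2 ^ j) %/ 2 < u %/ 2 ^ j by lia.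
  apply: wp_if => /=; rewrite eq1 => h.
    wsteps; split; last by rewrite eq1.
    exists ns, j.+1; split=> //=; first by rewrite ?eq1 expnSr divnMA.
      split=> // i; rewrite ltnS leq_eqVlt => /orP[/eqP ->|/pr //].
      by rewrite -lt0n.
    by move: TM; rewrite /Phis /Psi /CLs /LOs /HIs /=; lia.
  have z0 : arr s1 aPR (u %/ 2 ^ j) 0 = 0 by lia.
  wsteps; set s2 := St _ _ _ _.
  have ST1 : static n L Ub P s1 by apply: static_frame F _ _ _.
  have edv : var s1 vdv = var s vdv by frs.
  have hq : 0 < u %/ 2 ^ j < 2 * N by lia.
  have S2 := @scan_ok inp n L Ub P s2 (qs ++ ns) (u %/ 2 ^ j) ST1 Q1 eq1 hq.
  apply: wp_conseq S2 _ => s3 [ms [Q3 T3 D3 C3 TM3]] F3; wsteps.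
  have eq3 : var s3 vq = u %/ 2 ^ j by frs.
  have ePsi := @Psi_upd s1 s3 _ qlt z0.
  have epr i : arr s3 aPR i 0 = if i == u %/ 2 ^ j then 1 else arr s1 aPR i 0.
    by frs; rewrite andbT eq1.
  split; last by rewrite ?eq3 ?eq1.
  exists (ns ++ ms), j.+1; rewrite catA; split=> //=.
  + by rewrite ?eq3 expnSr divnMA.
  + split=> // q hq2; rewrite [arr _ _ _ _]epr; case: (q =P u %/ 2 ^ j) => [-> _ y hy ty|_ nz y hy ty]; first exact: C3.
    by rewrite mem_cat (SC1 q hq2 nz y hy ty).
  + split.
      move=> y; rewrite mem_cat => /orP[/T1 //|hy].
      have [_ _ _ b4 _] := Q3.
      apply: (@Ub_shift u y j) => //; first by lia.
        by apply: b4; rewrite mem_cat hy orbT.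
      by have /andP[] := T3 y hy.
    move=> y; rewrite [arr _ _ _ _]D3 /= edv D1 mem_cat.
    by case: (y \in ms); rewrite ?orbT // orbF.
  + split=> // i; rewrite ltnS leq_eqVlt [arr _ _ _ _]epr; case: (u %/ 2 ^ i =P _) => // ne.
    by case/orP=> [/eqP e|/pr //]; rewrite e in ne.
  + move: TM3 TM (ePsi epr); rewrite size_cat.
    rewrite /Phis /CLs /LOs /HIs /s2 /=.
    have -> : Psi (St (upd (var s3) vq (var s3 vq %/ 2)) (arr s3) (out s3) (tm s3).+1) = Psi s3 by [].
    by move=> TM3 TM ->; lia.
- move=> s1 [ns [j [eq1 [Q1 SC1] [T1 D1] [hj pr] TM]]] F; rewrite eq1 => le.
  have e0 : u %/ 2 ^ j = 0 by lia.
  exists ns; split=> //.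
    move=> y hy hU; have [i ij [gt ty]] := top_ancestor hU e0.
    apply: (SC1 _ _ (pr _ ij) y hy ty).
    by have := leq_div u (2 ^ i); lia.
  by move: TM; rewrite /Phis /Psi /CLs /LOs /HIs /=; lia.
Qed.

End Climb.

(** * Breadth-first search from every source *)

Definition c_reset : cmd :=
  vy ::= vN ;;
  CWhile vy (ESuc vNE)
    (put aCL vy vy ;; put aLO vy vy ;; put aHI vy vy ;; put aDI vy vn ;; incr vy) ;;
  vq ::= #0 ;;
  CWhile vq vN2 (put aPR vq #0 ;; incr vq) ;;
  vqh ::= #0 ;; vqt ::= #0.

Definition c_pop : cmd :=
  vu ::= get aQ vqh ;; incr vqh ;; vdv ::= ESuc (get aDI vu) ;; c_climb.

Definition c_emit : cmd :=
  vy ::= #0 ;;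
  CWhile vy vn (COut vo (get aDI (get aPOS vy)) ;; incr vo ;; incr vy).

Definition c_source : cmd :=
  c_reset ;; vw ::= get aPOS vx ;; vdv ::= #0 ;; c_visit ;;
  CWhile vqh vqt c_pop ;; c_emit ;; incr vx.

Definition c_all : cmd := vx ::= #0 ;; vo ::= #0 ;; CWhile vx vn c_source.

Lemma walk0 (T : finType) (e : rel T) x : walk e x x 0.
Proof. by apply/existsP; exists [tuple]; rewrite /= eqxx. Qed.

Lemma walkS (T : finType) (e : rel T) x y z k : walk e x y k -> e y z -> walk e x z k.+1.
Proof.
case/existsP=> p /andP[hp /eqP hl] h; apply/existsP; exists [tuple of rcons p z].
by rewrite /= rcons_path hp hl h last_rcons eqxx.
Qed.

Lemma walkS_inv (T : finType) (e : rel T) x z k : walk e x z k.+1 ->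
  exists2 y, walk e x y k & e y z.
Proof.
case/existsP=> p /andP[]; have := size_tuple p; case/lastP: (tval p) => [//|q b].
rewrite size_rcons last_rcons rcons_path => -[hs] /andP[hq hb] /eqP <-.
exists (last x q) => //; apply/existsP; have ht : size q == k by rewrite hs.
by exists (Tuple ht); rewrite /= hq eqxx.
Qed.

Lemma walk0_inv (T : finType) (e : rel T) x z : walk e x z 0 -> z = x.
Proof. by case/existsP=> p; rewrite (tuple0 p) /= => /eqP. Qed.

Section BFS.

Variables (inp : nat -> nat) (n L : nat) (Ub : nat -> nat -> bool) (P : nat -> nat).
Local Notation N := (2 ^ L).
Hypothesis n_le : n <= N.
Hypothesis U0 : forall y, Ub 0 y = false.
Hypothesis U_node : forall q y, 0 < q < N -> N <= y < N + n ->
  Ub q y = Ub (2 * q) y && Ub (2 * q).+1 y.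

Lemma reset_ok s : static n L Ub P s ->
  wp inp c_reset (fun s' => [/\ queue n L s' [::] /\ scanned n L Ub s' [::],
     forall y, N <= y < N + n -> arr s' aDI y 0 = n, var s' vqh = 0 &
     tm s' <= tm s + 6 * n + 6 * N + 15]) s.
Proof.
move=> [en eN eNE eN2 _]; rewrite /c_reset /put /incr; wsteps.
apply: (@wp_for _ (N + n).+1 6 (fun k s1 => forall y, N <= y < k ->
   [/\ arr s1 aCL y 0 = y, arr s1 aLO y 0 = y, arr s1 aHI y 0 = y & arr s1 aDI y 0 = n])) => //=.
- by rewrite eN; lia.
- by move=> s1 F; frs; rewrite eNE.
- by rewrite eN => y; lia.
- move=> k s1 hk ek I1 F; wsteps; split; rewrite ?ek //; last by lia.
  move=> y hy; rewrite andbT; frs; rewrite en; case: eqP => [->|ne] //.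
  by apply: I1; lia.
move=> s1 e1 I1 F1 T1; wsteps.
apply: (@wp_for _ (2 * N) 3 (fun k s2 => forall q, q < k -> arr s2 aPR q 0 = 0)) => //=.
- by move=> s2 F2; frs.
- move=> k s2 hk ek I2 F2; wsteps; split; rewrite ?ek //; last by lia.
  by move=> q hq; rewrite andbT; case: eqP => // ne; apply: I2; lia.
move=> s2 e2 I2 F2 T2; wsteps; split=> //.
- split; last by move=> q hq /=; rewrite I2 //; lia.
  split=> // y hy; rewrite /LOs /HIs /CLs /=; frs.
  have [-> b1 b2 _] := I1 y ltac:(lia); rewrite b1 b2; split=> // [||z hz|z]; try lia.
  by have [-> _ _ _] := I1 z ltac:(lia); lia.
- by move=> y hy; frs; have [] := I1 y ltac:(lia).
- by move: T1 T2 => /=; rewrite eN; lia.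
Qed.

Variable e : rel 'I_n.
Hypothesis P_inj : forall v w : 'I_n, P v = P w -> v = w.
Hypothesis P_range : forall v : 'I_n, N <= P v < N + n.
Hypothesis P_surj : forall y, N <= y < N + n -> exists v : 'I_n, P v = y.
Hypothesis U_edge : forall v w : 'I_n, v != w -> Ub (P v) (P w) = e v w.
Hypothesis e_irr : irreflexive e.

(** Nothing is removed from the queue: [qs] lists all discovered positions, and those before [vqh]
    have been expanded. [bfs_sorted] and [bfs_near] serve to establish [bfs_closed] for neighbours
    that were discovered before the vertex being expanded. *)
Record bfs (x : 'I_n) (s : st) (qs : seq nat) : Prop := Bfs {
  bfs_static : static n L Ub P s;
  bfs_queue : queue n L s qs;
  bfs_scanned : scanned n L Ub s qs;
  bfs_head : var s vqh <= size qs;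
  bfs_walk : forall v : 'I_n, P v \in qs -> walk e x v (arr s aDI (P v) 0);
  bfs_sorted : forall i j, i <= j < size qs ->
    arr s aDI (nth 0 qs i) 0 <= arr s aDI (nth 0 qs j) 0;
  bfs_near : forall i j, var s vqh <= i < size qs -> j < size qs ->
    arr s aDI (nth 0 qs j) 0 <= (arr s aDI (nth 0 qs i) 0).+1;
  bfs_closed : forall i y, i < var s vqh -> N <= y < N + n -> Ub (nth 0 qs i) y ->
    (y \in qs) && (arr s aDI y 0 <= (arr s aDI (nth 0 qs i) 0).+1);
  bfs_inf : forall y, N <= y < N + n -> y \notin qs -> arr s aDI y 0 = n;
  bfs_source : (P x \in qs) && (arr s aDI (P x) 0 == 0) }.

Lemma pop_ok x s qs : bfs x s qs -> var s vqh < size qs ->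
  wp inp c_pop (fun s' => exists ns, [/\ bfs x s' (qs ++ ns), var s' vqh = (var s vqh).+1 &
      tm s' + 3 * Phis n N s + 14 * Psi n L Ub s <=
      tm s + 3 * Phis n N s' + 14 * Psi n L Ub s' + 14 * size ns + 4 * L + 9]) s.
Proof.
move=> [ST Q SC hh W So Ne Cl Inf Src] lt; have sub_lt i a b : i < a + b -> (i < a) = false -> i - a < b by lia.
rewrite /c_pop /incr; wsteps.
have [q1 q2 q3 q4 q5] := Q.
move hE : (var s vqh) hh Ne Cl lt => h hh Ne Cl lt.
move uE : (nth 0 qs h) => u.
have eQ : arr s aQ h 0 = u by rewrite q2.
have uq : u \in qs by rewrite -uE mem_nth.
have hu := q4 _ uq.
set s1 := St _ _ _ _.
have hu' : N <= u < 2 * N by lia.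
have C := @climb_ok inp n L Ub P n_le U0 U_node s1 qs u ST Q SC eQ hu'.
apply: wp_conseq C _ => s2 [ns [[Q2 SC2] T2 D2 C2 TM2]] F2.
have edv : var s1 vdv = (arr s aDI u 0).+1 by rewrite /= eQ.
have eh : var s2 vqh = h.+1 by frs.
have [r1 r2 r3 r4 r5] := Q2.
have nsq y : y \in qs -> (y \in ns) = false.
  by move=> hy; move: r3; rewrite cat_uniq => /and3P[_ /hasPn k _]; apply/negP => /k /=; rewrite hy.
have Dq y : y \in qs -> arr s2 aDI y 0 = arr s aDI y 0 by move=> hy; rewrite D2 nsq.
have Dn y : y \in ns -> arr s2 aDI y 0 = (arr s aDI u 0).+1 by move=> hy; rewrite D2 hy edv.
have Du := Dq _ uq.
have le_u y : y \in qs -> arr s aDI y 0 <= (arr s aDI u 0).+1.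
  by move=> hy; have := @Ne h (index y qs); rewrite nth_index // uE leqnn lt index_mem hy; apply.
have nthD i : i < size (qs ++ ns) -> nth 0 (qs ++ ns) i =
    if i < size qs then nth 0 qs i else nth 0 ns (i - size qs) by rewrite nth_cat.
have DI_le i : i < size (qs ++ ns) -> arr s2 aDI (nth 0 (qs ++ ns) i) 0 <= (arr s aDI u 0).+1.
  move=> hi; rewrite nth_cat; case: ifP => c.
    by rewrite Dq ?mem_nth // le_u ?mem_nth.
  by rewrite Dn // mem_nth //; apply: sub_lt c; rewrite -size_cat.
have DI_ge i : h <= i < size (qs ++ ns) -> arr s aDI u 0 <= arr s2 aDI (nth 0 (qs ++ ns) i) 0.
  move=> hi; rewrite nth_cat; case: ifP => c.
    by rewrite Dq ?mem_nth // -uE; apply: So; rewrite c; lia.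
  by rewrite Dn // mem_nth //; apply: sub_lt c; rewrite -size_cat; case/andP: hi.
have ST2 : static n L Ub P s2 by apply: static_frame F2 _ _ _.
exists ns; split=> //; last first.
  move: TM2; have -> : Phis n N s1 = Phis n N s by [].
  have -> : Psi n L Ub s1 = Psi n L Ub s by [].
  have -> : tm s1 = (tm s).+3 by [].
  by move: (Psi _ _ _ _) (Psi _ _ _ _) (Phis _ _ _) (Phis _ _ _) => *; lia.
constructor => //.
- by rewrite eh size_cat; lia.
- move=> v; rewrite mem_cat => /orP[hv|hv]; first by rewrite Dq //; apply: W.
  rewrite Dn //; have [v0 e0] := P_surj hu.
  (* The diagonal of U may be set, since resolving a part against itself covers [(v, v)]. This does
     no harm, because the expanded vertex is already in the queue. *)
  have ne : v0 != v by apply: contraTneq hv => <-; rewrite e0 nsq.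
  apply: (@walkS _ _ _ v0); first by rewrite -e0; apply: W; rewrite e0.
  by rewrite -U_edge // e0; apply: T2.
- move=> i j /andP[ij hj]; have [jl|jg] := ltnP j (size qs).
    rewrite !nth_cat jl (leq_ltn_trans ij jl) !Dq ?mem_nth //; last exact: leq_ltn_trans ij jl.
    by apply: So; rewrite ij.
  have jn : nth 0 (qs ++ ns) j \in ns.
    by rewrite nth_cat ltnNge jg mem_nth //; apply: sub_lt; rewrite -?size_cat // ltnNge jg.
  by rewrite (Dn _ jn); apply: DI_le; lia.
- move=> i j; rewrite eh => hi hj; apply: leq_trans (DI_le _ hj) _; rewrite ltnS; apply: DI_ge; lia.
- move=> i y; rewrite eh ltnS leq_eqVlt => hi hy hU.
  have il : i < size qs by lia.
  rewrite nth_cat il in hU *; rewrite (Dq (nth 0 qs i)) ?mem_nth //.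
  case/orP: hi hU => [/eqP -> hU|ih hU].
    rewrite uE in hU *; have yn := C2 y hy hU; rewrite yn /=.
    by have := @DI_le (index y (qs ++ ns)); rewrite nth_index // index_mem; apply.
  by have /andP[yq yd] := Cl i y ih hy hU; rewrite mem_cat yq Dq.
- by move=> y hy; rewrite mem_cat negb_or D2 => /andP[h1 /negbTE ->]; apply: Inf.
- by case/andP: Src => h1 h2; rewrite mem_cat h1 Dq.
Qed.


Lemma Psi_le s :
  Psi n L Ub s <= rises n L Ub 0 + \sum_(q < 2 * N | 0 < q) rises n L Ub q + 2 * N.
Proof.
apply: (@leq_trans (\sum_(q < 2 * N) (rises n L Ub q + 1))).
  by apply: leq_sum => q _; rewrite addn1; case: (0 < _); rewrite ?mul1n.
rewrite big_split /= sum_nat_const card_ord muln1 leq_add2r.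
have N0 : 0 < 2 * N by rewrite muln_gt0 expn_gt0.
rewrite (bigD1 (Ordinal N0)) //= leq_add2l.
by apply: eq_leq; apply: eq_bigl => q; rewrite -val_eqE /= lt0n.
Qed.

Lemma rises0 : rises n L Ub 0 = 0.
Proof. by apply: big1 => i _; rewrite /rise /top !U0 /= andbF. Qed.

Lemma size_queue s qs : queue n L s qs -> size qs <= n.
Proof.
move=> [_ _ u h _]; rewrite -(size_iota N n); apply: uniq_leq_size => // y /h.
by rewrite mem_iota.
Qed.

Lemma Phi_le s qs : queue n L s qs -> Phis n N s <= n.+1 * trunc_log 2 n.+1.
Proof.
move=> [_ _ _ _ U]; rewrite -[X in X * _](card_ord n.+1) -sum_nat_const.
apply: leq_sum => i _; apply: leq_trunc_log.
by have [h1 h2 _ _ _] := U (N + i) ltac:(have := ltn_ord i; lia); lia.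
Qed.

(** Once all of the queue is expanded, [bfs_closed] turns a walk of length [k] into a recorded
    distance of at most [k]; conversely [bfs_walk] provides a walk of the recorded length. *)
Lemma bfs_dist x s qs (v : 'I_n) : bfs x s qs -> var s vqh = size qs ->
  is_dist e x v (arr s aDI (P v) 0) \/ (forall k, ~~ walk e x v k) /\ arr s aDI (P v) 0 = n.
Proof.
move=> B eh.
have reach k z : walk e x z k -> (P z \in qs) && (arr s aDI (P z) 0 <= k).
  elim: k z => [|k IH] z.
    by move=> /walk0_inv ->; case/andP: (bfs_source B) => -> /eqP ->.
  case/walkS_inv=> y /IH /andP[hy hd] ed.
  have ne : y != z by apply: contraTneq ed => ->; rewrite e_irr.
  have hi : index (P y) qs < var s vqh by rewrite eh index_mem.
  have := bfs_closed B hi (P_range z); rewrite nth_index // U_edge // => /(_ ed) /andP[-> h].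
  by rewrite /=; lia.
have [hv|nv] := boolP (P v \in qs).
  left; split; first exact: bfs_walk B _ hv.
  by move=> j /reach /andP[].
right; split; last exact: bfs_inf B _ (P_range v) nv.
by move=> k; apply: contra nv => /reach /andP[].
Qed.

Lemma emit_ok s : static n L Ub P s ->
  wp inp c_emit (fun s' => [/\ forall y, y < n -> out s' (var s vo + y) = arr s aDI (P y) 0,
     forall k, k < var s vo -> out s' k = out s k, var s' vo = var s vo + n &
     tm s' <= tm s + 4 * n + 2]) s.
Proof.
move=> [en eN eNE eN2 [eP _]]; rewrite /c_emit /incr; wsteps.
apply: (@wp_for _ n 4 (fun k s1 => [/\ forall y, y < k -> out s1 (var s vo + y) = arr s aDI (P y) 0,
   forall j, j < var s vo -> out s1 j = out s j & var s1 vo = var s vo + k])) => //=.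
- by move=> s1 F; frs.
- by split; rewrite ?addn0.
- move=> k s1 hk ek [I1 I2 I3] F; wsteps; split; rewrite ?ek ?I3; [by [] | split | by lia].
  + move=> y hy; frs; rewrite eqn_add2l ltnS leq_eqVlt in hy *.
    by case: eqP hy => [->|_] /= hy; [rewrite eP | rewrite I1].
  + by move=> j hj; rewrite ifN ?I2 //; lia.
  + by rewrite addnS.
- by move=> s1 e1 [I1 I2 I3] F T; split; [exact: I1 | exact: I2 | exact: I3 | lia].
Qed.

(** Besides the linear phases: the largest value of [Phi], the rises of all scanned nodes from
    [Psi], and the walks to the root. *)
Definition source_cost : nat :=
  40 * N + 60 * n + 3 * (n.+1 * trunc_log 2 n.+1) +
  14 * (\sum_(q < 2 * N | 0 < q) rises n L Ub q) + n * (4 * L) + 60.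

Lemma source_ok s (x : 'I_n) : static n L Ub P s -> var s vx = x ->
  wp inp c_source (fun s' => [/\
     forall y : 'I_n, is_dist e x y (out s' (var s vo + y)) \/
       (forall k, ~~ walk e x y k) /\ out s' (var s vo + y) = n,
     forall k, k < var s vo -> out s' k = out s k, var s' vo = var s vo + n /\ var s' vx = x.+1 &
     tm s' <= tm s + source_cost]) s.
Proof.
move=> ST ex; rewrite /c_source; apply: wp_seq.
apply: wp_conseq (reset_ok ST) _ => s1 [[Q1 SC1] D1 h1 T1] F1; wsteps.
have ST1 : static n L Ub P s1 by apply: static_frame F1 _ _ _.
have [en eN eNE eN2 [eP _]] := ST1.
have ePx : arr s1 aPOS (var s1 vx) 0 = P x by frs; rewrite ex -eP //; frs.
rewrite ePx; set s2 := St _ _ _ _.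
have [qt0 _ _ _ U1] := Q1.
have V := @visit_ok inp n N s2 (fun y => y \in [::]) (P x) erefl (P_range x) isT U1.
apply: wp_conseq V _ => s3 [U3 D3 A3 qt3 T3] F3; apply: wp_seq.
have B3 : bfs x s3 [:: P x].
  have eh : var s3 vqh = 0 by frs.
  have d0 : arr s3 aDI (P x) 0 = 0 by rewrite D3 eqxx.
  constructor.
  - apply: static_frame F3 _ _ _ => //; by case: ST1.
  - split; first by rewrite qt3 /= qt0.
    + by case=> // _; rewrite A3 /= qt0 eqxx.
    + by [].
    + by move=> y; rewrite inE => /eqP ->; exact: P_range.
    + by apply: eq_uf U3 => // y; rewrite inE.
  - move=> q hq; rewrite (_ : arr s3 aPR = arr s1 aPR); last by frs.
    by move=> nz y hy ty; have := SC1 q hq nz y hy ty.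
  - by rewrite eh.
  - by move=> v; rewrite inE => /eqP /P_inj ->; rewrite d0; exact: walk0.
  - by move=> i j /andP[ij]; rewrite ltnS leqn0 => /eqP j0; move: ij; rewrite j0 leqn0 => /eqP ->.
  - move=> i j /andP[_]; rewrite !ltnS !leqn0 => /eqP -> /eqP ->; exact: leqnSn.
  - by move=> i y; rewrite eh.
  - by move=> y hy; rewrite inE => ne; rewrite D3 (negbTE ne) /=; exact: D1.
  - by rewrite inE eqxx d0.
have T3' : tm s3 <= tm s + 6 * n + 6 * N + 30 + 3 * Phis n N s3.
  by move: T3; rewrite /s2 /=; move: (Phis _ _ _) (Phis _ _ _) => *; lia.
have o3 : out s3 = out s by rewrite (frO F3 isT) /= (frO F1 isT).
have vo3 : var s3 vo = var s vo by frs.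
have vx3 : var s3 vx = x by frs.
move: B3 T3' o3 vo3 vx3 => {D3 A3 qt3 T3 U3 F3 s2} B3 T3' o3 vo3 vx3.
pose I s4 := exists qs, bfs x s4 qs /\
  tm s4 + 3 * Phis n N s3 + 14 * Psi n L Ub s3 <=
  tm s3 + 3 * Phis n N s4 + 14 * Psi n L Ub s4 + 14 * size qs + var s4 vqh * (4 * L + 10).
apply: (@wp_while _ I (fun s4 => n - var s4 vqh)) => /=.
- by exists [:: P x]; split=> //; move: (Phis _ _ _) (Psi _ _ _ _) => *; lia.
- move=> s4 [qs [B4 T4]] F4 lt.
  have Q4 := bfs_queue B4; have [qt4 _ _ _ _] := Q4.
  have sz := size_queue Q4; rewrite qt4 in lt.
  have B4' : bfs x (tick s4) qs by case: B4; constructor.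
  apply: wp_conseq (pop_ok B4' lt) _ => s5 [ns [B5 h5 T5]] _; split; last by rewrite h5 /=; lia.
  exists (qs ++ ns); split=> //; rewrite h5 size_cat /=.
  move: T4 T5; have -> : Phis n N (tick s4) = Phis n N s4 by [].
  have -> : Psi n L Ub (tick s4) = Psi n L Ub s4 by [].
  rewrite [tm (tick s4)]/= (mulSn (var s4 vqh)); move: (Phis _ _ _) (Phis _ _ _) (Phis _ _ _) (Psi _ _ _ _) (Psi _ _ _ _) (Psi _ _ _ _) (var s4 vqh * _) => *; lia.
move=> s4 [qs [B4 T4]] F4 ge; wsteps.
have Q4 := bfs_queue B4; have [qt4 _ _ _ _] := Q4.
have sz := size_queue Q4; rewrite qt4 in ge.
have eh : var s4 vqh = size qs by apply/eqP; rewrite eqn_leq ge (bfs_head B4).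
have ST4 : static n L Ub P (tick s4) by exact: (bfs_static B4).
apply: wp_conseq (emit_ok ST4) _ => s5 [E5 K5 V5 T5] F5; wsteps.
have vo4 : var s4 vo = var s vo by rewrite -vo3; frs.
have vx5 : var s5 vx = x by frs.
rewrite /= vo4 in E5 K5 V5 T5; rewrite /incr; wsteps; split.
- by move=> y; rewrite E5 //; exact: bfs_dist B4 eh.
- by move=> k hk; rewrite K5 // (frO F4 isT) o3.
- by rewrite V5 vx5.
have P4 := Phi_le Q4; have S4 := Psi_le s4.
rewrite rises0 add0n in S4; rewrite eh in T4.
have sL : size qs * (4 * L + 10) <= n * (4 * L + 10) by rewrite leq_mul2r sz orbT.
have dist a : a * (4 * L + 10) = a * (4 * L) + 10 * a by rewrite mulnDr (mulnC a 10).
rewrite !dist in sL T4.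
move: P4 S4 T3' T4 T5 sL sz; rewrite /source_cost.
move: (n.+1 * _) (Phis _ _ _) (Phis _ _ _) (Psi _ _ _ _) (Psi _ _ _ _) (\sum_(_ < _ | _) _).
move: (n * (4 * L)) (size qs * (4 * L)) => *; lia.
Qed.

Lemma all_ok s : static n L Ub P s ->
  wp inp c_all (fun s' => (forall x y : 'I_n, is_dist e x y (out s' (x * n + y)) \/
       (forall k, ~~ walk e x y k) /\ out s' (x * n + y) = n) /\
     tm s' <= tm s + n * source_cost.+1 + 3) s.
Proof.
move=> ST; rewrite /c_all; wsteps.
pose I k s1 := [/\ static n L Ub P s1, var s1 vo = k * n &
  forall x y : 'I_n, x < k -> is_dist e x y (out s1 (x * n + y)) \/
       (forall k, ~~ walk e x y k) /\ out s1 (x * n + y) = n].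
have [en _ _ _ _] := ST.
apply: (@wp_for _ n source_cost.+1 I) => //=.
- by move=> s1 F; frs.
- move=> k s1 hk ek [ST1 eo H1] F.
  have C := @source_ok (tick s1) (Ordinal hk) ST1 ek.
  apply: wp_conseq C _ => s2 [H2 K2 [V2 X2] T2] F2; split; [exact: X2 | split | by move: T2 => /=; lia].
  + by apply: static_frame F2 _ _ _.
  + by rewrite V2 /= eo mulSn addnC.
  + move=> x y; rewrite ltnS leq_eqVlt => /orP[/eqP ex|lt].
      have -> : x = Ordinal hk by apply: val_inj.
      by have := H2 y; rewrite /= eo.
    rewrite K2 /= ?eo; first exact: H1.
    by have := ltn_ord y; nia.
- by move=> s1 e1 [ST1 eo H1] F T; split; [move=> x y; exact: H1 | lia].
Qed.

End BFS.

(** * The whole program on the encoded input *)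

Definition c_load : cmd :=
  vn ::= EInp #0 ;; vl ::= EInp #1 ;; vnn ::= vn ;; vp ::= #2 ;; c_leaves.

Definition c_main : cmd :=
  c_load ;; c_ops ;; c_roots ;; c_table ;; c_pow ;; c_pos ;; c_ends ;; c_fill ;;
  c_heap ;; c_next ;; c_all.

Definition s_init : st := St (fun=> 0) (fun _ _ _ => 0) (fun=> 0) 0.

Lemma nth_input n (ops : seq (op 'I_n)) (o : op 'I_n) i j : i < size ops -> j < 3 ->
  nth 0 (input ops) (2 + 3 * i + j) = nth 0 (op_code (nth o ops i)) j.
Proof.
rewrite /input => hi hj; rewrite (_ : 2 + 3 * i + j = (3 * i + j).+2) /=; last by lia.
elim: ops i hi => //= o' ops IH [|i] hi; rewrite nth_cat; case: o' => [[k a] b] /=.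
  by rewrite muln0 add0n hj.
by rewrite ifN; [rewrite -IH //; congr nth; lia | lia].
Qed.

Lemma size_input n (ops : seq (op 'I_n)) : size (input ops) = 2 + 3 * size ops.
Proof.
rewrite /= size_flatten; congr _.+2; elim: ops => //= o ops ->.
by case: o => [[k a] b] /=; lia.
Qed.

Lemma input_le n (ops : seq (op 'I_n)) i : nth 0 (input ops) i <= n + size ops + 2.
Proof.
have [lt|ge] := ltnP i (size (input ops)); last by rewrite nth_default.
move: lt; rewrite size_input; case: i => [|[|i]] /=; [lia | lia | move=> lt].
have hi : i %/ 3 < size ops by lia.
have [o _] : exists o : op 'I_n, True.
  by case: ops lt hi => [|o ops] // _ _; exists o.
have := nth_input o hi (ltn_pmod i (isT : 0 < 3)).
have -> : 2 + 3 * (i %/ 3) + i %% 3 = i.+2 by have := divn_eq i 3; lia.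
rewrite /= => ->; case: (nth o ops _) => [[k a] b].
case: (i %% 3) => [|[|[|j]]] /=; rewrite ?nth_nil; have := ltn_ord a; have := ltn_ord b; try lia.
by case: k => /=; lia.
Qed.

Lemma take_input n (ops : seq (op 'I_n)) i : i < size ops -> exists o : op 'I_n,
  let inp := nth 0 (input ops) in
  [/\ take i.+1 ops = rcons (take i ops) o, inp (2 + 3 * i) = code o,
      inp (2 + 3 * i).+1 = o.1.2 & inp (2 + 3 * i).+2 = o.2].
Proof.
move=> hi; have [o0 _] : exists o : op 'I_n, True by case: ops hi => [|o ops] // _; exists o.
exists (nth o0 ops i); split; first by rewrite (take_nth o0).
- by have := nth_input o0 hi (isT : 0 < 3); rewrite addn0 => ->; case: (nth o0 ops i) => [[? ?] ?].
- by have := nth_input o0 hi (isT : 1 < 3); rewrite addn1 => ->; case: (nth o0 ops i) => [[? ?] ?].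
- by have := nth_input o0 hi (isT : 2 < 3); rewrite addn2 => ->; case: (nth o0 ops i) => [[? ?] ?].
Qed.

Section Main.

Variables (n : nat) (e : rel 'I_n) (cs : seq (state 'I_n)) (ops : seq (op 'I_n)) (d : nat).
Hypotheses (e_sym : symmetric e) (e_irr : irreflexive e).
Hypotheses (hcs : construction_sequence e cs) (hdes : describes ops cs) (hd : width 1 cs = d).

Let inp := nth 0 (input ops).
Let m := final (minit n) ops.

Definition rank_sum (G : nat -> nat -> nat) (x : nat) : nat := \sum_(y < n) (0 < G y x).

Lemma rank_sumE G x : rank_sum G x = rank n (fun i j => 0 < G i j) x.
Proof.
rewrite /rank_sum /rank -sum1_card [RHS]big_mkcond /=; apply: eq_bigr => y _.
by rewrite inE; case: (0 < _).
Qed.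

Definition total_cost (L E : nat) : nat :=
  let N := 2 ^ L in
  11 * size ops + n * (5 * n + 5) + 2 * n * (22 * n + 8) + 10 * N + n * (9 * n + 20) +
  N * (17 * n + 20) + 30 +
  n * (41 * N + 60 * n + 3 * (n.+1 * trunc_log 2 n.+1) + 14 * ((16 * L + 20) * E) + n * (4 * L) + 60).

Lemma main_ok :
  wp inp c_main (fun s' =>
    (forall x y : 'I_n, is_dist e x y (out s' (x * n + y)) \/
       (forall k, ~~ walk e x y k) /\ out s' (x * n + y) = n) /\
    exists2 L, 0 < L -> 2 ^ L.-1 < n & tm s' <= total_cost L (esum (minit n) ops (@eff n))) s_init.
Proof.
have wm : wf n m by apply/wf_final/wf_init.
have nn2 : nn m <= n + n by have := nn_le hcs hdes hd (leqnn _); rewrite take_size.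
have nn1 : n <= nn m by exact: wf_nn wm.
rewrite /c_main /c_load; wsteps.
apply: wp_conseq (leaves_ok inp (n := n) _) _ => //= s1 [H1 T1] F1; apply: wp_seq.
have R1 : mrep n (minit n) s1 by split; frs.
apply: wp_conseq (ops_ok (inp := inp) (@take_input n ops) R1 _ _ _) _; [by frs | by frs | by frs |].
move=> s2 [R2 T2] F2; apply: wp_seq; rewrite -/m in R2 T2.
apply: wp_conseq (roots_ok inp R2) _ => s3 [H3 T3] F3; apply: wp_seq.
have [en2 enn2 _ _ eopc2] := R2.
have en : var s3 vn = n by frs.
apply: wp_conseq (table_ok inp (s := s3) wm _ H3 _ _) _; [by frs | by move=> i j; frs | by frs |].
move=> s4 [TF TG T4] F4; apply: wp_seq.
have en4 : var s4 vn = n by frs.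
apply: wp_conseq (pow_ok inp en4) _ => s5 [L [eN nL Lmin T5]] F5; apply: wp_seq.
have en5 : var s5 vn = n by frs.
apply: wp_conseq (pos_ok inp en5 eN) _ => s6 [H6 T6] F6; apply: wp_seq.
have en6 : var s6 vn = n by frs.
have eN6 : var s6 vN = 2 ^ L by frs.
apply: wp_conseq (ends_ok inp en6 eN6) _ => s7 [eNE eN2 T7] F7; apply: wp_seq.
have en7 : var s7 vn = n by frs.
pose G i j := 0 < arr s4 aG i j.
pose P := pos_of n G L.
have eP x : x < n -> arr s7 aPOS x 0 = P x.
  by move=> hx; frs; rewrite H6 // /P /pos_of -rank_sumE /rank_sum; frs.
apply: wp_conseq (fill_ok inp en7 eP _) _; first by move=> i j; frs.
move=> s8 [H8 T8] F8; apply: wp_seq.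
have eN8 : var s8 vN = 2 ^ L by frs.
have eNE8 : var s8 vNE = 2 ^ L + n by frs.
have eN28 : var s8 vN2 = 2 * 2 ^ L by frs.
have N0 : 0 < 2 ^ L by rewrite expn_gt0.
have Pr (x : 'I_n) : 2 ^ L <= P x < 2 ^ L + n by exact: (pos_ltn L TG).
have Pi (x y : 'I_n) : P x = P y -> x = y by exact: (pos_inj TG).
have Ps y : 2 ^ L <= y < 2 ^ L + n -> exists x : 'I_n, P x = y by exact: (pos_surj TG nL).
apply: wp_conseq (heap_ok inp N0 eN8 eNE8 eN28 _) _.
  move=> q y hq; rewrite H8; case: existsP => // -[x /existsP[z /and3P[/eqP h _ _]]].
  by have := Pr x; lia.
move=> s9 [H9 Z9 K9 T9] F9; apply: wp_seq.
have eN9 : var s9 vN = 2 ^ L by frs.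
have eNE9 : var s9 vNE = 2 ^ L + n by frs.
have eN29 : var s9 vN2 = 2 * 2 ^ L by frs.
apply: wp_conseq (next_ok inp N0 eN9 eNE9 eN29) _ => s10 [H10 T10] F10.
(* The recursion for U is available only at columns that are positions of vertices; switching off
   the other columns makes it hold for all of them. *)
pose Ub q y := (2 ^ L <= y < 2 ^ L + n) && (0 < arr s9 aU q y).
have UP q (y : 'I_n) : Ub q (P y) = (0 < arr s9 aU q (P y)) by rewrite /Ub Pr.
have Fxy (x y : 'I_n) : arr s7 aF x y = fc (minit n) ops x y.
  by have := tabF_fc (m := minit n) x y (wf_init n) TF; rewrite /=; frs.
have Uleaf (x y : 'I_n) : Ub (P x) (P y) = (fc (minit n) ops x y == 1).
  rewrite UP K9; last by case/andP: (Pr x).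
  rewrite H8 -Fxy; case: existsP => [[x' /existsP[y' /and3P[/eqP/Pi -> /eqP/Pi -> ->]]] //|h] /=.
  apply/esym/negbTE/negP => h1; case: h; exists x; apply/existsP; exists y.
  by rewrite !eqxx.
have Upad c y : 2 ^ L + n <= c < 2 * 2 ^ L -> Ub c y = false.
  move=> hc; rewrite /Ub K9; last by lia.
  rewrite H8; case: existsP => [[x /existsP[z /and3P[/eqP h _ _]]]|_]; last by rewrite andbF.
  by have := Pr x; lia.
have Unode q y : 0 < q < 2 ^ L -> Ub q y = Ub (2 * q) y && Ub (2 * q).+1 y.
  by move=> hq; rewrite /Ub; case hy: (2 ^ L <= y < 2 ^ L + n) => //=; rewrite H9.
have U0 y : Ub 0 y = false by rewrite /Ub Z9 andbF.
have Ue (v w : 'I_n) : v != w -> Ub (P v) (P w) = e v w.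
  by move=> ne; rewrite Uleaf (edge_fc e_sym hcs hdes hd).
have ST : static n L Ub P s10.
  split; try by frs.
  split; first by move=> x hx; frs; rewrite -eP //; frs.
  move=> q y hq hy; have [h1 h2 h3] := H10 q y hq hy; split=> //.
    by move=> w hw; rewrite /top /Ub (_ : 2 ^ L <= w < 2 ^ L + n) //=; [exact: h2 | lia].
  move=> hz; rewrite /top /Ub (_ : 2 ^ L <= _ < 2 ^ L + n) //=; [exact: h3 | lia].
have RS := rises_le TG nL Uleaf Upad Unode U0.
apply: wp_conseq (all_ok inp (e := e) nL U0 (fun q y h _ => Unode q y h) Pi Pr Ps Ue e_irr ST) _.
move=> s11 [H11 T11] F11; split; first exact: H11.
exists L; first exact: Lmin.
have k1 : (nn m - n) * (5 * n + 5) <= n * (5 * n + 5) by rewrite leq_mul2r; lia.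
have k2 : nn m * (11 * nn m + 4) <= 2 * n * (22 * n + 4).
  by apply: leq_mul; lia.
have k3 : n * (source_cost n L Ub).+1 <= n * (41 * 2 ^ L + 60 * n + 3 * (n.+1 * trunc_log 2 n.+1) +
    14 * ((16 * L + 20) * esum (minit n) ops (@eff n)) + n * (4 * L) + 60).
  rewrite leq_mul2l /source_cost; apply/orP; right.
  by move: RS; move: (\sum_(_ < _ | _) _) (_ * esum _ _ _) (n.+1 * _) (n * (4 * L)) => *; lia.
rewrite /total_cost; move: k1 k2 k3 nn2 T1 T2 T3 T4 T5 T6 T7 T8 T9 T10 T11.
move: (n * (41 * _ + _ + _ + _ + _ + _)) (n * (source_cost _ _ _).+1) => a1 a2.
move: (nn m) => q; move: (2 ^ L) => N.
move: ((q - n) * _) (q * (11 * q + 4)) => a3 a4.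
by clear; move=> *; lia.
Qed.

End Main.

(** * Laying out the memory of the machine *)

Lemma lwp_weaken W p m T (Q Q' : store -> Prop) :
  lwp W p m T Q -> (forall m', Q m' -> Q' m') -> lwp W p m T Q'.
Proof. by move=> [t [m' [h1 h2 h3]]] h; exists t, m'; split=> //; exact: h. Qed.

Definition p_power (k : nat) : prog := iter k (fun p => Seq p (Arith Mul 4 4 8)) (Const 4 1).

(** With [X] for [n] plus the number of steps plus 2, the stride in register 4 becomes [X ^ k], so
    each of the 14 arrays has [X ^ k] rows and columns. The output follows the arrays, and its
    address is left in register 0. *)
Definition p_prelude (k : nat) : prog :=
  Seq (Const 8 0) (Seq (Read 8 8) (Seq (Const 10 1) (Seq (Read 10 10)
  (Seq (Const 2 3) (Seq (Arith Mul 2 2 10) (Seq (Const 12 2) (Seq (Arith Add 2 2 12)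
  (Seq (Arith Add 8 8 10) (Seq (Arith Add 8 8 12)
  (Seq (p_power k)
  (Seq (Const 6 14) (Seq (Arith Mul 0 4 4) (Seq (Arith Mul 0 0 6) (Arith Add 0 0 2)))))))))))))).

Lemma power_ok W k m X : reg m 8 = X -> X ^ k < W -> 0 < X ->
  lwp W (p_power k) m k.+1 (fun m' => [/\ mem m' = mem m, reg m' 4 = X ^ k &
    forall q, q != 4 -> reg m' q = reg m q]).
Proof.
move=> e + X0; elim: k => [|k IH] lt /=.
  by apply: lwp_const => //; split=> // q; rewrite /= /upd => /negbTE ->.
have lt' : X ^ k < W by apply: leq_ltn_trans lt; rewrite expnS leq_pmull.
have -> : k.+2 = k.+1 + 1 by rewrite addn1.
apply: lwp_seq; apply: lwp_weaken (IH lt') _ => m1 [e1 e2 e3].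
apply: lwp_arith; rewrite /= e2 (e3 8) // e -expnSr //.
by split=> //= q ne; rewrite (negbTE ne) e3.
Qed.

Lemma prelude_ok n (ops : seq (op 'I_n)) W k :
  let X := n + size ops + 2 in let base := 2 + 3 * size ops in
  let outb := base + X ^ k * X ^ k * 14 in
  outb < W -> 3 * X + 14 < W -> X ^ k * X ^ k * 14 < W ->
  lwp W (p_prelude k) (initial_store (input ops)) (k + 15)
    (repr (nth 0 (input ops)) base 14 (X ^ k).-1 outb s_init).
Proof.
move=> X base outb h1 h2 h3.
have X0 : 0 < X by rewrite /X addn2.
have Xk : 0 < X ^ k by rewrite expn_gt0 X0.
have le1 : X ^ k * X ^ k <= X ^ k * X ^ k * 14 by rewrite leq_pmulr.
have le2 : X ^ k <= X ^ k * X ^ k by rewrite leq_pmulr.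
rewrite /p_prelude.
have -> : k + 15 = 1 + (1 + (1 + (1 + (1 + (1 + (1 + (1 + (1 + (1 + (k.+1 + (1 + (1 + (1 + 1))))))))))))) by lia.
have nX : n + size ops + 2 = X by [].
have bE : 3 * size ops + 2 = base by rewrite addnC.
do 10! [apply: lwp_seq; (apply: lwp_const || apply: lwp_read || apply: lwp_arith);
  rewrite /= /upd /=; first by rewrite /X in h2; lia].
apply: lwp_seq; apply: (lwp_weaken (power_ok (X := X) _ _ _)); rewrite /= ?/upd //=; first by lia.
move=> m1 [em e4 er].
apply: lwp_seq; apply: lwp_const; first by lia.
apply: lwp_seq; apply: lwp_arith; rewrite /= /upd /= e4; first by lia.
apply: lwp_seq; apply: lwp_arith; rewrite /= /upd /=; first by lia.
apply: lwp_arith; rewrite /= /upd /= er //= bE; first by rewrite addnC.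
have mE i : base <= i -> nth 0 (input ops) i = 0.
  by move=> h; rewrite nth_default // size_input.
split=> /=.
- move=> x; have o q : ~~ odd q -> (vreg x == q) = false by move=> ho; rewrite eq_sym vreg_odd.
  by rewrite !o // er ?o //= /upd !o.
- by rewrite (er 2) //= e4 prednK //; split=> //; rewrite addnC.
- by move=> a i j _ _ _; rewrite em mE // /addr leq_addl.
- by move=> i _; rewrite em.
- by move=> i _; rewrite em mE // /outb; lia.
Qed.

(** * Arithmetic of the time and word bounds *)

Lemma trunc_log_le m : trunc_log 2 m <= m.
Proof.
case: m => [|m]; first by rewrite trunc_log0.
exact: leq_trans (ltnW (ltn_expl _ (isT : 1 < 2))) (trunc_logP _ _).
Qed.


Lemma total_cost_mono n (ops : seq (op 'I_n)) L E n' S' N' T' L' E' :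
  n <= n' -> size ops <= S' -> 2 ^ L <= N' -> n.+1 * trunc_log 2 n.+1 <= T' -> L <= L' -> E <= E' ->
  total_cost ops L E <= 11 * S' + n' * (5 * n' + 5) + 2 * n' * (22 * n' + 8) + 10 * N' +
    n' * (9 * n' + 20) + N' * (17 * n' + 20) + 30 +
    n' * (41 * N' + 60 * n' + 3 * T' + 14 * ((16 * L' + 20) * E') + n' * (4 * L') + 60).
Proof.
move=> h1 h2 h3 h4 h5 h6; rewrite /total_cost.
by repeat (apply: leq_add || apply: leq_mul).
Qed.

(** This bound is for the word size. It must be in terms of [n] and the number of steps alone and
    hold for every [n], so effective steps are estimated by all steps. *)
Lemma cost_poly n (ops : seq (op 'I_n)) L E : (0 < L -> 2 ^ L.-1 < n) -> E <= size ops ->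
  total_cost ops L E <= 2000 * (n + size ops + 2) ^ 3.
Proof.
move=> hL hE; have hT := trunc_log_le n.+1.
have [X [eX X2]] : exists X, n + size ops + 2 = X /\ 0 < X by exists (n + size ops + 2); split; lia.
have hN : 2 ^ L <= 2 * X.
  by case: L hL => [|L] hL; [rewrite expn0; lia | rewrite expnS leq_mul2l /= (leq_trans (ltnW (hL isT))) //; lia].
have hL' : L <= X.
  case: L hL {hN} => // L hL; have := hL isT; have := ltn_expl L (isT : 1 < 2); rewrite /=; lia.
have hT' : n.+1 * trunc_log 2 n.+1 <= X * X by apply: leq_mul; lia.
rewrite eX; apply: leq_trans (total_cost_mono (n' := X) (S' := X) _ _ hN hT' hL' (_ : E <= X)) _; [lia | lia | lia |].
have e3 : X ^ 3 = X * X * X by rewrite !expnS expn0 muln1 mulnA.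
rewrite e3; have k1 : X <= X * X by rewrite leq_pmulr.
have k2 : X * X <= X * X * X by rewrite leq_pmulr.
have -> : X * (41 * (2 * X) + 60 * X + 3 * (X * X) + 14 * ((16 * X + 20) * X) + X * (4 * X) + 60) =
  142 * (X * X) + 231 * (X * X * X) + 280 * (X * X) + 60 * X by lia.
have -> : X * (5 * X + 5) = 5 * (X * X) + 5 * X by lia.
have -> : 2 * X * (22 * X + 8) = 44 * (X * X) + 16 * X by lia.
have -> : X * (9 * X + 20) = 9 * (X * X) + 20 * X by lia.
have -> : 2 * X * (17 * X + 20) = 34 * (X * X) + 40 * X by lia.
by move: (X * X * X) (X * X) k1 k2 => a b k1 k2; clear -k1 k2 X2; lia.
Qed.

(** The dominant term comes from [n] sources with [O(L * E)] rises each, where [E] is O(d n). Since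
    [2 ^ L] is less than [2 * n] for positive [L], both [L] and the logarithm of [n.+1] are at most
    twice that of [n]. *)
Lemma cost_log n (ops : seq (op 'I_n)) L E d I : (0 < L -> 2 ^ L.-1 < n) -> 1 < n -> 0 < d ->
  E <= 5 * d * n -> size ops <= n + E + I ->
  total_cost ops L E <= 5000 * (d * n ^ 2 * trunc_log 2 n + I).
Proof.
move=> hL n1 d0 hE hS; set t := trunc_log 2 n.
have t0 : 0 < t by rewrite /t trunc_log_gt0.
have tn : n < 2 ^ t.+1 by exact: trunc_log_ltn.
have hN : 2 ^ L <= 2 * n.
  by case: L hL => [|L] hL; [rewrite expn0; lia | rewrite expnS leq_mul2l /= (ltnW (hL isT))].
have hL' : L <= 2 * t.
  case: L hL {hN} => // L hL; have lt : 2 ^ L < 2 ^ t.+1 by apply: ltn_trans tn; exact: hL.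
  by move: lt; rewrite ltn_exp2l // => lt; clear -lt t0; lia.
have hT : n.+1 * trunc_log 2 n.+1 <= 2 * n * (2 * t).
  apply: leq_mul; first by clear -n1; lia.
  have : 2 ^ trunc_log 2 n.+1 <= 2 ^ t.+1 by apply: leq_trans (trunc_logP _ _) tn.
  by rewrite leq_exp2l // => h; clear -h t0; lia.
have hS' : size ops <= n + 5 * d * n + I by clear -hE hS; lia.
apply: leq_trans (total_cost_mono (leqnn n) hS' hN hT hL' hE) _.
move: t t0 {tn hN hL' hT} => t t0; clear -n1 d0 t0.
have e2 : n ^ 2 = n * n by rewrite !expnS expn0 muln1.
rewrite e2.
have -> : n * (41 * (2 * n) + 60 * n + 3 * (2 * n * (2 * t)) + 14 * ((16 * (2 * t) + 20) * (5 * d * n)) + n * (4 * (2 * t)) + 60) =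
  142 * (n * n) + 20 * (n * n * t) + 2240 * (d * (n * n) * t) + 1400 * (d * (n * n)) + 60 * n by lia.
have -> : n * (5 * n + 5) = 5 * (n * n) + 5 * n by lia.
have -> : 2 * n * (22 * n + 8) = 44 * (n * n) + 16 * n by lia.
have -> : n * (9 * n + 20) = 9 * (n * n) + 20 * n by lia.
have -> : 2 * n * (17 * n + 20) = 34 * (n * n) + 40 * n by lia.
have k1 : n <= n * n by rewrite leq_pmulr // ltnW.
have k2 : n * n * t <= d * (n * n) * t by rewrite leq_mul2r leq_pmull ?orbT.
have k3 : d * (n * n) <= d * (n * n) * t by rewrite leq_pmulr.
have k4 : n * n <= d * (n * n) by rewrite leq_pmull.
have k5 : 5 * d * n <= 5 * (d * (n * n)) by rewrite -mulnA !leq_mul2l k1 orbT.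
move: (d * (n * n) * t) k2 k3 => a; move: (n * n * t) => b k2 k3.
move: (d * (n * n)) (5 * d * n) k3 k4 k5 => a' b' k3 k4 k5; move: (n * n) k1 k4 => b'' k1 k4.
by lia.
Qed.

Lemma esum_eff_le n (m : model) ops : esum m ops (@eff n) <= size ops.
Proof. by elim: ops m => //= o ops IH m; have := IH (mstep m o); case: (eff m o) => /=; lia. Qed.

Lemma width_gt0 n (e : rel 'I_n) cs : 0 < n -> construction_sequence e cs -> 0 < width 1 cs.
Proof.
move=> n0 [h _ _]; rewrite h /width big_cons leq_max; apply/orP; left.
pose v := Ordinal n0; apply: leq_trans (leq_bigmax v).
rewrite card_gt0; apply/set0Pn; exists [set v]; rewrite inE imset_f //=.
apply/set0Pn; exists v; rewrite !inE eqxx /=.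
by apply/existsP; exists ord0; apply/existsP; exists [tuple]; rewrite /= eqxx.
Qed.

(** The factor [Z] disappears in [X ^ Z], as [X] is at least 2. The three estimates make room for
    all values of the run, for the indices of the output, and for all addresses; the additional
    exponent 5 yields the factor 32, enough for 14 arrays and the rest. *)
Lemma word_room (X Z k : nat) : 1 < X -> k = Z + 4 ->
  [/\ X + Z * X ^ 3 < X ^ k, X * X <= X ^ k & 3 * X + X ^ k * X ^ k * 14 + X ^ k + 14 < X ^ (2 * k + 5)].
Proof.
move=> X1 ek; set Y := X ^ k.
have X0 : 0 < X by exact: ltnW.
have hZ : Z < X ^ Z by apply: ltn_expl.
have Y1 : X ^ 4 * Z.+1 <= Y by rewrite /Y ek addnC expnD leq_mul2l hZ orbT.
have h4 : X ^ 3 < X ^ 4 by rewrite ltn_exp2l.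
have h1 : X <= X ^ 3 by rewrite -[X in X <= _]expn1 leq_exp2l.
have h2 : X * X <= X ^ 4 by rewrite mulnn leq_exp2l.
have h5 : X ^ 4 <= Y by rewrite (leq_trans _ Y1) // leq_pmulr.
have h6 : Z * X ^ 3 <= Z * X ^ 4 by rewrite leq_mul2l (ltnW h4) orbT.
split; [lia | lia |].
have h7 : 2 ^ 5 <= X ^ 5 by rewrite leq_exp2r.
have -> : X ^ (2 * k + 5) = Y * Y * X ^ 5 by rewrite expnD mulnC mul2n -addnn expnD mulnC.
have h8 : Y * Y * 32 <= Y * Y * X ^ 5 by rewrite leq_mul2l h7 orbT.
have h9 : Y <= Y * Y by rewrite leq_pmulr //; lia.
have h10 : 1 < Y by lia.
apply: leq_trans h8.
by move: (Y * Y) h9 h1 h4 h5 => q *; clear hZ; lia.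
Qed.

Theorem theorem1p8 :
  exists (p : prog) (c C : nat),
  forall (n : nat) (e : rel 'I_n) (cs : seq (state 'I_n)) (ops : seq (op 'I_n)) (d : nat),
    symmetric e -> irreflexive e ->
    construction_sequence e cs -> describes ops cs ->
    width 1 cs = d ->
    exists (t : nat) (s : store),
      [/\ exec (word_bound ops c) p (initial_store (input ops)) t s,
          holds_distances e s
        & 1 < n -> t <= C * (d * n ^ 2 * trunc_log 2 n + idle_steps cs)].
Proof.
have [Z cZ] : exists Z, csize c_main <= Z by exists (csize c_main).
have ca : carrays 14 c_main by [].
have [q eq] : exists q, q = 2000 by exists 2000.
have [q' eq'] : exists q', q' = 5000 by exists 5000.
(* Values grow by at most [Z] per unit of time and the time is at most [q * X ^ 3], so [X ^ k]
   exceeds every value that occurs. *)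
pose k := Z * q + 4.
exists (Seq (p_prelude k) (compile c_main)), (2 * k + 5), ((k + 15) + 12 * Z * q').
move=> n e cs ops d e_sym e_irr hcs hdes hd.
have [s' R [H [L hL T]]] := main_ok e_sym e_irr hcs hdes hd.
have hE := esum_eff_le (minit n) ops.
have hE5 := effs_bound hcs hdes hd; have hS := size_ops_le hcs hdes hd.
rewrite /effs take_size in hE5 hS.
have Tp := leq_trans T (cost_poly hL hE); rewrite -eq in Tp.
have Tl : 1 < n -> tm s' <= q' * (d * n ^ 2 * trunc_log 2 n + idle_steps cs).
  move=> n1; apply: leq_trans T _; rewrite eq'; apply: cost_log => //.
  by rewrite -hd; apply: width_gt0 hcs; exact: ltnW.
have [X eX] : exists X, n + size ops + 2 = X by exists (n + size ops + 2).
rewrite /word_bound eX; rewrite eX in Tp.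
have X1 : 1 < X by rewrite -eX addn2.
have [r1 r2 r3] := word_room (k := k) X1 (erefl _).
move: (X ^ (2 * k + 5)) r3 => W r3.
(* The polynomial bound shows that the compiled run fits into words; the sharper bound [Tl] is used
   only for the running time. *)
have hZ : Z * tm s' <= Z * q * X ^ 3 by rewrite -mulnA leq_mul2l Tp orbT.
have base_le : 2 + 3 * size ops <= 3 * X by clear -eX; lia.
have P := @prelude_ok n ops W k; rewrite /= eX in P.
have {P} [||| t1 [m1 [E1 T1 R1]]] := P; [by clear -r3 base_le; lia | by clear -r3; lia | by clear -r3; lia |].
have Y0 : 0 < X ^ k by rewrite expn_gt0 ltnW.
have hout i : 2 + 3 * size ops <= i -> nth 0 (input ops) i = 0.
  by move=> h; rewrite nth_default // size_input.
have ge : addr (2 + 3 * size ops) 14 (X ^ k).-1 0 (X ^ k).-1.+1 0 <= 2 + 3 * size ops + X ^ k * X ^ k * 14.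
  by rewrite /addr prednK // !addn0 addnC.
have lt : 2 + 3 * size ops + X ^ k * X ^ k * 14 + (X ^ k).-1.+2 < W.
  by rewrite prednK //; clear -r3 base_le; lia.
have hi i : nth 0 (input ops) i <= X by rewrite -eX; exact: input_le.
have bd : X + Z * tm s' <= (X ^ k).-1 by rewrite -ltnS prednK //; clear -r1 hZ; lia.
have b0 : bounded s_init (X + Z * tm s_init) by split.
have [t2 [m2 [E2 T2 [R2 _]]]] := compile_correct (isT : 0 < 14) hout ge lt R cZ ca hi bd R1 b0.
exists (t1 + t2), m2; split; first exact: exec_seq E1 E2.
- move=> x y; have [_ [-> _ _ _] _ _ eo] := R2.
  rewrite -addnA eo //.
  have le : x * n + y < n * n by have := ltn_ord x; have := ltn_ord y; clear; nia.
  have le2 : n * n <= X * X by apply: leq_mul; clear -eX; lia.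
  by rewrite -ltnS prednK //; clear -le le2 r2; lia.
move=> n1; have {}Tl := Tl n1.
have d0 : 0 < d by rewrite -hd; apply: width_gt0 hcs; exact: ltnW.
have pos : 0 < d * n ^ 2 * trunc_log 2 n by rewrite 2!muln_gt0 d0 expn_gt0 trunc_log_gt0 n1 (ltnW n1).
rewrite mulnDl; apply: leq_add; first by rewrite (leq_trans T1) // leq_pmulr // addn_gt0 pos.
by apply: leq_trans T2 _; rewrite subn0 -(mulnA (12 * Z)) leq_mul2l Tl orbT.
Qed.
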